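(* Let $B=2^{k_1}C_1\perp\cdots\perp2^{k_r}C_r\in\mathcal H_n(\mathfrak o)$ be a pre-optimal form, and write $\mathrm{GK}(B)=(\underbrace{m_1,\ldots,m_1}_{n_1},\ldots,\underbrace{m_s,\ldots,m_s}_{n_s})$ with $m_1<\cdots<m_s$ and $n=n_1+\cdots+n_s$; put $n_j^*=n_1+\cdots+n_j$. Then: (1) for every $1\le j\le s$ there is an integer $1\le l_j\le r$ such that $B^{(n_j^* )}=B^{[l_j]}$ (i.e. $n_j^*=\deg C_1+\cdots+\deg C_{l_j}$); (2) defining $\zeta_j=\eta_{B^{[l_j]}}$ if $n_j^*$ is odd and $\zeta_j=\xi_{B^{[l_j]}}$ if $n_j^*$ is even, we have $\mathrm{EGK}(B)=(n_1,\ldots,n_s;m_1,\ldots,m_s;\zeta_1,\ldots,\zeta_s)$.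
   Context: Let $F$ be a finite unramified extension of $\mathbb Q_2$ with ring of integers $\mathfrak o$, $\mathrm{ord}$ the valuation with $\mathrm{ord}(2)=1$, $\mathrm{ord}(0)=+\infty$. $\mathcal H_n(\mathfrak o)$ is the set of symmetric $B=(b_{ij})\in M_n(F)$ with $b_{ii}\in\mathfrak o$, $2b_{ij}\in\mathfrak o$; nondegenerate means $\det B\ne0$. $B^{(m)}$ is the upper-left $m\times m$ submatrix; $\perp$ is block-diagonal sum; $B\sim B'$ means $B'={}^tUBU$ with $U\in GL_n(\mathfrak o)$. For nondegenerate $B$ of degree $n$: $D_B=(-4)^{[n/2]}\det B$; $\xi_B=1,-1,0$ according as $D_B\in F^{\times2}$, $F(\sqrt{D_B})/F$ is unramified quadratic, or ramified; if $B$ is $GL_n(F)$-equivalent to $\mathrm{diag}(b_1',\dots,b_n')$, $\eta_B=\langle-1,-1\rangle^{[(n+1)/4]}\langle-1,\det B\rangle^{[(n-1)/2]}\prod_{i<j}\langle b_i',b_j'\rangle$ (Hilbert symbols; this is the Clifford invariant). $S_2(\mathfrak o)_e$: symmetric $2\times2$ matrices over $\mathfrak o$ with diagonal in $2\mathfrak o$; unimodular diagonal: diagonal with unit entries. GK invariant: $S(B)$ is the set of non-decreasing $(a_i)\in\mathbb Z_{\ge0}^n$ with $\mathrm{ord}(b_{ii})\ge a_i$ and $\mathrm{ord}(2b_{ij})\ge(a_i+a_j)/2$ ($i\le j$); $\mathbf S(\{B\})=\bigcup_{U\in GL_n(\mathfrak o)}S({}^tUBU)$; $\mathrm{GK}(B)$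 is its lexicographically greatest element; $B$ is optimal if $\mathrm{GK}(B)\in S(B)$. Extended GK datum: for nondegenerate $B$, choose optimal $B'\sim B$, write $\mathrm{GK}(B')=(m_1^{(n_1)},\dots,m_t^{(n_t)})$ ($m_1<\dots<m_t$, multiplicities $n_i$), $n_u^*=n_1+\dots+n_u$, $\zeta_u=\xi_{B'^{(n_u^* )}}$ if $n_u^*$ even and $\eta_{B'^{(n_u^* )}}$ if odd; $\mathrm{EGK}(B)=(n_1,\dots,n_t;m_1,\dots,m_t;\zeta_1,\dots,\zeta_t)$ (independent of the choice of $B'$). Pre-optimal forms: $B=2^{k_1}C_1\perp\cdots\perp2^{k_r}C_r$ with $k_i\ge0$, each $C_i$ unimodular diagonal or in $\frac12(S_2(\mathfrak o)_e\cap GL_2(\mathfrak o))$; $B^{[j]}=2^{k_1}C_1\perp\cdots\perp2^{k_j}C_j$; $\mathcal D_m=\{j:k_j=m, C_j\text{ diagonal}\}$, $\mathcal E_m=\{j:k_j=m, C_j\text{ not diagonal}\}$. Pre-optimal means: (PO1) $\sum_{j\in\mathcal D_m}\deg C_j\le2$ and $\mathcal E_m$ is a (possibly empty) set of consecutive integers, for each $m$; (PO2) for $i<j$: $\mathcal D_{m_1}\ni i$, $\mathcal D_{m_2}\ni j\Rightarrow m_1\le m_2$; $\mathcal E_{m_1}\ni i,\mathcal E_{m_2}\ni j\Rightarrow m_1\le m_2$; $\mathcal D_{m_1}\ni i,\mathcal E_{m_2}\ni j\Rightarrow m_1\le m_2-1$; $\mathcal E_{m_1}\ni i,\mathcal D_{m_2}\ni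 j\Rightarrow m_1\le m_2+1$; (PO3) if $C_i$ is unimodular diagonal of degree 2 then $i\ge2$ and either ($\deg B^{[i]}$ even and $\xi_{B^{[i-1]}}=\xi_{B^{[i]}}=0$) or ($\deg B^{[i-1]}$ odd and $\mathrm{ord}\det B^{[i-1]}+k_i$ even); (PO4) if $k_i=k_{i-1}-1$, $C_i$ diagonal, $C_{i-1}$ not diagonal, then $\deg C_i=2$, or $\deg C_i=1$ and either ($\deg B^{[i]}$ and $\mathrm{ord}\det B^{[i]}$ even) or ($\deg B^{[i]}$ odd and $\xi_{B^{[i-1]}}=0$); (PO5) if $C_i$ diagonal, $C_{i+1}$ not diagonal, $k_i=k_{i+1}-1$, then $\deg C_i=1$ and either ($\deg B^{[i]}$ even and $\mathrm{ord}\det B^{[i]}$ odd) or ($\deg B^{[i]}$ odd and $\xi_{B^{[i-1]}}\ne0$ if $i\ge2$); (PO6) if $\deg B^{[i]}$ even, $C_i,C_{i+1}$ unimodular diagonal and $k_{i+1}=k_i+1$, then $\xi_{B^{[i]}}=0$. *)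

(* Defs.v *)
From HB Require Import structures.
From mathcomp Require Import all_boot all_order all_algebra.
From mathcomp Require Import boolp.
From mathcomp Require classical_sets.

Set Implicit Arguments.
Unset Strict Implicit.
Unset Printing Implicit Defensive.

Import Order.TTheory GRing.Theory Num.Theory.
Local Open Scope ring_scope.

(* The base field.  A valuation v : F -> int (its value at 0 is       *)
(* irrelevant; ord(0) = +oo is encoded by vge below).                 *)

Definition vge (F : fieldType) (v : F -> int) (x : F) (k : int) : bool :=
  (x == 0) || (k <= v x).

Definition integral (F : fieldType) (v : F -> int) (x : F) : bool := vge v x 0.

Definition unit_o (F : fieldType) (v : F -> int) (x : F) : bool :=
  (x != 0) && (v x == 0).

(* (F, v) is a finite unramified extension of Q_2 with its normalized
   valuation: a complete discretely valued field with v(2) = 1 (so 2 is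
   a uniformizer), 2 != 0, and finite residue field o/2o. *)
Record unram2 (F : fieldType) (v : F -> int) : Prop := {
  v_mul : forall x y : F, x != 0 -> y != 0 -> v (x * y) = v x + v y;
  v_add : forall x y : F, x != 0 -> y != 0 -> x + y != 0 ->
            v x <= v (x + y) \/ v y <= v (x + y);
  two_nz : (2 : F) != 0;
  v_two : v 2 = 1;
  res_fin : exists s : seq F, all (integral v) s /\
            forall x, integral v x -> exists2 y, y \in s & vge v (x - y) 1;
  v_complete : forall u : nat -> F,
     (forall N : int, exists M : nat, forall p, (M <= p)%N -> vge v (u p.+1 - u p) N) ->
     exists l : F, forall N : int, exists M : nat, forall p, (M <= p)%N -> vge v (u p - l) N
}.

Definition hilb (F : fieldType) (a b : F) : int :=
  if `[< exists x y z : F, [|| x != 0, y != 0 | z != 0] /\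
                          z ^+ 2 = a * x ^+ 2 + b * y ^+ 2 >] then 1 else -1.

(* entry (i,j) of M addressed by natural numbers (0 outside the range) *)
Definition mxe (F : fieldType) (n : nat) (M : 'M[F]_n) (i j : nat) : F :=
  match (insub i : option 'I_n), (insub j : option 'I_n) with
  | Some i', Some j' => M i' j'
  | _, _ => 0
  end.

Definition ulsub (F : fieldType) (n : nat) (m : nat) (M : 'M[F]_n) : 'M[F]_m :=
  \matrix_(i < m, j < m) mxe M i j.

Definition in_Hn (F : fieldType) (v : F -> int) (n : nat) (M : 'M[F]_n) : bool :=
  [&& M^T == M, [forall i, integral v (M i i)] &
      [forall i, forall j, integral v (2 * M i j)]].

Definition GLo (F : fieldType) (v : F -> int) (n : nat) (U : 'M[F]_n) : bool :=
  [forall i, forall j, integral v (U i j)] && unit_o v (\det U).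

Definition sim (F : fieldType) (v : F -> int) (n : nat) (B B' : 'M[F]_n) : Prop :=
  exists U : 'M[F]_n, GLo v U /\ B' = U^T *m B *m U.

(* lexicographic order on sequences of naturals (of equal length) *)
Fixpoint lexle (s t : seq nat) : bool :=
  match s, t with
  | x :: s', y :: t' => (x < y)%N || ((x == y) && lexle s' t')
  | _, _ => true
  end.

Definition inS (F : fieldType) (v : F -> int) (n : nat) (M : 'M[F]_n) (a : seq nat) : Prop :=
  [/\ size a = n, sorted leq a,
      (forall i : 'I_n, vge v (M i i) (nth 0%N a i)%:Z) &
      (forall i j : 'I_n, (i <= j)%N ->
          (2 * M i j == 0) || ((nth 0%N a i + nth 0%N a j)%:Z <= 2 * v (2 * M i j)))].

Definition inSU (F : fieldType) (v : F -> int) (n : nat) (M : 'M[F]_n) (a : seq nat) : Prop :=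
  exists U : 'M[F]_n, GLo v U /\ inS v (U^T *m M *m U) a.

Definition GK (F : fieldType) (v : F -> int) (n : nat) (M : 'M[F]_n) : seq nat :=
  classical_sets.xget [::] (fun a => inSU v M a /\ forall a', inSU v M a' -> lexle a' a).

Definition optimal (F : fieldType) (v : F -> int) (n : nat) (M : 'M[F]_n) : Prop :=
  inS v M (GK v M).

(* xi of a discriminant D: 1 if square, -1 if F(sqrt D)/F unramified
   quadratic, 0 if ramified.  Unramifiedness of F(sqrt D) (D not a square)
   means ramification index 1, i.e. the extended valuation
   w = v o N / 2 takes only integer values: v(a^2 - D b^2) is always even. *)
Definition disc_xi (F : fieldType) (v : F -> int) (D : F) : int :=
  if `[< exists y : F, D = y ^+ 2 >] then 1
  else if `[< forall a b : F, (a != 0) || (b != 0) ->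
                 ~~ odd (absz (v (a ^+ 2 - D * b ^+ 2))) >] then -1
  else 0.

Definition xi (F : fieldType) (v : F -> int) (m : nat) (M : 'M[F]_m) : int :=
  disc_xi v ((-4) ^+ (m./2) * \det M).

Definition eta_diag (F : fieldType) (m : nat) (detM : F) (d : 'rV[F]_m) : int :=
  hilb (-1 : F) (-1) ^+ (m.+1 %/ 4) * hilb (-1 : F) detM ^+ (m.-1 %/ 2) *
  \prod_(i < m) \prod_(j < m | (i < j)%N) hilb (d 0 i) (d 0 j).

Definition eta (F : fieldType) (m : nat) (M : 'M[F]_m) : int :=
  eta_diag (\det M)
    (classical_sets.xget 0 (fun d : 'rV[F]_m => exists U : 'M[F]_m,
                U \in unitmx /\ U^T *m M *m U = diag_mx d)).

Definition zeta (F : fieldType) (v : F -> int) (m : nat) (M : 'M[F]_m) : int :=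
  if odd m then eta M else xi v M.

Fixpoint runs (s : seq nat) : seq (nat * nat) :=
  match s with
  | [::] => [::]
  | x :: t =>
      match runs t with
      | (k, y) :: r => if x == y then (k.+1, y) :: r else (1%N, x) :: (k, y) :: r
      | [::] => [:: (1%N, x)]
      end
  end.

Definition EGK (F : fieldType) (v : F -> int) (n : nat) (M : 'M[F]_n)
  : seq nat * seq nat * seq int :=
  let M' := classical_sets.xget M (fun M' => sim v M M' /\ optimal v M') in
  let rs := runs (GK v M') in
  let ns := map fst rs in
  (ns, map snd rs,
   [seq zeta v (ulsub (sumn (take j ns)) M') | j <- iota 1 (size ns)]).

(* BD s : diagonal matrix diag(s);  BE x y z : the 2x2 matrix [[x,y],[y,z]] *)
Inductive blk (F : Type) := BD of seq F | BE of F & F & F.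

Definition isD (F : Type) (b : blk F) : bool :=
  if b is BD _ then true else false.

Definition deg (F : Type) (b : blk F) : nat :=
  match b with BD s => size s | BE _ _ _ => 2 end.

Definition blk_entry (F : fieldType) (b : blk F) (i j : nat) : F :=
  match b with
  | BD s => if i == j then nth 0 s i else 0
  | BE x y z =>
      if (i == 0%N) && (j == 0%N) then x
      else if (i == 1%N) && (j == 1%N) then z
      else if ((i == 0%N) && (j == 1%N)) || ((i == 1%N) && (j == 0%N)) then y
      else 0
  end.

(* C unimodular diagonal (of positive degree), or
   C in (1/2)(S_2(o)_e \cap GL_2(o)) *)
Definition blk_ok (F : fieldType) (v : F -> int) (b : blk F) : bool :=
  match b with
  | BD s => (0 < size s)%N && all (unit_o v) s
  | BE x y z => [&& vge v (2 * x) 1, vge v (2 * z) 1, integral v (2 * y) &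
                    unit_o v ((2 * x) * (2 * z) - (2 * y) ^+ 2)]
  end.

Definition degs (F : Type) (bl : seq (nat * blk F)) : nat :=
  sumn (map (fun p => deg p.2) bl).

Fixpoint ent (F : fieldType) (bl : seq (nat * blk F)) (i j : nat) : F :=
  match bl with
  | [::] => 0
  | (k, b) :: t =>
      let d := deg b in
      if (i < d)%N && (j < d)%N then 2 ^+ k * blk_entry b i j
      else if (d <= i)%N && (d <= j)%N then ent t (i - d) (j - d)
      else 0
  end.

Definition assemble (F : fieldType) (bl : seq (nat * blk F)) : 'M[F]_(degs bl) :=
  \matrix_(i, j) ent bl i j.

(* 1-based accessors k_i, C_i, and B^{[j]} *)
Definition kb (F : Type) (bl : seq (nat * blk F)) (i : nat) : nat :=
  (nth (0%N, BD [::]) bl i.-1).1.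
Definition Cb (F : Type) (bl : seq (nat * blk F)) (i : nat) : blk F :=
  (nth (0%N, BD [::]) bl i.-1).2.
Definition Bpre (F : fieldType) (bl : seq (nat * blk F)) (j : nat) :=
  assemble (take j bl).

Definition ord_det_odd (F : fieldType) (v : F -> int) (m : nat) (M : 'M[F]_m) : bool :=
  odd (absz (v (\det M))).

Definition pre_optimal (F : fieldType) (v : F -> int) (bl : seq (nat * blk F)) : Prop :=
  let r := size bl in
  (forall m : nat,
     (\sum_(1 <= j < r.+1 | (kb bl j == m) && isD (Cb bl j)) deg (Cb bl j) <= 2)%N) /\
  (forall m i l j : nat, (1 <= i)%N -> (i < l)%N -> (l < j)%N -> (j <= r)%N ->
     kb bl i = m -> kb bl j = m -> ~~ isD (Cb bl i) -> ~~ isD (Cb bl j) ->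
     kb bl l = m /\ ~~ isD (Cb bl l)) /\
  (forall i j : nat, (1 <= i)%N -> (i < j)%N -> (j <= r)%N ->
     [/\ isD (Cb bl i) -> isD (Cb bl j) -> (kb bl i <= kb bl j)%N,
         ~~ isD (Cb bl i) -> ~~ isD (Cb bl j) -> (kb bl i <= kb bl j)%N,
         isD (Cb bl i) -> ~~ isD (Cb bl j) -> (kb bl i + 1 <= kb bl j)%N &
         ~~ isD (Cb bl i) -> isD (Cb bl j) -> (kb bl i <= kb bl j + 1)%N]) /\
  (forall i : nat, (1 <= i <= r)%N -> isD (Cb bl i) -> deg (Cb bl i) = 2%N ->
     (2 <= i)%N /\
     ((~~ odd (degs (take i bl)) /\ xi v (Bpre bl i.-1) = 0 /\ xi v (Bpre bl i) = 0) \/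
      (odd (degs (take i.-1 bl)) /\ ~~ odd (absz (v (\det (Bpre bl i.-1))) + kb bl i)%N))) /\
  (forall i : nat, (2 <= i <= r)%N -> (kb bl i + 1 = kb bl i.-1)%N ->
     isD (Cb bl i) -> ~~ isD (Cb bl i.-1) ->
     deg (Cb bl i) = 2%N \/
     (deg (Cb bl i) = 1%N /\
      ((~~ odd (degs (take i bl)) /\ ~~ ord_det_odd v (Bpre bl i)) \/
       (odd (degs (take i bl)) /\ xi v (Bpre bl i.-1) = 0)))) /\
  (forall i : nat, (1 <= i)%N -> (i < r)%N ->
     isD (Cb bl i) -> ~~ isD (Cb bl i.+1) -> (kb bl i + 1 = kb bl i.+1)%N ->
     deg (Cb bl i) = 1%N /\
     ((~~ odd (degs (take i bl)) /\ ord_det_odd v (Bpre bl i)) \/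
      (odd (degs (take i bl)) /\ ((2 <= i)%N -> xi v (Bpre bl i.-1) != 0)))) /\
  (forall i : nat, (1 <= i)%N -> (i < r)%N -> ~~ odd (degs (take i bl)) ->
     isD (Cb bl i) -> isD (Cb bl i.+1) -> (kb bl i.+1 = kb bl i + 1)%N ->
     xi v (Bpre bl i) = 0).

(* Main.v *)
Require Import Defs.
From HB Require Import structures.
From mathcomp Require Import all_boot all_order all_algebra.
From mathcomp Require Import boolp.
From mathcomp Require Import zify ring.
From mathcomp Require classical_sets.

(* For integral A and exponents a with A in S(a), filter the lattice by the vectors whose i-th
   coordinate has valuation at least (m - a_i)/2.  If the quadratic form induced on every graded
   piece has trivial radical, the filtration is intrinsic: a is then lexicographically greatest, and
   any two bases in which a is attained differ by a matrix respecting the filtration.  At a jump of a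
   the corresponding upper-left blocks have the same graded form, and the graded form determines the
   value zeta: its hyperbolic or anisotropic planes have unramified discriminant, and Hilbert symbols
   of such a discriminant with units are trivial.

   For a pre-optimal form such exponents are built block by block.  A new vector of scale K is
   corrected by an integral combination of the earlier ones, so that it either stays single or forms
   a plane with an earlier single vector or with its neighbour; (PO1)-(PO6) ensure that the exponents
   stay non-decreasing.  The base change is unitriangular, hence does not affect zeta of the leading
   blocks, and jumps of a only occur at block boundaries. *)

Set Implicit Arguments.
Unset Strict Implicit.
Unset Printing Implicit Defensive.

Import Order.TTheory GRing.Theory Num.Theory.
Local Open Scope ring_scope.
(* Hypotheses about field elements slow down the preprocessing of [lia]. *)
Ltac lia_goal := clear; lia.

Lemma leq_card_fibres (T T' : finType) (f : T -> T') n :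
  (forall x, #|[set y | f y == f x]| <= n)%N -> (#|T| <= n * #|f @: [set: T]|)%N.
Proof.
move=> fn; rewrite -cardsT -sum1_card (partition_big_imset f) /= mulnC -sum_nat_const.
apply: leq_sum => _ /imsetP[x _ ->]; rewrite sum1dep_card; apply: leq_trans (fn x).
by apply: subset_leq_card; apply/subsetP => y; rewrite !inE.
Qed.

Section Dyadic.

Variables (F : fieldType) (v : F -> int).
Hypothesis HF : unram2 v.

(** * Valuations and square roots *)

Lemma two_neq0 : (2 : F) != 0. Proof. exact: two_nz HF. Qed.

Lemma vM x y : x != 0 -> y != 0 -> v (x * y) = v x + v y.
Proof. exact: v_mul HF x y. Qed.

Lemma v1 : v 1 = 0.
Proof.
have n1 : (1 : F) != 0 by exact: oner_neq0.
by have := vM n1 n1; rewrite mulr1; lia.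
Qed.

Lemma vN x : v (- x) = v x.
Proof.
have [->|x0] := eqVneq x 0; first by rewrite oppr0.
have m1 : (-1 : F) != 0 by rewrite oppr_eq0 oner_eq0.
by have := vM m1 m1; rewrite mulN1r opprK v1 -[- x]mulN1r vM //; lia.
Qed.

Lemma vV x : x != 0 -> v x^-1 = - v x.
Proof. by move=> x0; have := @vM x x^-1 x0; rewrite invr_eq0 divff // v1 => /(_ x0); lia. Qed.

Lemma vX x n : x != 0 -> v (x ^+ n) = n%:Z * v x.
Proof.
move=> x0; elim: n => [|n IHn]; first by rewrite expr0 v1 mul0r.
by rewrite exprS vM ?expf_neq0 // IHn; lia.
Qed.

Lemma v2X n : v (2 ^+ n) = n%:Z.
Proof. by rewrite vX ?two_neq0 // (v_two HF) mulr1. Qed.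

(* The bounds on [ord (2 b_ij)] are the half-integers (a_i + a_j) / 2: comparing [2 * v x] instead
   of [v x] keeps every bound an integer. *)
Definition wge (x : F) (k : int) : bool := (x == 0) || (k <= 2 * v x).
Definition weq (x : F) (k : int) : bool := (x != 0) && (2 * v x == k).

Lemma wgeP x k : reflect (x != 0 -> k <= 2 * v x) (wge x k).
Proof.
rewrite /wge; apply: (iffP idP) => [/orP[/eqP->|//]|]; first by rewrite eqxx.
by case: (eqVneq x 0) => //= x0 /(_ isT).
Qed.

Lemma weqP x k : reflect (x != 0 /\ 2 * v x = k) (weq x k).
Proof. by apply: (iffP andP) => -[? /eqP]. Qed.

Lemma vgeE x k : vge v x k = wge x (2 * k).
Proof. by rewrite /vge /wge; case: (x == 0) => //=; apply/idP/idP; lia. Qed.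

Lemma integralE x : integral v x = wge x 0.
Proof. by rewrite /integral vgeE mulr0. Qed.

Lemma unit_oE x : unit_o v x = weq x 0.
Proof. by rewrite /unit_o /weq; congr andb; apply/eqP/eqP; lia. Qed.

Lemma wge0 k : wge 0 k. Proof. by rewrite /wge eqxx. Qed.

Lemma wgeW x k l : wge x k -> l <= k -> wge x l.
Proof. by move=> /wgeP h lk; apply/wgeP => /h; lia. Qed.

Lemma wge_sharpen x k l : wge x k -> (forall z : int, k <= 2 * z -> l <= 2 * z) -> wge x l.
Proof. by move=> /wgeP h kl; apply/wgeP => /h /kl. Qed.

Lemma wge_inf x : (forall n : nat, wge x n%:Z) -> x = 0.
Proof.
move=> h; apply/eqP; apply: contraT => x0.
by have /wgeP/(_ x0) := h `|(2 * v x + 1)%R|%N; lia.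
Qed.

Lemma wgeN x k : wge (- x) k = wge x k.
Proof. by rewrite /wge oppr_eq0 vN. Qed.

Lemma wgeD x y k : wge x k -> wge y k -> wge (x + y) k.
Proof.
move=> /wgeP hx /wgeP hy; apply/wgeP => xy0.
have [x0|x0] := eqVneq x 0; first by move: xy0; rewrite x0 add0r.
have [y0|y0] := eqVneq y 0; first by move: xy0; rewrite y0 addr0.
by have := hx x0; have := hy y0; case: (v_add HF x0 y0 xy0); lia.
Qed.

Lemma wgeB x y k : wge x k -> wge y k -> wge (x - y) k.
Proof. by move=> hx hy; apply: wgeD => //; rewrite wgeN. Qed.

Lemma wge_subC x y k : wge (x - y) k = wge (y - x) k.
Proof. by rewrite -wgeN opprB. Qed.

Lemma wgeM x y k l : wge x k -> wge y l -> wge (x * y) (k + l).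
Proof.
move=> /wgeP hx /wgeP hy; apply/wgeP; rewrite mulf_eq0 negb_or => /andP[x0 y0].
by rewrite vM //; have := hx x0; have := hy y0; lia.
Qed.

Lemma wgeM_le x y k l m : wge x k -> wge y l -> m <= k + l -> wge (x * y) m.
Proof. by move=> hx hy; apply: wgeW; apply: wgeM. Qed.

Lemma wge_sum (I : Type) (r : seq I) (P : pred I) (f : I -> F) k :
  (forall i, P i -> wge (f i) k) -> wge (\sum_(i <- r | P i) f i) k.
Proof. by move=> h; apply: (big_ind (wge^~ k)) => // [|x y]; [exact: wge0 | exact: wgeD]. Qed.

Lemma wge_prod (I : Type) (r : seq I) (x : I -> F) (k : I -> int) :
  (forall i, wge (x i) (k i)) -> wge (\prod_(i <- r) x i) (\sum_(i <- r) k i).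
Proof.
move=> h; apply: (big_ind2 wge) => // [|x1 k1 x2 k2]; last exact: wgeM.
by apply/wgeP; rewrite v1.
Qed.

Lemma wge1 k : k <= 0 -> wge 1 k.
Proof. by move=> k0; apply/wgeP; rewrite v1; lia. Qed.

Lemma weq_neq0 x k : weq x k -> x != 0. Proof. by case/andP. Qed.

Lemma weqW x k l : weq x k -> l <= k -> wge x l.
Proof. by move=> /weqP[_ xk] lk; apply/wgeP; lia. Qed.

Lemma weq_wge x k : weq x k -> wge x k.
Proof. by move=> h; apply: weqW h _. Qed.

Lemma weq_eq x k y l : weq x k -> y = x -> l = k -> weq y l.
Proof. by move=> h -> ->. Qed.

Lemma weq_even x k : weq x k -> exists z : int, k = 2 * z.
Proof. by move=> /weqP[_ <-]; exists (v x). Qed.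

Lemma wge_weq x k : wge x (2 * k) -> ~~ wge x (2 * k + 2) -> weq x (2 * k).
Proof.
move=> /wgeP xk; rewrite /wge negb_or -ltNge => /andP[x0 xk2].
by apply/weqP; split=> //; have := xk x0; lia.
Qed.

Lemma weqN x k : weq (- x) k = weq x k.
Proof. by rewrite /weq oppr_eq0 vN. Qed.

Lemma weqM x y k l : weq x k -> weq y l -> weq (x * y) (k + l).
Proof.
move=> /weqP[x0 xk] /weqP[y0 yl]; apply/weqP; split; first by rewrite mulf_neq0.
by rewrite vM //; lia.
Qed.

Lemma weqV x k : weq x k -> weq x^-1 (- k).
Proof. by move=> /weqP[x0 xk]; apply/weqP; rewrite invr_eq0 vV //; split=> //; lia. Qed.

Lemma weqX x k n : weq x k -> weq (x ^+ n) (n%:Z * k).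
Proof. by move=> /weqP[x0 xk]; apply/weqP; rewrite expf_neq0 // vX //; split=> //; lia. Qed.

Lemma weq1 : weq 1 0. Proof. by rewrite /weq oner_eq0 v1. Qed.
Lemma weq2X n : weq (2 ^+ n) (2 * n%:Z).
Proof. by rewrite /weq expf_neq0 ?two_neq0 //= v2X. Qed.
Lemma weq2 : weq 2 2. Proof. by have := weq2X 1; rewrite expr1. Qed.
Lemma weq4 : weq 4 4. Proof. by rewrite (_ : 4 = 2 ^+ 2) ?(weq2X 2) //; ring. Qed.
Lemma weq8 : weq 8 6. Proof. by rewrite (_ : 8 = 2 ^+ 3) ?(weq2X 3) //; ring. Qed.

Lemma weqDl x y k : weq x k -> wge y (k + 1) -> weq (x + y) k.
Proof.
move=> /weqP[x0 xk] hy.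
have xy0 : x + y != 0.
  apply/eqP => xy0; move: hy; rewrite (_ : y = - x) ?wgeN; last by rewrite -[y](addKr x) xy0 addr0.
  by move=> /wgeP/(_ x0); lia.
have /wgeP/(_ xy0) lo : wge (x + y) k by apply: wgeD (wgeW hy _); [apply/wgeP; lia | lia].
apply/weqP; split=> //; apply/eqP; rewrite eq_le lo andbT leNgt; apply/negP => hi.
have : wge ((x + y) - y) (k + 1) by apply: wgeB => //; apply/wgeP; lia.
by rewrite addrK => /wgeP/(_ x0); lia.
Qed.

Lemma weq_near x y k : weq y k -> wge (x - y) (k + 1) -> weq x k.
Proof. by move=> hy hxy; rewrite -(subrK y x) addrC; apply: weqDl. Qed.

Lemma weq_mulP x y k l : wge x k -> wge y l -> weq (x * y) (k + l) -> weq x k /\ weq y l.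
Proof.
move=> /wgeP hx /wgeP hy /weqP[]; rewrite mulf_eq0 negb_or => /andP[x0 y0].
by rewrite vM //; have := hx x0; have := hy y0 => ? ? ?; split; apply/weqP; split=> //; lia.
Qed.

Lemma weq_sqr x k : weq (x ^+ 2) (2 * k) -> weq x k.
Proof.
move=> /weqP[]; rewrite expf_eq0 /= => x0; rewrite vX // => ?; apply/weqP; split=> //; lia.
Qed.

Lemma wge_div x y k l m : wge x k -> weq y l -> m <= k - l -> wge (x / y) m.
Proof. by move=> hx /weqV hy ?; apply: (wgeM_le hx (weq_wge hy)); lia. Qed.

Lemma wge_divl x y k l : weq y l -> wge (x / y) k = wge x (k + l).
Proof.
move=> hy; apply/idP/idP => h; last by apply: wge_div h hy _; lia.
by rewrite -(divfK (weq_neq0 hy) x); apply: wgeM h (weq_wge hy).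
Qed.

Lemma wge_mul2 x (k : int) : wge (2 * x) (k + 2) = wge x k.
Proof. by rewrite -(wge_divl _ _ weq2) [2 * x]mulrC mulfK ?two_neq0. Qed.

Lemma wge_mul4 x (k : int) : wge (4 * x) (k + 4) = wge x k.
Proof. by rewrite -(wge_divl _ _ weq4) [4 * x]mulrC mulfK ?(weq_neq0 weq4). Qed.

Lemma wge2M x k l : wge x k -> l <= k + 2 -> wge (2 * x) l.
Proof. by rewrite -wge_mul2; apply: wgeW. Qed.

Lemma wge4M x k l : wge x k -> l <= k + 4 -> wge (4 * x) l.
Proof. by rewrite -wge_mul4; apply: wgeW. Qed.

Lemma wgeM0 x y : wge x 0 -> wge y 0 -> wge (x * y) 0.
Proof. by move=> hx hy; apply: (wgeM_le hx hy). Qed.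

Lemma wgeX0 x n : wge x 0 -> wge (x ^+ n) 0.
Proof. by move=> hx; elim: n => [|n]; [apply: wge1 | rewrite exprS; apply: wgeM0]. Qed.

Lemma wge_natr n : wge n%:R 0.
Proof. by elim: n => [|n IHn]; rewrite ?wge0 // -natr1 wgeD ?wge1. Qed.

(* Closes [wge e 0] when [e] is an integral polynomial in integral elements. *)
Ltac integrality :=
  repeat first [done | by apply: weq_wge | exact: wge_natr | exact: wge0 | exact: wge1
    | rewrite wgeN | apply: wgeD | apply: wgeB | apply: wgeX0 | apply: wgeM0].

Lemma weqV0 x : weq x 0 -> weq x^-1 0. Proof. by move=> /weqV; rewrite oppr0. Qed.

Lemma ex_val (m : int) : exists2 t : F, t != 0 & v t = m.
Proof.
case: m => m; first by exists (2 ^+ m); rewrite ?expf_neq0 ?two_neq0 ?v2X.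
by exists (2 ^+ m.+1)^-1; rewrite ?invr_eq0 ?vV ?expf_neq0 ?two_neq0 ?v2X.
Qed.

Lemma wge_telescope (u : nat -> F) n p : (forall i, wge (u i.+1 - u i) i%:Z) -> (n <= p)%N ->
  wge (u p - u n) n%:Z.
Proof.
move=> du; elim: p => [|p IHp]; first by rewrite leqn0 => /eqP->; rewrite subrr wge0.
rewrite leq_eqVlt => /predU1P[->|np]; first by rewrite subrr wge0.
rewrite -(subrK (u p) (u p.+1)) -addrA; apply: wgeD (IHp np).
by apply: wgeW (du p) _; lia.
Qed.

Lemma cauchy_limit (u : nat -> F) : (forall n, wge (u n.+1 - u n) n%:Z) ->
  exists l, forall n, wge (u n - l) n%:Z.
Proof.
move=> du; have [N|l ul] := @v_complete _ _ HF u.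
  by exists `|(2 * N)%R|%N => p hp; rewrite vgeE; apply: wgeW (du p) _; lia.
exists l => n; have [M uM] := ul n%:Z; set p := maxn n M.
have -> : u n - l = (u p - l) - (u p - u n) by ring.
apply: wgeB; last exact: wge_telescope du (leq_maxl _ _).
by have := uM p (leq_maxr _ _); rewrite vgeE => /wgeW; apply; lia.
Qed.

(* [y] is the limit of the contraction y |-> 2 t - y^2 of 2o. *)
Lemma hensel_artin_schreier t : wge t 0 -> exists y, y ^+ 2 + y = 2 * t.
Proof.
move=> t_int; pose u := fix u n := if n is m.+1 then 2 * t - u m ^+ 2 else 0.
have uS n : u n.+1 = 2 * t - u n ^+ 2 by [].
have u_2o n : wge (u n) 2.
  elim: n => [|n IHn]; first exact: wge0.
  by rewrite uS; apply: wgeB; [apply: (wge2M t_int) | rewrite expr2; apply: (wgeM_le IHn IHn)].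
have du n : wge (u n.+1 - u n) n%:Z.
  elim: n => [|n IHn]; first by rewrite subr0; apply: wgeW (u_2o 1%N) _.
  rewrite (uS n.+1) {2}(uS n) (_ : _ - _ = - ((u n.+1 - u n) * (u n.+1 + u n))); last by ring.
  by rewrite wgeN; apply: (wgeM_le IHn (wgeD (u_2o _) (u_2o _))); lia.
have [l ul] := cauchy_limit du; exists l; apply/eqP; rewrite -subr_eq0; apply/eqP/wge_inf => n.
have -> : l ^+ 2 + l - 2 * t = (l - u n.+1) + (l - u n) * (l + u n) by rewrite uS; ring.
have l_int : wge l 0 by have := ul 0%N; rewrite sub0r wgeN.
apply: wgeD; first by rewrite wge_subC; apply: wgeW (ul n.+1) _; lia.
rewrite -[n%:Z]addr0; apply: wgeM; first by rewrite wge_subC.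
by apply: wgeD => //; apply: wgeW (u_2o n) _.
Qed.

Lemma sqrt_near1 x : wge (x - 1) 6 -> exists y, x = y ^+ 2.
Proof.
move=> x1; have [|y yE] := @hensel_artin_schreier ((x - 1) / 8); first exact: wge_div x1 weq8 _.
exists (1 + 2 * y); have n8 := weq_neq0 weq8.
have -> : (1 + 2 * y) ^+ 2 = 1 + 4 * (y ^+ 2 + y) by ring.
by rewrite yE; field.
Qed.

Lemma sqrt_near x y : weq y 0 -> wge (x - y) 6 -> exists2 t : F, t != 0 & x = y * t ^+ 2.
Proof.
move=> hy hxy; have y0 := weq_neq0 hy; have x0 : x != 0.
  by apply: (@weq_neq0 _ 0); apply: weq_near hy (wgeW hxy _).
have [|t tE] := @sqrt_near1 (x / y).
  by rewrite -(divff y0) -mulrBl; apply: wge_div hxy hy _.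
exists t; last by rewrite -tE mulrC divfK.
by apply: contraNneq x0 => t0; rewrite -[x](divfK y0) tE t0 expr0n mul0r.
Qed.

(** * The residue field *)

Lemma residue_map : exists (K : finType) (red : F -> K) (lift : K -> F),
  [/\ forall c, wge (lift c) 0, cancel lift red &
      forall x y, wge x 0 -> wge y 0 -> (red x == red y) = wge (x - y) 2].
Proof.
have [r [/allP r_int r_cover]] := res_fin HF.
pose canon x := nth 0 r (find (fun y => vge v (x - y) 1) r).
have canon_near x : wge x 0 -> wge (x - canon x) 2.
  rewrite -integralE => /r_cover[y yr xy]; rewrite -[2]mulr1 -vgeE.
  by apply: (nth_find _ (a := fun y => vge v (x - y) 1)); apply/hasP; exists y.
have canon_in x : wge x 0 -> canon x \in r.
  rewrite -integralE => /r_cover[y yr xy]; rewrite mem_nth // -has_find.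
  by apply/hasP; exists y.
have canon_int x : wge x 0 -> wge (canon x) 0 by move=> /canon_in/r_int; rewrite integralE.
have canon_eq x y : wge x 0 -> wge y 0 -> (canon x == canon y) = wge (x - y) 2.
  move=> hx hy; apply/eqP/idP => [e|xy].
    have -> : x - y = (x - canon x) - (y - canon y) by rewrite e; ring.
    by apply: wgeB; apply: canon_near.
  rewrite /canon; congr nth; apply: eq_find => z; rewrite !vgeE; apply/idP/idP => h.
    by rewrite (_ : y - z = (x - z) - (x - y)); [apply: wgeB | ring].
  by rewrite (_ : x - z = (y - z) + (x - y)); [apply: wgeD | ring].
have canonK x : wge x 0 -> canon (canon x) = canon x.
  by move=> hx; apply/eqP; rewrite canon_eq ?canon_int // wge_subC canon_near.
pose reps := [seq canon y | y <- r].
have canon_reps x : wge x 0 -> canon x \in reps.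
  by move=> hx; rewrite -canonK //; apply: map_f; apply: canon_in.
have int0 : wge 0 0 := wge0 0.
exists (seq_sub reps), (fun x => insubd (SeqSub (canon_reps _ int0)) (canon x)), val; split.
- by move=> c; have /mapP[y /r_int] := valP c; rewrite integralE => /canon_int ? ->.
- move=> c; apply: val_inj; rewrite val_insubd; have /mapP[y /r_int] := valP c.
  by rewrite integralE => hy /= ->; rewrite canonK ?canon_reps.
by move=> x y hx hy; rewrite -val_eqE !val_insubd !canon_reps // canon_eq.
Qed.

Lemma residue_mul_eq0 x y : wge x 0 -> wge y 0 -> wge (x * y) 2 -> wge x 2 || wge y 2.
Proof.
move=> hx hy; apply: contraTT; rewrite negb_or => /andP[nx ny].
have /weqP[n0 v0] := weqM (wge_weq (k := 0) hx nx) (wge_weq (k := 0) hy ny).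
by apply/negP => /wgeP/(_ n0); lia.
Qed.

Lemma residue_sqrt x : wge x 0 -> exists2 s, wge s 0 & wge (s ^+ 2 - x) 2.
Proof.
move=> hx; have [K [red [lift [lift_int liftK red_eq]]]] := residue_map.
pose sq c := red (lift c ^+ 2).
have sq_inj : injective sq.
  move=> c d /eqP; rewrite red_eq ?wgeX0 // => cd; apply/eqP.
  have hcd : wge (lift c - lift d) 0 by integrality.
  rewrite -(liftK c) -(liftK d) red_eq //; rewrite -[_ 2]orbb; apply: residue_mul_eq0 => //.
  rewrite (_ : _ * _ = (lift c ^+ 2 - lift d ^+ 2) - 2 * (lift d * (lift c - lift d))); last by ring.
  by apply: wgeB => //; apply: (wge2M (k := 0)) => //; integrality.
have [sqV _ sqVK] := injF_bij sq_inj; exists (lift (sqV (red x))) => //.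
by rewrite -red_eq ?wgeX0 //; apply/eqP/sqVK.
Qed.

(* z |-> z^2 + z is additive with kernel {0, 1} on the residue field, so its image has index 2. *)
Section ArtinSchreier.

Variables (K : finType) (red : F -> K) (lift : K -> F).
Hypothesis lift_int : forall c, wge (lift c) 0.
Hypothesis liftK : cancel lift red.
Hypothesis red_eq : forall x y, wge x 0 -> wge y 0 -> (red x == red y) = wge (x - y) 2.

Definition artin_schreier (c : K) : K := red (lift c ^+ 2 + lift c).

Lemma artin_schreier_int z : wge z 0 -> wge (z ^+ 2 + z) 0.
Proof. by move=> hz; integrality. Qed.

Lemma lift_red x : wge x 0 -> wge (lift (red x) - x) 2.
Proof. by move=> hx; rewrite -red_eq ?liftK. Qed.

Lemma artin_schreier_fibre c : (#|[set d | artin_schreier d == artin_schreier c]| <= 2)%N.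
Proof.
suff sub : [set d | artin_schreier d == artin_schreier c] \subset [set c; red (lift c + 1)].
  by apply: leq_trans (subset_leq_card sub) _; rewrite cards2; case: eqP.
apply/subsetP => d; rewrite !inE red_eq ?artin_schreier_int // => dc.
have dc_int : wge (lift d - lift c) 0 by integrality.
have c1_int : wge (lift c + 1) 0 by integrality.
rewrite -[in d == c](liftK c) -{1 2}(liftK d) !red_eq //.
have : wge (lift d - lift c) 2 || wge (lift d - lift c + 1) 2.
  apply: residue_mul_eq0 => //; first by integrality.
  rewrite (_ : _ * _ = (lift d ^+ 2 + lift d - (lift c ^+ 2 + lift c)) -
     2 * (lift c * (lift d - lift c))); last by ring.
  by apply: wgeB => //; apply: (wge2M (k := 0)) => //; integrality.
case/orP => h; first by rewrite h.
rewrite (_ : lift d - (lift c + 1) = lift d - lift c + 1 - 2); last by ring.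
by rewrite (wgeB h) ?orbT // (weq_wge weq2).
Qed.

Lemma artin_schreier_index (I : finType) (t : I -> F) : (forall i, wge (t i) 0) ->
  (forall i j z, i != j -> wge z 0 -> ~~ wge (z ^+ 2 + z - (t i + t j)) 2) -> (#|I| <= 2)%N.
Proof.
move=> t_int t_sep; pose shift (ic : I * K) := red (lift ic.2 + t ic.1).
have shift_int c i : wge (lift c + t i) 0 by integrality.
have shift_inj : {in setX [set: I] (artin_schreier @: [set: K]) &, injective shift}.
  move=> [i c] [j d]; rewrite !inE /= => /imsetP[c' _ ->] /imsetP[d' _ ->] {c d} /eqP.
  have lc : wge (lift (artin_schreier c') - (lift c' ^+ 2 + lift c')) 2.
    by rewrite lift_red ?artin_schreier_int.
  have ld : wge (lift (artin_schreier d') - (lift d' ^+ 2 + lift d')) 2.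
    by rewrite lift_red ?artin_schreier_int.
  set c := artin_schreier c' in lc *; set d := artin_schreier d' in ld *.
  rewrite red_eq //= => cd; have [ij|ij] := eqVneq i j.
    rewrite ij in cd *; congr pair; apply/eqP; rewrite -(liftK c) -(liftK d) red_eq //.
    by rewrite (_ : _ - _ = lift c + t j - (lift d + t j)) //; ring.
  have dz : wge (lift c' - lift d') 0 by integrality.
  case/negP: (t_sep _ _ _ ij dz).
  have -> : (lift c' - lift d') ^+ 2 + (lift c' - lift d') - (t i + t j) =
     (lift d - (lift d' ^+ 2 + lift d')) - (lift c - (lift c' ^+ 2 + lift c')) +
     (lift c + t i - (lift d + t j)) - 2 * (t i + lift d' * (lift c' - lift d')) by ring.
  apply: wgeB; first by apply: wgeD => //; apply: wgeB.
  by apply: (wge2M (k := 0)) => //; integrality.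
have image_gt0 : (0 < #|artin_schreier @: [set: K]|)%N.
  by apply/card_gt0P; exists (artin_schreier (red 0)); apply: imset_f.
rewrite -(leq_pmul2r image_gt0) -cardsT -cardsX -(card_in_imset shift_inj).
by apply: leq_trans (max_card _) (leq_card_fibres artin_schreier_fibre).
Qed.

End ArtinSchreier.

Lemma residue_artin_schreier x1 x2 : wge x1 0 -> wge x2 0 ->
  exists2 z, wge z 0 & [|| wge (z ^+ 2 + z - x1) 2, wge (z ^+ 2 + z - x2) 2 |
                          wge (z ^+ 2 + z - (x1 + x2)) 2].
Proof.
move=> hx1 hx2; apply: contrapT => no_root.
have [K [red [lift [lift_int liftK red_eq]]]] := residue_map.
pose t (o : option bool) := if o is Some b then if b then x1 else x2 else 0.
suff : (#|{: option bool}| <= 2)%N by rewrite card_option card_bool.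
apply: (artin_schreier_index lift_int liftK red_eq (t := t)).
  by case=> [[]|] //; apply: wge0.
move=> o o' z oo hz; apply/negP => h; apply: no_root; exists z => //.
case: o o' oo h => [[]|] [[]|] //= _; rewrite ?addr0 ?add0r => h; rewrite ?h ?orbT //.
by rewrite [x1 + x2]addrC h !orbT.
Qed.

(** * Bimultiplicativity of the Hilbert symbol *)

Definition is_norm (a b : F) : Prop := exists s t, b = s ^+ 2 - a * t ^+ 2.

Lemma is_normM a b c : is_norm a b -> is_norm a c -> is_norm a (b * c).
Proof.
by move=> [s [t ->]] [s' [t' ->]]; exists (s * s' + a * t * t'), (s * t' + t * s'); ring.
Qed.

Lemma is_norm_sqr a t : is_norm a (t ^+ 2).
Proof. by exists t, 0; ring. Qed.

Lemma is_norm_mul_sqr a b t : t != 0 -> is_norm a (b * t ^+ 2) <-> is_norm a b.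
Proof.
move=> t0; split=> [[x [y bE]]|h]; last by apply: is_normM h (is_norm_sqr _ _).
exists (x / t), (y / t); apply: (mulIf (expf_neq0 2 t0)); rewrite bE; field.
by rewrite t0.
Qed.

Lemma is_norm_mulKr a b c : c != 0 -> is_norm a (b * c) -> is_norm a c -> is_norm a b.
Proof. by move=> c0 bc_norm c_norm; rewrite -(is_norm_mul_sqr _ _ c0) mulrA; apply: is_normM. Qed.

Lemma is_norm_base_mul_sqr a b t : t != 0 -> is_norm a b -> is_norm (a * t ^+ 2) b.
Proof. by move=> t0 [x [y ->]]; exists x, (y / t); field. Qed.

Lemma is_norm_base_sqr a b : a != 0 -> is_norm (a ^+ 2) b.
Proof. by move=> a0; exists ((b + 1) / 2), ((b - 1) / (2 * a)); field; rewrite a0 two_neq0. Qed.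

Lemma is_norm_near a x y : weq y 0 -> wge (x - y) 6 -> is_norm a y -> is_norm a x.
Proof. by move=> hy /(sqrt_near hy)[t t0 ->]; rewrite is_norm_mul_sqr. Qed.

Lemma hilbP a b : a != 0 -> hilb a b = 1 <-> is_norm a b.
Proof.
move=> a0; rewrite /hilb; case: asboolP => [[x [y [z [nz e]]]]|h]; split=> //; last first.
  by move=> [s [t e]]; case: h; exists t, 1, s; rewrite oner_eq0 orbT e; split=> //; ring.
move=> _; have [y0|y0] := eqVneq y 0; last first.
  by rewrite -(is_norm_mul_sqr _ _ y0); exists z, x; rewrite e; ring.
move: e nz; rewrite y0 expr0n mulr0 addr0 eqxx /= => e nz.
have x0 : x != 0.
  apply: contraTneq nz => x0; move: e; rewrite x0 expr0n mulr0 => /eqP.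
  by rewrite expf_eq0 /= => /eqP->; rewrite !eqxx.
have aE : a = (z / x) ^+ 2 by rewrite expr_div_n e mulfK // expf_neq0.
by rewrite aE; apply: is_norm_base_sqr; apply: contraNneq a0 => z0; rewrite aE z0 expr0n.
Qed.

Lemma hilb_pm1 (a b : F) : hilb a b = 1 \/ hilb a b = -1.
Proof. by rewrite /hilb; case: ifP; [left | right]. Qed.

Lemma hilbC (a b : F) : hilb a b = hilb b a.
Proof.
rewrite /hilb; congr (if _ then _ else _); apply/asboolP/asboolP => -[x [y [z [nz e]]]];
  by exists y, x, z; rewrite orbCA e addrC.
Qed.

Lemma hilb_mul_sqr (a b t : F) : t != 0 -> hilb a (b * t ^+ 2) = hilb a b.
Proof.
move=> t0; rewrite /hilb; congr (if _ then _ else _).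
apply/asboolP/asboolP => -[x [y [z [nz e]]]].
  by exists x, (y * t), z; rewrite mulf_eq0 (negPf t0) orbF e; split=> //; ring.
by exists x, (y / t), z; rewrite mulf_eq0 invr_eq0 (negPf t0) orbF e; split=> //; field.
Qed.

Lemma hilb_mull_sqr (a b t : F) : t != 0 -> hilb (a * t ^+ 2) b = hilb a b.
Proof. by move=> t0; rewrite ![hilb _ b]hilbC hilb_mul_sqr. Qed.

Lemma even_valP x : x != 0 -> ~~ odd `|v x| ->
  exists u t, [/\ weq u 0, t != 0 & x = u * t ^+ 2].
Proof.
move=> x0 vx; have [m vxE] : exists m : int, v x = 2 * m by exists (v x %/ 2)%Z; lia.
have [t t0 vt] := ex_val m; have t20 := expf_neq0 2 t0.
exists (x / t ^+ 2), t; split=> //; last by rewrite divfK.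
by apply/weqP; rewrite mulf_neq0 ?invr_eq0 // vM ?invr_eq0 // vV // vX // vt; split=> //; lia.
Qed.

Lemma odd_valP x : x != 0 -> odd `|v x| ->
  exists u t, [/\ weq u 0, t != 0 & x = 2 * u * t ^+ 2].
Proof.
move=> x0 vx; have := @even_valP (x / 2); rewrite mulf_neq0 ?invr_eq0 ?two_neq0 // => /(_ isT)[].
  by rewrite vM ?invr_eq0 ?two_neq0 // vV ?two_neq0 // (v_two HF); lia.
by move=> u [t [hu t0 e]]; exists u, t; split=> //; rewrite -mulrA -e mulrC divfK ?two_neq0.
Qed.

Lemma weq_1p2 x : wge x 0 -> weq (1 + 2 * x) 0.
Proof. by move=> hx; apply: weqDl weq1 _; apply: wge2M hx _. Qed.

Lemma weq_1p4 x : wge x 0 -> weq (1 + 4 * x) 0.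
Proof. by move=> hx; apply: weqDl weq1 _; apply: wge4M hx _. Qed.

Lemma unit_near_sqr u : weq u 0 -> exists s x, [/\ s != 0, wge x 0 & u = (1 + 2 * x) * s ^+ 2].
Proof.
move=> hu; have [s _ su] := residue_sqrt (weq_wge hu).
have s20 : weq (s ^+ 2) 0 by apply: weq_near hu (wgeW su _).
have s0 := weq_neq0 (weq_sqr (k := 0) s20).
exists s, ((u - s ^+ 2) / s ^+ 2 / 2); split=> //; last by field; rewrite s0 two_neq0.
by rewrite (wge_divl _ _ weq2) (wge_divl _ _ s20) wge_subC.
Qed.

Lemma near_sqr_of_artin_schreier x z : wge z 0 -> wge (z ^+ 2 + z - x) 2 ->
  exists2 t, t != 0 & 1 + 4 * x = t ^+ 2.
Proof.
move=> hz zx; have hs := weqX 2 (weq_1p2 hz).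
have [|t t0 e] := @sqrt_near (1 + 4 * x) _ hs.
  have -> : 1 + 4 * x - (1 + 2 * z) ^+ 2 = - (4 * (z ^+ 2 + z - x)) by ring.
  by rewrite wgeN; apply: wge4M zx _.
exists ((1 + 2 * z) * t); last by rewrite e exprMn.
by rewrite mulf_neq0 // (weq_neq0 (weq_1p2 hz)).
Qed.

(* p^2 + p q + w q^2 is the norm form of the unramified algebra of discriminant 1 - 4 w. *)
Lemma is_norm_unram w p q : is_norm (1 - 4 * w) (p ^+ 2 + p * q + w * q ^+ 2).
Proof. by exists (p + q / 2), (q / 2); field; rewrite two_neq0. Qed.

Lemma unit_is_norm_unram w u : wge w 0 -> weq u 0 -> is_norm (1 - 4 * w) u.
Proof.
move=> hw hu.
have norm_1p4 z : wge z 0 -> is_norm (1 - 4 * w) (1 + 4 * z).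
  move=> hz; have := is_norm_unram w 1 (4 * z); apply: is_norm_near.
    have -> : 1 ^+ 2 + 1 * (4 * z) + w * (4 * z) ^+ 2 = 1 + 4 * (z + w * z * (4 * z)) by ring.
    by apply: weq_1p4; integrality.
  have -> : 1 + 4 * z - (1 ^+ 2 + 1 * (4 * z) + w * (4 * z) ^+ 2) = - (4 * (4 * (w * z * z))) by ring.
  by rewrite wgeN; apply: (wge4M (k := 4)) => //; apply: (wge4M (k := 0)) => //; integrality.
have [s [x [s0 hx ->]]] := unit_near_sqr hu.
rewrite is_norm_mul_sqr //; have := is_norm_unram w 1 (2 * x); set y := (_ + _ + _) => y_norm.
have y0 : y != 0.
  apply: (@weq_neq0 _ 0); rewrite (_ : y = 1 + 2 * (x + 2 * (w * x ^+ 2))); last by rewrite /y; ring.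
  by apply: weq_1p2; integrality.
apply: is_norm_mulKr y_norm => //.
have -> : (1 + 2 * x) * y = 1 + 4 * (x + x ^+ 2 + w * x ^+ 2 * (1 + 2 * x)) by rewrite /y; ring.
by apply: norm_1p4; integrality.
Qed.

Lemma hilb_unram_unit w t u : wge w 0 -> t != 0 -> weq u 0 -> hilb ((1 - 4 * w) * t ^+ 2) u = 1.
Proof.
move=> hw t0 hu; have w0 : 1 - 4 * w != 0.
  by rewrite -mulrN (weq_neq0 (weq_1p4 _)) // wgeN.
by rewrite hilb_mull_sqr //; apply/hilbP => //; exact: unit_is_norm_unram.
Qed.

(* A residue-valued invariant R of F^* modulo norms, whose elements z^2 + z are the class of norms,
   bounds the index of the norm group by 2. *)
Lemma is_norm_index_of_residue a (R : F -> F -> Prop) :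
  (forall y, y != 0 -> exists2 r, wge r 0 & R y r) ->
  (forall y y' r r', R y r -> R y' r' -> R (y * y') (r + r')) ->
  (forall y r z, R y r -> wge z 0 -> wge (z ^+ 2 + z - r) 2 -> is_norm a y) ->
  forall b c, b != 0 -> c != 0 -> [\/ is_norm a b, is_norm a c | is_norm a (b * c)].
Proof.
move=> R_total R_mul R_norm b c /R_total[r r_int br] /R_total[s s_int cs].
have [z z_int /or3P[]] := residue_artin_schreier r_int s_int => zrs.
- by apply: Or31; apply: R_norm br z_int zrs.
- by apply: Or32; apply: R_norm cs z_int zrs.
by apply: Or33; apply: R_norm (R_mul _ _ _ _ br cs) z_int zrs.
Qed.

Section RamifiedUniformizer.

Variable u : F.
Hypothesis u_unit : weq u 0.
Notation a := (2 * u).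

Lemma unit_residue_ram2 y : weq y 0 -> exists2 r, wge r 0 & is_norm a (y * (1 + 4 * r)).
Proof.
move=> hy; have u0 := weq_neq0 u_unit; have [s [x [_ hx ->]]] := unit_near_sqr hy.
have [t ht tx] := residue_sqrt (wge_div hx u_unit (lexx _)).
have hd : wge ((x - u * t ^+ 2) / 2) 0.
  rewrite (wge_divl _ _ weq2) (_ : _ - _ = - (u * (t ^+ 2 - x / u))); last by field.
  by rewrite wgeN; apply: (wgeM_le (weq_wge u_unit) tx).
exists ((x - u * t ^+ 2) / 2 - x * (u * t ^+ 2)); first by integrality.
have -> : (1 + 2 * x) * s ^+ 2 * (1 + 4 * ((x - u * t ^+ 2) / 2 - x * (u * t ^+ 2))) =
   (1 ^+ 2 - a * t ^+ 2) * ((1 + 2 * x) * s) ^+ 2 by field; rewrite two_neq0.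
by apply: is_normM (is_norm_sqr _ _); exists 1, t.
Qed.

Lemma residue_ram2 y : y != 0 -> exists2 r, wge r 0 & is_norm a (y * (1 + 4 * r)).
Proof.
move=> y0; have u0 := weq_neq0 u_unit; have [vy|vy] := boolP (odd `|v y|); last first.
  have [u' [t [hu' t0 ->]]] := even_valP y0 vy; have [r hr r_norm] := unit_residue_ram2 hu'.
  by exists r => //; rewrite mulrAC is_norm_mul_sqr.
have [u' [t [hu' _ ->]]] := odd_valP y0 vy.
have [|r hr r_norm] := @unit_residue_ram2 (- (u * u')); first by rewrite weqN; apply: (weqM u_unit hu').
exists r => //; have -> : 2 * u' * t ^+ 2 * (1 + 4 * r) =
  (0 ^+ 2 - a * 1 ^+ 2) * (- (u * u') * (1 + 4 * r)) * (t / u) ^+ 2 by field.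
by apply: is_normM (is_norm_sqr _ _); apply: is_normM r_norm; exists 0, 1.
Qed.

Lemma is_norm_index_ram2 b c : b != 0 -> c != 0 ->
  [\/ is_norm a b, is_norm a c | is_norm a (b * c)].
Proof.
apply: (is_norm_index_of_residue (R := fun y r => wge r 0 /\ is_norm a (y * (1 + 4 * r)))).
- by move=> y /residue_ram2[r hr hy]; exists r.
- move=> y y' r r' [hr hy] [hr' hy']; split; first exact: wgeD.
  have := is_normM hy hy'; rewrite mulrACA.
  have rr' := weq_1p4 (wgeD hr hr').
  have [|t t0 ->] := @sqrt_near ((1 + 4 * r) * (1 + 4 * r')) _ rr'; last by rewrite mulrA is_norm_mul_sqr.
  have -> : (1 + 4 * r) * (1 + 4 * r') - (1 + 4 * (r + r')) = 4 * (4 * (r * r')) by ring.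
  by apply: (wge4M (k := 4)) => //; apply: (wge4M (k := 0)) => //; integrality.
move=> y r z [_ hy] hz rz; have [t t0 tE] := near_sqr_of_artin_schreier hz rz.
by move: hy; rewrite tE is_norm_mul_sqr.
Qed.

End RamifiedUniformizer.

Section RamifiedUnit.

Variable x0 : F.
Hypothesis x0_unit : weq x0 0.
Notation a := (1 + 2 * x0).

Lemma is_norm_ram1 y : is_norm a (1 + 2 * (y - x0 * y ^+ 2)).
Proof. by exists (1 + y), y; ring. Qed.

Lemma near_one_is_norm_ram1 z : wge z 0 -> is_norm a (1 + 4 * z).
Proof.
move=> hz; have x00 := weq_neq0 x0_unit.
have := is_norm_ram1 (x0^-1 - 2 * z).
have -> : 1 + 2 * (x0^-1 - 2 * z - x0 * (x0^-1 - 2 * z) ^+ 2) = 1 + 4 * (z * (1 - 2 * (x0 * z))).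
  by field.
apply: is_norm_near; first by apply: weq_1p4; integrality.
have -> : 1 + 4 * z - (1 + 4 * (z * (1 - 2 * (x0 * z)))) = 4 * (2 * (z * (x0 * z))) by ring.
by apply: (wge4M (k := 2)) => //; apply: (wge2M (k := 0)) => //; integrality.
Qed.

Lemma is_norm_1p2_congr y x x' : wge x 0 -> wge x' 0 -> wge (x - x') 2 ->
  is_norm a (y * (1 + 2 * x)) <-> is_norm a (y * (1 + 2 * x')).
Proof.
suff impl x1 x2 : wge x1 0 -> wge x2 0 -> wge (x1 - x2) 2 ->
    is_norm a (y * (1 + 2 * x1)) -> is_norm a (y * (1 + 2 * x2)).
  by move=> hx hx' xx'; split; apply: impl; rewrite // wge_subC.
move=> h1 h2 h12 y_norm; have n1 := weq_neq0 (weq_1p2 h1).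
rewrite -(is_norm_mul_sqr _ _ n1).
have -> : y * (1 + 2 * x2) * (1 + 2 * x1) ^+ 2 =
   y * (1 + 2 * x1) * (1 + 4 * ((x2 - x1) / 2 + x1 + x1 * x2)) by field; rewrite two_neq0.
apply: is_normM y_norm (near_one_is_norm_ram1 _).
have : wge ((x2 - x1) / 2) 0 by rewrite (wge_divl _ _ weq2) wge_subC.
by move=> h; integrality.
Qed.

Lemma residue_ram1 y : y != 0 -> exists2 x, wge x 0 & is_norm a (y * (1 + 2 * x)).
Proof.
move=> y0; have x00 := weq_neq0 x0_unit.
have residue_unit u : weq u 0 -> exists2 x, wge x 0 & is_norm a (u * (1 + 2 * x)).
  move=> /unit_near_sqr[s [x [_ hx ->]]]; exists x => //.
  by rewrite mulrAC -expr2; apply: is_normM; apply: is_norm_sqr.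
have [vy|vy] := boolP (odd `|v y|); last first.
  have [u [t [hu t0 ->]]] := even_valP y0 vy; have [x hx x_norm] := residue_unit _ hu.
  by exists x => //; rewrite mulrAC is_norm_mul_sqr.
have [u [t [hu _ ->]]] := odd_valP y0 vy.
have [|x hx x_norm] := residue_unit (- (x0 * u)); first by rewrite weqN; apply: (weqM x0_unit hu).
exists x => //; have -> : 2 * u * t ^+ 2 * (1 + 2 * x) =
  (1 ^+ 2 - a * 1 ^+ 2) * (- (x0 * u) * (1 + 2 * x)) * (t / x0) ^+ 2 by field.
by apply: is_normM (is_norm_sqr _ _); apply: is_normM x_norm; exists 1, 1.
Qed.

Lemma is_norm_index_ram1 b c : b != 0 -> c != 0 ->
  [\/ is_norm a b, is_norm a c | is_norm a (b * c)].
Proof.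
have x00 := weq_neq0 x0_unit.
have hx0V := weq_wge (weqV0 x0_unit).
apply: (is_norm_index_of_residue
  (R := fun y r => exists x, [/\ wge x 0, r = - (x0 * x) & is_norm a (y * (1 + 2 * x))])).
- move=> y /residue_ram1[x hx hy]; exists (- (x0 * x)); last by exists x.
  by integrality.
- move=> y y' _ _ [x [hx -> hy]] [x' [hx' -> hy']]; exists (x + x'); split; [integrality | by ring |].
  have := is_normM hy hy'; rewrite mulrACA.
  have -> : (1 + 2 * x) * (1 + 2 * x') = 1 + 2 * (x + x' + 2 * (x * x')) by ring.
  apply: (is_norm_1p2_congr _ _ _ _).1; [integrality..|].
  by rewrite addrAC subrr add0r; apply: (wge2M (k := 0)) => //; integrality.
move=> y _ z [x [hx -> hy]] hz zx; pose w := - z / x0 - x0 * (- z / x0) ^+ 2.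
have w_int : wge w 0 by rewrite /w; integrality.
have xw : wge (x - w) 2.
  have -> : x - w = (z ^+ 2 + z - - (x0 * x)) / x0 by rewrite /w; field.
  by rewrite (wge_divl _ _ x0_unit).
have := hy; rewrite (is_norm_1p2_congr _ hx w_int xw) => yw_norm.
by apply: is_norm_mulKr yw_norm (is_norm_ram1 _); apply: weq_neq0 (weq_1p2 w_int).
Qed.

End RamifiedUnit.

Lemma is_norm_index a b c : a != 0 -> b != 0 -> c != 0 ->
  [\/ is_norm a b, is_norm a c | is_norm a (b * c)].
Proof.
move=> a0 b0 c0.
have scale a' t : t != 0 -> [\/ is_norm a' b, is_norm a' c | is_norm a' (b * c)] ->
    [\/ is_norm (a' * t ^+ 2) b, is_norm (a' * t ^+ 2) c | is_norm (a' * t ^+ 2) (b * c)].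
  by move=> t0 [] h; [apply: Or31 | apply: Or32 | apply: Or33]; apply: is_norm_base_mul_sqr.
have [va|va] := boolP (odd `|v a|).
  by have [u [t [hu t0 ->]]] := odd_valP a0 va; apply/scale/is_norm_index_ram2.
have [u [t [hu t0 ->]]] := even_valP a0 va; apply: (scale _ _ t0).
have [s [x [s0 hx ->]]] := unit_near_sqr hu; apply: (scale _ _ s0).
have [hx2|/(wge_weq (k := 0) hx)] := boolP (wge x 2); last by move/is_norm_index_ram1; apply.
have even_norm y : y != 0 -> ~~ odd `|v y| -> is_norm (1 + 2 * x) y.
  move=> y0 /(even_valP y0)[u' [t' [hu' t'0 ->]]]; rewrite is_norm_mul_sqr //.
  rewrite (_ : 1 + 2 * x = 1 - 4 * - (x / 2)); last by field; rewrite two_neq0.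
  by apply: unit_is_norm_unram => //; rewrite wgeN (wge_divl _ _ weq2).
have [vb|vb] := boolP (odd `|v b|); last by apply: Or31; apply: even_norm.
have [vc|vc] := boolP (odd `|v c|); last by apply: Or32; apply: even_norm.
by apply: Or33; apply: even_norm; rewrite ?mulf_neq0 // vM //; move: vb vc; lia_goal.
Qed.

Lemma hilbMr (a b c : F) : a != 0 -> b != 0 -> c != 0 -> hilb a (b * c) = hilb a b * hilb a c.
Proof.
move=> a0 b0 c0; have bc0 : b * c != 0 by rewrite mulf_neq0.
have [[ab|ab] [ac|ac]] := (hilb_pm1 a b, hilb_pm1 a c); rewrite ab ac.
- by apply/hilbP => //; apply: is_normM; apply/hilbP.
- case: (hilb_pm1 a (b * c)) => // /(hilbP _ a0) bc_norm; exfalso.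
  have /(hilbP _ a0) : is_norm a c by apply: (is_norm_mulKr b0); [rewrite mulrC | apply/hilbP].
  by rewrite ac.
- case: (hilb_pm1 a (b * c)) => // /(hilbP _ a0) bc_norm; exfalso.
  have /(hilbP _ a0) : is_norm a b by apply: (is_norm_mulKr c0 bc_norm); apply/hilbP.
  by rewrite ab.
by case: (is_norm_index a0 b0 c0) => /(hilbP _ a0) h; [rewrite h in ab | rewrite h in ac | rewrite h].
Qed.

Lemma hilbMl (a b c : F) : a != 0 -> b != 0 -> c != 0 -> hilb (a * b) c = hilb a c * hilb b c.
Proof. by move=> *; rewrite ![hilb _ c]hilbC hilbMr. Qed.

(** * The Hasse invariant *)

Section SymmetricForm.

Variables (V : lmodType F) (bt : {symmetric V}).

Lemma symC x y : bt x y = bt y x. Proof. by rewrite hermC expr0 mul1r. Qed.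
Lemma symDl x y z : bt (x + y) z = bt x z + bt y z. Proof. exact: linearDl. Qed.
Lemma symZl c x y : bt (c *: x) y = c * bt x y. Proof. exact: linearZl_LR. Qed.
Lemma symZr c x y : bt x (c *: y) = c * bt x y. Proof. exact: linearZr_LR. Qed.

Lemma symDD x y : bt (x + y) (x + y) = bt x x + 2 * bt x y + bt y y.
Proof. by rewrite symDl !linearDr /= [bt y x]symC; ring. Qed.

End SymmetricForm.

Lemma hilb1 (x : F) : x != 0 -> hilb x 1 = 1.
Proof. by move=> x0; apply/hilbP; rewrite // -[1](expr1n _ 2); apply: is_norm_sqr. Qed.

Lemma hilb_prod (x : F) s : x != 0 -> all (fun y => y != 0) s ->
  \prod_(y <- s) hilb x y = hilb x (\prod_(y <- s) y).
Proof.
move=> x0; elim: s => [|y s IHs] /=; first by rewrite !big_nil hilb1.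
by move=> /andP[y0 s0]; rewrite !big_cons IHs // hilbMr // prodf_seq_neq0.
Qed.

Definition eq_mod_sqr (x y : F) : Prop := exists2 c, c != 0 & x = y * c ^+ 2.

Lemma eq_mod_sqr_refl x : eq_mod_sqr x x.
Proof. by exists 1; rewrite ?oner_eq0 // expr1n mulr1. Qed.

Lemma eq_mod_sqr_sym x y : eq_mod_sqr x y -> eq_mod_sqr y x.
Proof. by move=> [c c0 ->]; exists c^-1; rewrite ?invr_eq0 // exprVn mulfK // expf_neq0. Qed.

Lemma eq_mod_sqr_trans y x z : eq_mod_sqr x y -> eq_mod_sqr y z -> eq_mod_sqr x z.
Proof. by move=> [c c0 ->] [d d0 ->]; exists (d * c); [rewrite mulf_neq0 | ring]. Qed.

Lemma eq_mod_sqrM x y z t : eq_mod_sqr x y -> eq_mod_sqr z t -> eq_mod_sqr (x * z) (y * t).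
Proof. by move=> [c c0 ->] [d d0 ->]; exists (c * d); [rewrite mulf_neq0 | ring]. Qed.

Lemma hilb_eq_mod_sqr x x' y y' : eq_mod_sqr x x' -> eq_mod_sqr y y' -> hilb x y = hilb x' y'.
Proof. by move=> [c c0 ->] [d d0 ->]; rewrite hilb_mul_sqr ?hilb_mull_sqr. Qed.

Fixpoint hasse (s : seq F) : int :=
  if s is x :: r then (\prod_(y <- r) hilb x y) * hasse r else 1.

Notation nonzero s := (all (fun x : F => x != 0) s).

Lemma hasse_cat s t : nonzero s -> nonzero t ->
  hasse (s ++ t) = hasse s * hasse t * hilb (\prod_(x <- s) x) (\prod_(y <- t) y).
Proof.
move=> + t0; have pt0 : \prod_(y <- t) y != 0 by rewrite prodf_seq_neq0.
elim: s => [|x s IHs] /=; first by rewrite big_nil hilbC hilb1 // mulr1 mul1r.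
move=> /andP[x0 s0]; have ps0 : \prod_(y <- s) y != 0 by rewrite prodf_seq_neq0.
by rewrite IHs // big_cat big_cons /= hilbMl // !hilb_prod //; ring.
Qed.

Lemma hasse_perm s t : perm_eq s t -> hasse s = hasse t.
Proof.
have hasse_mid s1 x s2 : hasse (s1 ++ x :: s2) = hasse (x :: s1 ++ s2).
  elim: s1 => //= y s1; rewrite /= => ->.
  by rewrite !big_cat /= !big_cons (hilbC y x) !big_cat /=; ring.
elim: s t => [|x s IHs] t; first by rewrite perm_sym => /perm_nilP->.
move=> st; have xt : x \in t by rewrite -(perm_mem st) mem_head.
case/splitPr: xt st => t1 t2; rewrite perm_sym perm_catC cat_cons perm_cons perm_catC perm_sym => st.
by rewrite hasse_mid /= (IHs _ st) (perm_big _ st).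
Qed.

Definition hasse_equiv (s t : seq F) : Prop :=
  hasse s = hasse t /\ eq_mod_sqr (\prod_(x <- s) x) (\prod_(x <- t) x).

Lemma hasse_equiv_refl s : hasse_equiv s s.
Proof. by split=> //; apply: eq_mod_sqr_refl. Qed.

Lemma hasse_equiv_sym s t : hasse_equiv s t -> hasse_equiv t s.
Proof. by case=> st dst; split=> //; apply: eq_mod_sqr_sym. Qed.

Lemma hasse_equiv_trans t s r : hasse_equiv s t -> hasse_equiv t r -> hasse_equiv s r.
Proof. by move=> [st dst] [tr dtr]; split; [rewrite st | apply: eq_mod_sqr_trans dst dtr]. Qed.

Lemma hasse_equiv_perm s t : perm_eq s t -> hasse_equiv s t.
Proof.
by move=> st; split; [apply: hasse_perm | rewrite (perm_big _ st); apply: eq_mod_sqr_refl].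
Qed.

Lemma hasse_equiv_cat s s' t t' : nonzero s -> nonzero s' -> nonzero t -> nonzero t' ->
  hasse_equiv s s' -> hasse_equiv t t' -> hasse_equiv (s ++ t) (s' ++ t').
Proof.
move=> s0 s0' t0 t0' [ss dss] [tt dtt]; split; last by rewrite !big_cat; apply: eq_mod_sqrM.
by rewrite !hasse_cat // ss tt (hilb_eq_mod_sqr dss dtt).
Qed.

Lemma hasse_equiv_cons x y s t : y != 0 -> nonzero s -> nonzero t ->
  eq_mod_sqr x y -> hasse_equiv s t -> hasse_equiv (x :: s) (y :: t).
Proof.
move=> y0 s0 t0 xy st; have x0 : x != 0 by have [c c0 ->] := xy; rewrite mulf_neq0 ?expf_neq0.
rewrite -[x :: s]cat1s -[y :: t]cat1s; apply: hasse_equiv_cat; rewrite //= ?x0 ?y0 //.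
by split; [rewrite /= !big_nil | rewrite !big_seq1].
Qed.

Lemma hasse_equiv_rotate q1 q2 c1 c2 (N := c1 ^+ 2 * q1 + c2 ^+ 2 * q2) :
  q1 != 0 -> q2 != 0 -> c1 != 0 -> c2 != 0 -> N != 0 ->
  hasse_equiv [:: N; q1 * q2 * N] [:: q1; q2].
Proof.
move=> q10 q20 c10 c20 N0.
have hilb_sum (A B : F) : A != 0 -> B != 0 -> A + B != 0 -> hilb (A + B) (A * B * (A + B)) = hilb A B.
  move=> A0 B0 AB0; have : hilb (A * (A + B)) (B * (A + B)) = 1.
    by apply/hilbP; rewrite ?mulf_neq0 //; exists (A + B), 1; ring.
  rewrite hilbMl ?mulf_neq0 // !hilbMr ?mulf_neq0 // [hilb A (A + B)]hilbC.
  move: (hilb_pm1 A B) (hilb_pm1 (A + B) A) (hilb_pm1 (A + B) B) (hilb_pm1 (A + B) (A + B)).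
  by do 4![case=> ->].
split; last by rewrite !big_cons !big_nil; exists N => //; ring.
rewrite /= !big_seq1 !big_nil !mulr1.
have [A0 B0] : c1 ^+ 2 * q1 != 0 /\ c2 ^+ 2 * q2 != 0 by rewrite !mulf_neq0 ?expf_neq0.
transitivity (hilb N (c1 ^+ 2 * q1 * (c2 ^+ 2 * q2) * N)).
  apply: hilb_eq_mod_sqr; first exact: eq_mod_sqr_refl.
  by apply: eq_mod_sqr_sym; exists (c1 * c2); [rewrite mulf_neq0 | ring].
rewrite hilb_sum //; apply: hilb_eq_mod_sqr; [exists c1 => // | exists c2 => //]; exact: mulrC.
Qed.

Lemma pair_sum_neq0 (T : eqType) (a : T -> F) s :
  (1 < count (fun y => a y != 0%R) s)%N -> \sum_(y <- s) a y != 0 ->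
  exists y1 y2 r, [/\ perm_eq s (y1 :: y2 :: r), a y1 != 0, a y2 != 0 & a y1 + a y2 != 0].
Proof.
set P := fun y => _; rewrite -size_filter => s1 sum0.
have sE : perm_eq s (filter P s ++ filter (predC P) s) by rewrite perm_sym (perm_filterC P s).
have : \sum_(y <- filter P s) a y != 0.
  move: sum0; rewrite (perm_big _ sE) big_cat /= [X in _ + X]big1_seq ?addr0 // => y /=.
  by rewrite mem_filter /= negbK => /andP[/eqP].
have : all P (filter P s) := filter_all P s.
move: s1 sE; case: (filter P s) => [|y1 [|y2 f]] //= _; set g := filter _ s.
move=> sE /and3P[a1 a2 af] sum_neq0.
have [a12|a12] := eqVneq (a y1 + a y2) 0; last by exists y1, y2, (f ++ g).
case: f sE af sum_neq0 => [|y3 f]; first by rewrite !big_cons big_nil addr0 a12 eqxx.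
move=> sE /andP[a3 _] _; have [a13|a13] := eqVneq (a y1 + a y3) 0; last first.
  exists y1, y3, (y2 :: f ++ g); split=> //; apply: perm_trans sE _; rewrite /= perm_cons.
  by apply/permPl; apply: (perm_catCA [:: y2] [:: y3]).
exists y2, y3, (y1 :: f ++ g); split=> //.
  by apply: perm_trans sE _; apply/permPl; apply: (perm_catCA [:: y1] [:: y2; y3]).
have -> : a y2 + a y3 = (a y1 + a y2) + (a y1 + a y3) - 2 * a y1 by ring.
by rewrite a12 a13 addr0 sub0r oppr_eq0 mulf_neq0 ?two_neq0.
Qed.

Section OrthogonalBasis.

Variables (V : lmodType F) (bt : {symmetric V}).
Local Notation "''[' x , y ]" := (bt x y) : ring_scope.
Local Notation "''[' x ]" := (bt x x) : ring_scope.
Implicit Types (x y z : V) (s r : seq V).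

Definition orthogonal_seq s : bool :=
  all (fun x => '[x] != 0) s && pairwise (fun x y => '[x, y] == 0) s.

(* For an orthogonal sequence [s] this is membership in its linear span. *)
Definition Span s x : Prop := x = \sum_(y <- s) ('[x, y] / '[y]) *: y.

Definition norms s : seq F := [seq '[x] | x <- s].

Lemma orthogonal_seq_cons x s :
  orthogonal_seq (x :: s) = [&& '[x] != 0, all (fun y => '[x, y] == 0) s & orthogonal_seq s].
Proof. by rewrite /orthogonal_seq /= -!andbA; do !bool_congr. Qed.

Lemma orthogonal_seq_perm s r : perm_eq s r -> orthogonal_seq s = orthogonal_seq r.
Proof.
move=> sr; rewrite /orthogonal_seq (perm_all _ sr); congr andb.
have orthoC s1 s2 : allrel (fun x y => '[x, y] == 0) s1 s2 = allrel (fun x y => '[x, y] == 0) s2 s1.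
  by rewrite allrelC; apply: eq_allrel => x y; rewrite symC.
apply: catCA_perm_subst sr => s1 s2 s3; rewrite !pairwise_cat !allrel_catr (orthoC s2 s1) -!andbA.
by do !bool_congr.
Qed.

Lemma norms_neq0 s : orthogonal_seq s -> all (fun q : F => q != 0) (norms s).
Proof. by rewrite all_map => /andP[]. Qed.

Lemma Span_norm s x : Span s x -> '[x] = \sum_(y <- s) '[x, y] ^+ 2 / '[y].
Proof.
move=> xE; rewrite {1}xE linear_sumlz /=; apply: eq_bigr => y _.
by rewrite symZl [bt y x]symC; ring.
Qed.

Lemma Span_sum (I : eqType) (r : seq I) (c : I -> F) (e : I -> V) :
  orthogonal_seq (map e r) -> Span (map e r) (\sum_(i <- r) c i *: e i).
Proof.
elim: r => [|i r IHr]; first by rewrite /Span !big_nil.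
rewrite map_cons orthogonal_seq_cons => /and3P[i0 /allP ir or]; rewrite /Span !big_cons.
have sum_ei : '[\sum_(j <- r) c j *: e j, e i] = 0.
  rewrite linear_sumlz big1_seq // => j /= jr.
  by rewrite symZl symC (eqP (ir _ (map_f e jr))) mulr0.
congr (_ + _); first by rewrite symDl symZl sum_ei addr0 mulfK.
rewrite {1}(IHr or); apply: eq_big_seq => y yr.
by rewrite symDl symZl (eqP (ir _ yr)) mulr0 add0r.
Qed.

Definition witt_chain s r : Prop :=
  [/\ orthogonal_seq r, size r = size s, hasse_equiv (norms r) (norms s) &
      forall x, Span s x -> Span r x].

Lemma witt_chain_trans r s q : witt_chain s r -> witt_chain r q -> witt_chain s q.
Proof.
move=> [_ sr ir pr] [oq rq iq pq]; split=> //; [by rewrite rq | exact: hasse_equiv_trans iq ir |].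
by move=> x /pr/pq.
Qed.

Lemma witt_chain_perm s r : orthogonal_seq s -> perm_eq s r -> witt_chain s r.
Proof.
move=> os sr; split; rewrite -?(orthogonal_seq_perm sr) ?(perm_size sr) //.
  by apply: hasse_equiv_perm; rewrite perm_sym perm_map.
by move=> x; rewrite /Span -(perm_big _ sr).
Qed.

Lemma witt_chain_scale c y r : c != 0 -> orthogonal_seq (y :: r) -> witt_chain (y :: r) (c *: y :: r).
Proof.
move=> c0 oyr; move: (oyr); rewrite orthogonal_seq_cons => /and3P[y0 /allP yr or].
have cy_norm : '[c *: y] = '[y] * c ^+ 2 by rewrite symZl symZr; ring.
have cy0 : '[c *: y] != 0 by rewrite cy_norm mulf_neq0 ?expf_neq0.
split=> //.
- rewrite orthogonal_seq_cons cy0 or andbT; apply/allP => z /yr/eqP yz.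
  by rewrite symZl yz mulr0.
- apply: hasse_equiv_cons; rewrite ?norms_neq0 //; last exact: hasse_equiv_refl.
  by rewrite cy_norm; exists c.
move=> x xE; rewrite /Span {1}xE !big_cons; congr (_ + _).
by rewrite cy_norm symZr scalerA; congr (_ *: _); field; rewrite c0 y0.
Qed.

Lemma orthogonal_pair_span c1 c2 y1 y2 (z1 := c1 *: y1 + c2 *: y2)
    (z2 := (c2 * '[y2]) *: y1 - (c1 * '[y1]) *: y2) x :
  '[y1] != 0 -> '[y2] != 0 -> '[z1] != 0 -> '[y1, y2] = 0 ->
  [/\ '[z1] = c1 ^+ 2 * '[y1] + c2 ^+ 2 * '[y2], '[z2] = '[y1] * '[y2] * '[z1], '[z1, z2] = 0 &
      ('[x, z1] / '[z1]) *: z1 + ('[x, z2] / '[z2]) *: z2 =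
      ('[x, y1] / '[y1]) *: y1 + ('[x, y2] / '[y2]) *: y2].
Proof.
move=> y10 y20 + y12.
have norm1 : '[z1] = c1 ^+ 2 * '[y1] + c2 ^+ 2 * '[y2].
  by rewrite symDD !(symZl, symZr) y12; ring.
have norm2 : '[z2] = '[y1] * '[y2] * '[z1].
  by rewrite /z2 -scaleNr symDD !(symZl, symZr) y12 norm1; ring.
move=> z10; split=> //.
  by rewrite /z1 /z2 symDl !linearBr /= !(symZl, symZr) [bt y2 y1]symC y12; ring.
have xz1 : '[x, z1] = c1 * '[x, y1] + c2 * '[x, y2] by rewrite /z1 linearDr /= !symZr.
have xz2 : '[x, z2] = c2 * '[y2] * '[x, y1] - c1 * '[y1] * '[x, y2] by rewrite /z2 linearBr /= !symZr.
rewrite norm2 xz1 xz2 norm1 in z10 *.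
rewrite {1}/z1 {1}/z2 scalerDr scalerBr !scalerA addrACA -scalerDl -scalerBl.
by congr (_ *: _ + _ *: _); field; rewrite y10 y20 z10.
Qed.

Lemma witt_chain_rotate c1 c2 y1 y2 r (z1 := c1 *: y1 + c2 *: y2)
    (z2 := (c2 * '[y2]) *: y1 - (c1 * '[y1]) *: y2) :
  c1 != 0 -> c2 != 0 -> '[z1] != 0 -> orthogonal_seq (y1 :: y2 :: r) ->
  witt_chain (y1 :: y2 :: r) (z1 :: z2 :: r).
Proof.
move=> c10 c20 z10; rewrite !orthogonal_seq_cons /= -andbA => /and4P[y10 /eqP y12 /allP y1r].
move=> /and3P[y20 /allP y2r or].
have gram x := orthogonal_pair_span x y10 y20 z10 y12.
have [norm1 norm2 z12 _] := gram 0; rewrite -/z1 -/z2 in norm1 norm2 z12.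
have z20 : '[z2] != 0 by rewrite norm2 !mulf_neq0.
have zr z : z \in r -> '[z1, z] = 0 /\ '[z2, z] = 0.
  move=> zr; rewrite symDl linearBl /= !symZl.
  by rewrite (eqP (y1r _ zr)) (eqP (y2r _ zr)) !mulr0 addr0 subr0.
split=> //.
- rewrite !orthogonal_seq_cons /= z10 z20 z12 eqxx or /= andbT.
  by apply/andP; split; apply/allP => z /zr[/eqP ? /eqP].
- rewrite -[z1 :: _]/([:: z1; z2] ++ r) -[y1 :: _]/([:: y1; y2] ++ r) /norms !map_cat.
  apply: hasse_equiv_cat; rewrite /= ?z10 ?z20 ?y10 ?y20 ?norms_neq0 //.
    by rewrite norm2 norm1; apply: hasse_equiv_rotate; rewrite // -norm1.
  exact: hasse_equiv_refl.
move=> x xE; have [_ _ _ span] := gram x.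
by rewrite /Span {1}xE !big_cons !addrA -/z1 -/z2 span.
Qed.

Lemma orthogonal_seq_neq0 s y : orthogonal_seq s -> y \in s -> '[y] != 0.
Proof. by move=> /andP[/allP s0 _]; apply: s0. Qed.

Lemma witt_chain_single s x y : orthogonal_seq s -> Span s x -> y \in s -> '[x, y] != 0 ->
  (forall z, z \in rem y s -> '[x, z] = 0) -> exists r, witt_chain s (x :: r).
Proof.
move=> os xs ys xy xr; have pyr := perm_to_rem ys; exists (rem y s).
have xE : x = ('[x, y] / '[y]) *: y.
  rewrite {1}xs (perm_big _ pyr) big_cons /= [X in _ + X]big1_seq ?addr0 // => z /= /xr ->.
  by rewrite mul0r scale0r.
rewrite xE; apply: witt_chain_trans (witt_chain_perm os pyr) (witt_chain_scale _ _).
  by rewrite mulf_neq0 // invr_eq0 (orthogonal_seq_neq0 os).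
by rewrite -(orthogonal_seq_perm pyr).
Qed.

Definition support x s : nat := count (fun y => '[x, y] != 0) s.

Lemma witt_chain_shrink s x : orthogonal_seq s -> Span s x -> '[x] != 0 -> (1 < support x s)%N ->
  exists2 r, witt_chain s r & (support x r < support x s)%N.
Proof.
move=> os xs x0 two; pose comp y := '[x, y] ^+ 2 / '[y].
have comp_neq0 y : y \in s -> (comp y != 0) = ('[x, y] != 0).
  by move=> ys; rewrite mulf_eq0 invr_eq0 expf_eq0 /= (negPf (orthogonal_seq_neq0 os ys)) orbF.
have [||y1 [y2 [r [p12 xy1 xy2 sum12]]]] := @pair_sum_neq0 _ comp s.
- by rewrite (eq_in_count comp_neq0).
- by rewrite -(Span_norm xs).
have y1s : y1 \in s by rewrite (perm_mem p12) inE eqxx.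
have y2s : y2 \in s by rewrite (perm_mem p12) !inE eqxx orbT.
have [n1 n2] := (orthogonal_seq_neq0 os y1s, orthogonal_seq_neq0 os y2s).
rewrite comp_neq0 // in xy1; rewrite comp_neq0 // in xy2.
have os' := os; rewrite (orthogonal_seq_perm p12) in os'.
have y12 : '[y1, y2] = 0 by move: os'; rewrite orthogonal_seq_cons /= => /and3P[_ /andP[/eqP]].
pose c1 := '[x, y1] / '[y1]; pose c2 := '[x, y2] / '[y2].
have [c10 c20] : c1 != 0 /\ c2 != 0 by rewrite !mulf_neq0 ?invr_eq0.
have z10 : '[c1 *: y1 + c2 *: y2] != 0.
  rewrite symDD !(symZl, symZr) y12 !mulr0 addr0; move: sum12; congr (_ != 0).
  by rewrite /comp /c1 /c2; field; rewrite n1 n2.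
have rot := witt_chain_rotate c10 c20 z10 os'; set z2 := (_ - _) in rot.
have xz2 : '[x, z2] = 0 by rewrite linearBr /= !symZr /c1 /c2; field; rewrite n1 n2.
exists (c1 *: y1 + c2 *: y2 :: z2 :: r); first exact: witt_chain_trans (witt_chain_perm os p12) rot.
by rewrite /support (permP p12) /= xz2 eqxx xy1 xy2 !add1n ltnS; case: (_ != 0).
Qed.

Lemma witt_chain_through s x : orthogonal_seq s -> Span s x -> '[x] != 0 ->
  exists r, witt_chain s (x :: r).
Proof.
have [n] := ubnP (support x s); elim: n s => // n IHn s; rewrite ltnS => sn os xs x0.
have [le1|two] := leqP (support x s) 1; last first.
  have [r chain_r lt_r] := witt_chain_shrink os xs x0 two; have [or _ _ span_r] := chain_r.
  have [r' chain_r'] := IHn r (leq_trans lt_r sn) or (span_r _ xs) x0.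
  by exists r'; apply: witt_chain_trans chain_r'.
have /hasP[y ys xy] : has (fun y => '[x, y] != 0) s.
  apply: contraT => /hasPn xs0; move: x0; rewrite (Span_norm xs) big1_seq ?eqxx // => y /xs0/negPn/eqP->.
  by rewrite expr0n mul0r.
apply: (witt_chain_single os xs ys xy) => z zr; apply/eqP; apply: contraLR le1 => xz.
rewrite -ltnNge /support (permP (perm_to_rem ys)) /= xy add1n ltnS -has_count.
by apply/hasP; exists z.
Qed.

Lemma hasse_equiv_basis s r : size s = size r -> orthogonal_seq s -> orthogonal_seq r ->
  {in r, forall x, Span s x} -> hasse_equiv (norms s) (norms r).
Proof.
elim: r s => [|x r IHr] s; first by move=> /size0nil-> *; apply: hasse_equiv_refl.
move=> sz os; rewrite orthogonal_seq_cons => /and3P[x0 /allP xr or] rs.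
have [s' [+ sz' inv span]] := witt_chain_through os (rs x (mem_head _ _)) x0.
rewrite orthogonal_seq_cons => /and3P[_ _ os'].
apply: hasse_equiv_trans (hasse_equiv_sym inv) _.
apply: (hasse_equiv_cons (s := norms s') (t := norms r)); rewrite ?norms_neq0 //.
  exact: eq_mod_sqr_refl.
apply: IHr => // [|z zr]; first by move: sz'; rewrite sz => -[].
have := span z (rs z _); rewrite inE zr orbT => /(_ isT).
by rewrite /Span big_cons symC (eqP (xr _ zr)) mul0r scale0r add0r.
Qed.

End OrthogonalBasis.

Section MatrixForm.

Variable m : nat.
Implicit Types (M X : 'M[F]_m) (d : 'rV[F]_m) (x y : 'cV[F]_m).

Definition qform M x y : F := (x^T *m M *m y) 0 0.

Lemma qform_bilinear M : bilinear_for *%R (idfun \; *%R) (qform M).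
Proof.
split=> u a x y; rewrite /qform.
- by rewrite linearP /= !mulmxDl -!scalemxAl !mxE.
- by rewrite mulmxDr -scalemxAr !mxE.
Qed.

Lemma qform_hermitian M x y : M^T = M -> qform M x y = (-1) ^+ false * idfun (qform M y x).
Proof.
move=> sM; rewrite mul1r /qform /= -[in LHS](trmxK (x^T *m M *m y)) [LHS]mxE.
by rewrite !trmx_mul sM trmxK mulmxA.
Qed.

Definition symmx_form M (sM : M^T = M) : {symmetric 'cV[F]_m} :=
  HB.pack (qform M)
    (bilinear_isBilinear.Build F _ _ _ _ _ (qform M) (qform_bilinear M))
    (isHermitianSesquilinear.Build F _ false idfun (qform M) (fun x y => qform_hermitian x y sM)).

Lemma symmx_formE M (sM : M^T = M) x y : symmx_form sM x y = qform M x y. Proof. by []. Qed.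

Lemma qform_col M X i j : qform M (col i X) (col j X) = (X^T *m M *m X) i j.
Proof.
rewrite /qform !colE trmx_mul trmx_delta !mulmxA -[_ *m X *m _]mulmxA -!mulmxA -rowE !mulmxA -colE.
by rewrite !mxE.
Qed.

Lemma congr_diag_sym M X d : X \in unitmx -> X^T *m M *m X = diag_mx d -> M^T = M.
Proof.
move=> uX XMX; have uXt : X^T \in unitmx by rewrite unitmx_tr.
have -> : M = invmx X^T *m diag_mx d *m invmx X.
  by rewrite -XMX !mulmxA mulVmx // mul1mx mulmxK.
by rewrite !trmx_mul tr_diag_mx !trmx_inv trmxK mulmxA.
Qed.

Lemma det_congr_diag M X d : X^T *m M *m X = diag_mx d -> \det X ^+ 2 * \det M = \prod_i d 0 i.
Proof. by move=> XMX; rewrite -det_diag -XMX !det_mulmx det_tr; ring. Qed.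

Lemma hasse_pairwise (g : 'I_m -> F) s : pairwise (fun i j : 'I_m => (i < j)%N) s ->
  hasse (map g s) = \prod_(i <- s) \prod_(j <- s | (i < j)%N) hilb (g i) (g j).
Proof.
elim: s => [|i s IHs]; first by rewrite big_nil.
rewrite pairwise_cons => /andP[/allP is_min ss]; rewrite /= IHs // !big_cons ltnn; congr (_ * _).
  rewrite big_map big_seq [RHS]big_seq_cond; apply: eq_bigl => j.
  by case: (boolP (j \in s)) => // /is_min ->.
rewrite big_seq [RHS]big_seq; apply: eq_bigr => j /is_min ij.
by rewrite big_cons ltnNge (ltnW ij).
Qed.

Lemma hasse_enum d : hasse [seq d 0 i | i <- enum 'I_m] =
  \prod_(i < m) \prod_(j < m | (i < j)%N) hilb (d 0 i) (d 0 j).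
Proof.
rewrite hasse_pairwise; first by rewrite big_enum; apply: eq_bigr => i _; apply: big_enum_cond.
by have := iota_ltn_sorted 0 m; rewrite (sorted_pairwise ltn_trans) -val_enum_ord pairwise_map.
Qed.

Definition cols X := [seq col i X | i <- enum 'I_m].

Section Diagonalization.

Variables (M X : 'M[F]_m) (d : 'rV[F]_m) (sM : M^T = M).
Hypotheses (uX : X \in unitmx) (XMX : X^T *m M *m X = diag_mx d) (d0 : forall i, d 0 i != 0).

Let qform_cols i j : qform M (col i X) (col j X) = d 0 i *+ (i == j).
Proof. by rewrite qform_col XMX mxE. Qed.

Lemma norms_cols : norms (symmx_form sM) (cols X) = [seq d 0 i | i <- enum 'I_m].
Proof. by rewrite /norms -map_comp; apply: eq_map => i; rewrite /= qform_cols eqxx. Qed.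

Lemma orthogonal_seq_cols : orthogonal_seq (symmx_form sM) (cols X).
Proof.
rewrite /orthogonal_seq all_map pairwise_map; apply/andP; split.
  by apply/allP => i _; rewrite /= qform_cols eqxx d0.
have : pairwise (fun i j => i != j) (enum 'I_m) by rewrite -uniq_pairwise enum_uniq.
by apply: sub_pairwise => i j /negPf ij; rewrite /= qform_cols ij.
Qed.

Lemma Span_cols x : Span (symmx_form sM) (cols X) x.
Proof.
have -> : x = \sum_(i <- enum 'I_m) (invmx X *m x) i 0 *: col i X.
  rewrite -[LHS](mulKVmx uX) big_enum; apply/colP => k; rewrite mxE summxE.
  by apply: eq_bigr => i _; rewrite !mxE mulrC.
exact: Span_sum orthogonal_seq_cols.
Qed.

End Diagonalization.

Lemma eta_congr_diag M X d : X \in unitmx -> X^T *m M *m X = diag_mx d -> (forall i, d 0 i != 0) ->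
  Defs.eta M = eta_diag (\det M) d.
Proof.
move=> uX XMX d0; have sM := congr_diag_sym uX XMX.
rewrite /Defs.eta; set P := fun d : 'rV_m => _; set d' := classical_sets.xget _ _.
have [U [uU UMU]] : P d' by apply: classical_sets.xgetPex; exists d, X.
have d'0 i : d' 0 i != 0.
  suff /prodf_neq0/(_ i isT) : \prod_i d' 0 i != 0 by [].
  have : \prod_i d 0 i != 0 by apply/prodf_neq0 => j _; apply: d0.
  rewrite -(det_congr_diag XMX) mulf_eq0 negb_or => /andP[_ M0].
  by rewrite -(det_congr_diag UMU) mulf_neq0 ?expf_neq0 // -unitfE.
rewrite /eta_diag; congr (_ * _); rewrite -!hasse_enum -(norms_cols sM XMX) -(norms_cols sM UMU).
suff [] : hasse_equiv (norms (symmx_form sM) (cols U)) (norms (symmx_form sM) (cols X)) by [].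
apply: hasse_equiv_basis; first by rewrite !size_map.
- exact: orthogonal_seq_cols UMU d'0.
- exact: orthogonal_seq_cols XMX d0.
by move=> x _; apply: Span_cols uU UMU d'0 x.
Qed.

End MatrixForm.

(** * Discriminants *)

Definition unramified (x : F) : Prop := exists w t, [/\ wge w 0, t != 0 & x = (1 - 4 * w) * t ^+ 2].

Definition ramified (x : F) : Prop :=
  (x != 0 /\ odd `|v x|) \/ exists u t, [/\ weq u 0, t != 0 & x = (1 + 2 * u) * t ^+ 2].

Lemma weq_1m4 w : wge w 0 -> weq (1 - 4 * w) 0.
Proof. by move=> hw; rewrite -mulrN; apply: weq_1p4; rewrite wgeN. Qed.

Lemma unramified1 : unramified 1.
Proof. by exists 0, 1; rewrite wge0 oner_eq0; split=> //; ring. Qed.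

Lemma unramifiedM x y : unramified x -> unramified y -> unramified (x * y).
Proof.
move=> [w [t [hw t0 ->]]] [w' [t' [hw' t0' ->]]].
by exists (w + w' - 4 * (w * w')), (t * t'); split; [integrality | rewrite mulf_neq0 | ring].
Qed.

Lemma unramified_neq0 x : unramified x -> x != 0.
Proof. by move=> [w [t [hw t0 ->]]]; rewrite mulf_neq0 ?expf_neq0 // (weq_neq0 (weq_1m4 hw)). Qed.

Lemma unramified_even x : unramified x -> ~~ odd `|v x|.
Proof.
move=> [w [t [hw t0 ->]]]; have /weqP[n0 vn] := weq_1m4 hw.
by rewrite vM ?expf_neq0 // vX //; lia.
Qed.

Lemma unramified_mul_sqr x t : t != 0 -> unramified x -> unramified (x * t ^+ 2).
Proof.
move=> t0 [w [s [hw s0 ->]]]; exists w, (s * t); split=> //; [by rewrite mulf_neq0 | by ring].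
Qed.

Lemma unramifiedM_ramified x y : unramified x -> ramified y -> ramified (x * y).
Proof.
move=> ux [[y0 oy]|[u [t [hu t0 ->]]]].
  left; have x0 := unramified_neq0 ux; split; first by rewrite mulf_neq0.
  by have := unramified_even ux; rewrite vM //; lia.
right; have [w [s [hw s0 ->]]] := ux.
exists (u + 2 * - (w * (1 + 2 * u))), (t * s); split; [|by rewrite mulf_neq0 | by ring].
by apply: (weqDl hu); apply: (wge2M (k := 0)) => //; integrality.
Qed.

Lemma ramified_neq0 x : ramified x -> x != 0.
Proof.
case=> [[]//|[u [t [hu t0 ->]]]]; rewrite mulf_neq0 ?expf_neq0 //.
exact: weq_neq0 (weq_1p2 (weq_wge hu)).
Qed.

Lemma disc_xi_mul_sqr x t : t != 0 -> disc_xi v (x * t ^+ 2) = disc_xi v x.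
Proof.
move=> t0; rewrite /disc_xi.
have -> : `[< exists z, x * t ^+ 2 = z ^+ 2 >] = `[< exists z, x = z ^+ 2 >].
  apply/asboolP/asboolP => -[z zE]; last by exists (z * t); rewrite zE exprMn.
  by exists (z / t); rewrite expr_div_n -zE mulfK // expf_neq0.
case: asboolP => // _; congr (if _ then _ else _).
apply/asboolP/asboolP => even_norm a b ab; last first.
  by rewrite -mulrA -exprMn; apply: even_norm; rewrite mulf_eq0 negb_or t0.
have := even_norm a (b / t); rewrite expr_div_n -mulrA [t ^+ 2 * _]mulrC divfK ?expf_neq0 //.
by apply; rewrite mulf_eq0 invr_eq0 negb_or t0 andbT.
Qed.

Lemma disc_xi_eq_mod_sqr x y : eq_mod_sqr x y -> disc_xi v x = disc_xi v y.
Proof. by move=> [c c0 ->]; apply: disc_xi_mul_sqr. Qed.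

Lemma weq_norm_form w p q : wge w 0 -> (forall z, wge z 0 -> ~~ wge (z ^+ 2 + z + w) 2) ->
  wge p 0 -> wge q 0 -> weq p 0 || weq q 0 -> weq (p ^+ 2 + p * q + w * q ^+ 2) 0.
Proof.
move=> hw no_root hp hq pq; apply: (wge_weq (k := 0)); first by integrality.
have [q2|/(wge_weq (k := 0) hq) q0] := boolP (wge q 2).
  have qN0 : ~~ weq q 0 by apply/negP => /weqP[q0]; move/wgeP/(_ q0): q2; lia.
  move: pq; rewrite (negPf qN0) orbF => /(weqX 2)/weqP[p0 vp]; apply/negP => h.
  have : wge (p ^+ 2) 2.
    rewrite (_ : p ^+ 2 = p ^+ 2 + p * q + w * q ^+ 2 - q * (p + w * q)); last by ring.
    by apply: wgeB h _; apply: (wgeM_le q2 (l := 0)) => //; integrality.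
  by move/wgeP/(_ p0); lia.
have qn0 := weq_neq0 q0; have hqV := weq_wge (weqV0 q0).
apply: contra (no_root (p / q) (wgeM0 hp hqV)) => h.
have -> : (p / q) ^+ 2 + p / q + w = (p ^+ 2 + p * q + w * q ^+ 2) / q ^+ 2 by field.
by rewrite (wge_divl _ _ (weqX 2 q0)).
Qed.

Lemma norm_form_even w p q : wge w 0 -> (forall z, wge z 0 -> ~~ wge (z ^+ 2 + z + w) 2) ->
  (p != 0) || (q != 0) -> ~~ odd `|v (p ^+ 2 + p * q + w * q ^+ 2)|.
Proof.
move=> hw no_root pq.
suff [t [t0 hp hq unit_pq]] : exists t, [/\ t != 0, wge (p / t) 0, wge (q / t) 0 &
    weq (p / t) 0 || weq (q / t) 0].
  have /weqP[n0 vn] := weq_norm_form hw no_root hp hq unit_pq.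
  have -> : p ^+ 2 + p * q + w * q ^+ 2 =
     ((p / t) ^+ 2 + p / t * (q / t) + w * (q / t) ^+ 2) * t ^+ 2 by field.
  by rewrite vM ?expf_neq0 // vX //; move: vn; lia_goal.
have divxx x : x != 0 -> weq (x / x) 0 by move=> x0; rewrite divff ?weq1.
have div_int x y : y != 0 -> (x != 0 -> v y <= v x) -> wge (x / y) 0.
  move=> y0 vyx; apply/wgeP; rewrite mulf_eq0 invr_eq0 negb_or => /andP[x0 _].
  by rewrite vM ?invr_eq0 // vV //; have := vyx x0; lia.
have [p0|p0] := eqVneq p 0.
  move: pq; rewrite p0 eqxx /= => q0; exists q; split=> //; rewrite ?divxx ?orbT //.
    by apply: div_int => //; rewrite eqxx.
  exact: div_int.
have [vpq|vqp] := lerP (v p) (v q); first by exists p; split; rewrite ?divxx //; apply: div_int.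
have [q0|q0] := eqVneq q 0; last first.
  by exists q; split; rewrite ?divxx ?orbT //; apply: div_int => // _; apply: ltW.
by exists p; split; rewrite ?divxx //; apply: div_int => //; rewrite q0 eqxx.
Qed.

Lemma disc_xi_unramified x : unramified x -> disc_xi v x != 0.
Proof.
move=> [w [t [hw t0 ->]]]; rewrite disc_xi_mul_sqr // /disc_xi.
case: asboolP => // not_sqr; case: asboolP => // odd_norm; case: odd_norm => a b ab.
have no_root z : wge z 0 -> ~~ wge (z ^+ 2 + z + w) 2.
  move=> hz; rewrite -[w]opprK; apply/negP => /(near_sqr_of_artin_schreier hz)[s _ sE].
  by case: not_sqr; exists s; rewrite -sE mulrN.
have -> : a ^+ 2 - (1 - 4 * w) * b ^+ 2 = (a - b) ^+ 2 + (a - b) * (2 * b) + w * (2 * b) ^+ 2 by ring.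
apply: norm_form_even => //; rewrite mulf_eq0 negb_or two_neq0 subr_eq0 /=.
by case: (eqVneq a b) ab => // ->; rewrite orbb.
Qed.

Lemma one_plus_2unit_not_sqr u y : weq u 0 -> 1 + 2 * u != y ^+ 2.
Proof.
move=> hu; apply/eqP => uE.
have hy : wge y 0 by apply/weq_wge/weq_sqr; rewrite -uE; apply: weq_1p2 (weq_wge hu).
have h2u := weqM weq2 hu; have u2E : 2 * u = (y - 1) * (y + 1).
  by have -> : (y - 1) * (y + 1) = y ^+ 2 - 1 by [ring]; rewrite -uE; ring.
have y1 : wge (y - 1) 2.
  have /orP[//|y1] : wge (y - 1) 2 || wge (y + 1) 2.
    by apply: residue_mul_eq0; [integrality | integrality | rewrite -u2E; apply: weq_wge h2u].
  by rewrite (_ : y - 1 = y + 1 - 2); [apply: wgeB y1 (weq_wge weq2) | ring].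
have y1' : wge (y + 1) 2 by rewrite (_ : y + 1 = y - 1 + 2); [apply: wgeD y1 (weq_wge weq2) | ring].
have := wgeM y1 y1'; rewrite -u2E => /wgeP/(_ (weq_neq0 h2u)).
by case/weqP: h2u => _; lia.
Qed.

Lemma disc_xi_ramified x : ramified x -> disc_xi v x = 0.
Proof.
case=> [[x0 ox]|[u [t [hu t0 ->]]]]; last rewrite disc_xi_mul_sqr //.
  rewrite /disc_xi; case: asboolP => [[y yE]|_].
    by move: ox x0; rewrite yE expf_eq0 /= => + y0; rewrite vX //; lia.
  case: asboolP => // even_norm; have := even_norm 0 1; rewrite oner_eq0 orbT => /(_ isT).
  by rewrite expr0n expr1n mulr1 sub0r vN ox.
rewrite /disc_xi; case: asboolP => [[y /eqP]|_]; first by rewrite (negPf (one_plus_2unit_not_sqr _ hu)).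
case: asboolP => // even_norm; have := even_norm 1 1; rewrite oner_eq0 => /(_ isT).
have -> : 1 ^+ 2 - (1 + 2 * u) * 1 ^+ 2 = - (2 * u) by ring.
by rewrite vN; case/weqP: (weqM weq2 hu) => _; lia.
Qed.

(** * Reduced systems *)

Section Pairings.

Implicit Types (ps : seq (nat * nat)) (ss : seq nat).

Definition pair_indices ps : seq nat := flatten [seq [:: p.1; p.2] | p <- ps].
Definition indices ps ss : seq nat := ss ++ pair_indices ps.
Definition linked ps i j : bool := ((i, j) \in ps) || ((j, i) \in ps).

Lemma pair_indices_cons i j ps : pair_indices ((i, j) :: ps) = [:: i, j & pair_indices ps].
Proof. by []. Qed.

Lemma size_pair_indices ps : size (pair_indices ps) = (size ps).*2.
Proof. by elim: ps => //= p ps ->. Qed.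

Lemma linkedC ps i j : linked ps i j = linked ps j i.
Proof. exact: orbC. Qed.

Lemma linked_cons p ps i j : linked (p :: ps) i j = [|| (i, j) == p, (j, i) == p | linked ps i j].
Proof. by rewrite /linked !inE; case: eqP; case: eqP; case: (_ \in ps). Qed.

Lemma mem_pair_indices ps i : reflect (exists j, linked ps i j) (i \in pair_indices ps).
Proof.
apply: (iffP flattenP) => [[_ /mapP[[p q] pq ->]]|[j /orP[] ij]].
- by rewrite !inE => /orP[] /eqP->; [exists q | exists p]; rewrite /linked pq ?orbT.
- by exists [:: i; j]; rewrite ?inE ?eqxx //; apply/mapP; exists (i, j).
- by exists [:: j; i]; rewrite ?inE ?eqxx ?orbT //; apply/mapP; exists (j, i).
Qed.

Lemma linked_mem ps i j : linked ps i j -> i \in pair_indices ps.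
Proof. by move=> ij; apply/mem_pair_indices; exists j. Qed.

Lemma mem_indices_single ps ss i : i \in ss -> i \in indices ps ss.
Proof. by rewrite mem_cat => ->. Qed.

Lemma mem_indices_pair ps ss i : i \in pair_indices ps -> i \in indices ps ss.
Proof. by rewrite mem_cat orbC => ->. Qed.

Lemma linked_indices ps ss i j : linked ps i j -> i \in indices ps ss.
Proof. by move/linked_mem; apply: mem_indices_pair. Qed.

Lemma uniq_pair_indices ps ss : uniq (indices ps ss) -> uniq (pair_indices ps).
Proof. by rewrite cat_uniq => /and3P[]. Qed.

Lemma single_not_paired ps ss i : uniq (indices ps ss) -> i \in ss -> i \notin pair_indices ps.
Proof. by rewrite cat_uniq => /and3P[_ /hasPn h _]; apply: contraL => /h. Qed.

Lemma single_not_linked ps ss i j : uniq (indices ps ss) -> i \in ss -> ~~ linked ps i j.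
Proof. by move=> u iss; apply: contra (single_not_paired u iss) => /linked_mem. Qed.

Lemma linked_neq ps i j : uniq (pair_indices ps) -> linked ps i j -> i != j.
Proof.
elim: ps => //= -[p q] ps IHps; rewrite inE negb_or -andbA => /and4P[pq _ _ u].
rewrite linked_cons !xpair_eqE => /or3P[/andP[/eqP-> /eqP->]|/andP[/eqP-> /eqP->]|/IHps] //.
  by rewrite eq_sym.
exact.
Qed.

Lemma linked_inj ps i i' j : uniq (pair_indices ps) -> linked ps i j -> linked ps i' j -> i = i'.
Proof.
elim: ps => //= -[p q] ps IHps; rewrite inE negb_or -andbA => /and4P[pq np nq u].
have out l l' : linked ps l l' -> (l' == p = false) * (l' == q = false).
  rewrite linkedC => /linked_mem ll'.
  by split; apply/negbTE; [apply: contraNneq np | apply: contraNneq nq] => <-.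
rewrite !linked_cons !xpair_eqE => hi hi'.
case/or3P: hi => [/andP[/eqP iE /eqP jE]|/andP[/eqP jE /eqP iE]|ij];
  case/or3P: hi' => [/andP[/eqP iE' /eqP jE']|/andP[/eqP jE' /eqP iE']|ij'];
  try (by rewrite iE iE'); try (by move: pq; rewrite -?jE -?jE' ?jE ?jE' eqxx).
- by have := out _ _ ij'; rewrite jE eqxx => -[].
- by have := out _ _ ij'; rewrite jE eqxx => -[].
- by have := out _ _ ij; rewrite jE' eqxx => -[].
- by have := out _ _ ij; rewrite jE' eqxx => -[].
exact: IHps ij ij'.
Qed.

Lemma indices_cons_perm ps ss i j : perm_eq (indices ((i, j) :: ps) ss) (i :: j :: indices ps ss).
Proof. by apply/permPl; apply: (perm_catCA ss [:: i; j] (pair_indices ps)). Qed.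

Lemma indices_cons_perm1 ps ss ss' i j : perm_eq ss (i :: ss') ->
  perm_eq (indices ((i, j) :: ps) ss') (j :: indices ps ss).
Proof.
move=> ssE; apply: perm_trans (indices_cons_perm _ _ _ _) _.
rewrite -[i :: j :: _]/([:: i] ++ [:: j] ++ _) perm_catCA /= perm_cons /indices -cat_cons perm_cat2r.
by rewrite perm_sym.
Qed.

Lemma mem_indices_cons ps ss i j l :
  (l \in indices ((i, j) :: ps) ss) = [|| l == i, l == j | l \in indices ps ss].
Proof. by rewrite (perm_mem (indices_cons_perm ps ss i j)) !inE. Qed.

Lemma uniq_indices_cons ps ss i j : uniq (indices ((i, j) :: ps) ss) =
  [&& i != j, i \notin indices ps ss, j \notin indices ps ss & uniq (indices ps ss)].
Proof.
by rewrite (perm_uniq (indices_cons_perm ps ss i j)) /= inE negb_or -!andbA; do !bool_congr.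
Qed.

End Pairings.

Section LinearCombinations.

Variable V : lmodType F.
Implicit Types (f : nat -> V) (I J : seq nat) (B : nat -> F -> bool).

Inductive lincomb f I B : V -> Prop :=
| lincomb0 : lincomb f I B 0
| lincombS x m c : lincomb f I B x -> m \in I -> B m c -> lincomb f I B (x + c *: f m).

Lemma lincombD f I B x y : lincomb f I B x -> lincomb f I B y -> lincomb f I B (x + y).
Proof.
move=> hx; elim: y / => [|y m c _ IHy mI hc]; first by rewrite addr0.
by rewrite addrA; apply: lincombS.
Qed.

Lemma lincombZ f I B B' s x : (forall m c, B m c -> B' m (s * c)) ->
  lincomb f I B x -> lincomb f I B' (s *: x).
Proof.
move=> BB'; elim: x / => [|x m c _ IHx mI hc]; first by rewrite scaler0; apply: lincomb0.
by rewrite scalerDr scalerA; apply: lincombS => //; apply: BB'.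
Qed.

Lemma lincomb_sub f I J B B' x : {subset I <= J} -> (forall m c, m \in I -> B m c -> B' m c) ->
  lincomb f I B x -> lincomb f J B' x.
Proof.
move=> IJ BB'; elim: x / => [|x m c _ IHx mI hc]; first exact: lincomb0.
by apply: lincombS => //; [apply: IJ | apply: BB'].
Qed.

Lemma lincomb1 f I B m c : m \in I -> B m c -> lincomb f I B (c *: f m).
Proof. by move=> mI hc; rewrite -[_ *: _]add0r; apply: lincombS => //; apply: lincomb0. Qed.

Lemma lincomb_sum f I B (r : seq nat) (c : nat -> F) : {subset r <= I} ->
  (forall m, m \in r -> B m (c m)) -> lincomb f I B (\sum_(m <- r) c m *: f m).
Proof.
move=> rI hc; rewrite big_seq; apply: (big_ind (lincomb f I B)) => [|x y|m mr].
- exact: lincomb0.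
- exact: lincombD.
by apply: lincomb1; [apply: rI | apply: hc].
Qed.

Definition spanned f I : V -> Prop := lincomb f I (fun _ _ => true).

Lemma lincomb_spanned f I J B x : {subset I <= J} -> lincomb f I B x -> spanned f J x.
Proof. by move=> IJ; apply: lincomb_sub. Qed.

Lemma spanned_mem f I m : m \in I -> spanned f I (f m).
Proof. by move=> mI; rewrite -[f m]scale1r; apply: lincomb1. Qed.

Lemma spanned_trans f g I J x : (forall m, m \in J -> spanned f I (g m)) ->
  spanned g J x -> spanned f I x.
Proof.
move=> gf; elim: x / => [|x m c _ IHx mJ _]; first exact: lincomb0.
by apply: lincombD => //; apply: lincombZ (gf _ mJ).
Qed.

Lemma spanned_coef f I x : uniq I -> spanned f I x ->
  exists c : nat -> F, x = \sum_(m <- I) c m *: f m.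
Proof.
move=> uI; elim: x / => [|x m c _ [d ->] mI _].
  by exists (fun=> 0); rewrite big1 // => i _; rewrite scale0r.
exists (fun i => d i + (if i == m then c else 0)).
under [RHS]eq_bigr do rewrite scalerDl.
rewrite big_split /=; congr (_ + _); rewrite (bigD1_seq m) //= eqxx big1 ?addr0 // => i /negPf ->.
by rewrite scale0r.
Qed.

Lemma lincomb_orth (bt : {symmetric V}) f I B x y :
  (forall m, m \in I -> bt (f m) y = 0) -> lincomb f I B x -> bt x y = 0.
Proof.
move=> fy; elim: x / => [|x m c _ IHx mI _]; first exact: linear0l.
by rewrite symDl symZl IHx fy // mulr0 addr0.
Qed.

End LinearCombinations.

Section ReducedSystems.

Variables (V : lmodType F) (bt : {symmetric V}).
Local Notation "''[' x , y ]" := (bt x y) : ring_scope.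
Local Notation "''[' x ]" := (bt x x) : ring_scope.
Implicit Types (f g : nat -> V) (a : nat -> nat) (ps : seq (nat * nat)) (ss I J : seq nat).

(* Step [t] of the filtration in which [f m] has weight [a m]. *)
Definition level f a I (t : int) : V -> Prop := lincomb f I (fun m c => wge c (t - (a m)%:Z)).

Lemma levelW f a I J t t' x : {subset I <= J} -> t' <= t -> level f a I t x -> level f a J t' x.
Proof. by move=> IJ tt'; apply: lincomb_sub => // m c _ hc; apply: wgeW hc _; lia. Qed.

Lemma levelD f a I t x y : level f a I t x -> level f a I t y -> level f a I t (x + y).
Proof. exact: lincombD. Qed.

Lemma levelZ f a I t t' s r x : wge s r -> t' <= t + r -> level f a I t x -> level f a I t' (s *: x).
Proof. by move=> hs tt'; apply: lincombZ => m c hc; apply: (wgeM_le hs hc); lia. Qed.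

Lemma level_basis f a I m : m \in I -> level f a I (a m)%:Z (f m).
Proof. by move=> mI; rewrite -[f m]scale1r; apply: lincomb1 => //; apply: wge1; lia. Qed.

Lemma level_trans f f' a I I' t x : (forall m, m \in I' -> level f a I (a m)%:Z (f' m)) ->
  level f' a I' t x -> level f a I t x.
Proof.
move=> ff'; elim: x / => [|x m c _ IHx mI hc]; first exact: lincomb0.
by apply: levelD => //; apply: (levelZ hc _ (ff' _ mI)); lia.
Qed.

Definition bounded f a I : Prop :=
  {in I, forall i, wge '[f i] (2 * (a i)%:Z)} /\
  {in I &, forall i j, i != j -> wge (2 * '[f i, f j]) ((a i)%:Z + (a j)%:Z)}.

Lemma bounded_form f a I i j : bounded f a I -> i \in I -> j \in I ->
  wge (2 * '[f i, f j]) ((a i)%:Z + (a j)%:Z).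
Proof.
move=> [diag off] iI jI; have [->|ij] := eqVneq i j; last exact: off.
by apply: (wge2M (diag _ jI)); lia.
Qed.

Lemma level_form f a I s t x y : bounded f a I -> level f a I s x -> level f a I t y ->
  wge (2 * '[x, y]) (s + t).
Proof.
move=> bf + hy; elim: x / => [|x i c _ IHx iI hc]; first by rewrite linear0l mulr0 wge0.
rewrite symDl mulrDr; apply: wgeD => //; rewrite symZl mulrCA.
suff hiy : wge (2 * '[f i, y]) ((a i)%:Z + t) by apply: (wgeM_le hc hiy); lia.
elim: y / hy {IHx} => [|y j d _ IHy jI hd]; first by rewrite linear0r mulr0 wge0.
rewrite linearDr /= mulrDr; apply: wgeD => //; rewrite symZr mulrCA.
by apply: (wgeM_le hd (bounded_form bf iI jI)); lia.
Qed.

Lemma level_norm f a I s x : bounded f a I -> level f a I s x -> wge '[x] (2 * s).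
Proof.
move=> bf; elim: x / => [|x i c hx IHx iI hc]; first by rewrite linear0l wge0.
rewrite symDD !(symZl, symZr) mulrCA; apply: wgeD; first apply: wgeD => //.
  by apply: (wgeM_le hc (level_form bf hx (level_basis f a iI))); lia.
by rewrite mulrA; apply: (wgeM_le (wgeM hc hc) (bf.1 _ iI)); lia.
Qed.

Definition graded_eq f f' a I : Prop :=
  {in I, forall i, wge ('[f' i] - '[f i]) (2 * (a i)%:Z + 2)} /\
  {in I &, forall i j, i != j ->
     wge (2 * '[f' i, f' j] - 2 * '[f i, f j]) ((a i)%:Z + (a j)%:Z + 1)}.

Lemma graded_eq_refl f a I : graded_eq f f a I.
Proof. by split=> [i _|i j _ _ _]; rewrite subrr wge0. Qed.

Lemma graded_eq_sym f f' a I : graded_eq f f' a I -> graded_eq f' f a I.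
Proof.
move=> [diag off]; split=> [i iI|i j iI jI ij]; rewrite wge_subC; [exact: diag | exact: off].
Qed.

Lemma graded_eq_trans f' f f'' a I :
  graded_eq f f' a I -> graded_eq f' f'' a I -> graded_eq f f'' a I.
Proof.
move=> [diag off] [diag' off']; split=> [i iI|i j iI jI ij].
  by rewrite -(subrK '[f' i] '[f'' i]) -addrA; apply: wgeD; [apply: diag' | apply: diag].
rewrite -(subrK (2 * '[f' i, f' j]) (2 * '[f'' i, f'' j])) -addrA.
by apply: wgeD; [apply: off' | apply: off].
Qed.

Lemma graded_eq_sub f f' a I J : {subset J <= I} -> graded_eq f f' a I -> graded_eq f f' a J.
Proof.
by move=> JI [diag off]; split=> [i /JI|i j /JI iI /JI jI]; [apply: diag | apply: off].
Qed.

Lemma level_graded_eq g f f' a I J : bounded g a I ->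
  {in J, forall i, level g a I (a i)%:Z (f i)} ->
  {in J, forall i, level g a I ((a i)%:Z + 1) (f' i - f i)} -> graded_eq f f' a J.
Proof.
move=> bg hf hd; split=> [i iJ|i j iJ jJ _].
  have -> : '[f' i] - '[f i] = 2 * '[f i, f' i - f i] + '[f' i - f i].
    by rewrite !linearBr /= !linearBl /= [bt (f' i) (f i)]symC; ring.
  apply: wgeD; last by apply: wgeW (level_norm bg (hd _ iJ)) _; lia.
  by apply: (wge_sharpen (level_form bg (hf _ iJ) (hd _ iJ))); lia.
have -> : 2 * '[f' i, f' j] - 2 * '[f i, f j] =
   2 * '[f i, f' j - f j] + 2 * '[f' i - f i, f j] + 2 * '[f' i - f i, f' j - f j].
  by rewrite !linearBr /= !linearBl /=; ring.
apply: wgeD; first apply: wgeD.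
- by apply: wgeW (level_form bg (hf _ iJ) (hd _ jJ)) _; lia.
- by apply: wgeW (level_form bg (hd _ iJ) (hf _ jJ)) _; lia.
by apply: wgeW (level_form bg (hd _ iJ) (hd _ jJ)) _; lia.
Qed.

Lemma level_graded_eq_id f f' a I : bounded f a I ->
  {in I, forall i, level f a I ((a i)%:Z + 1) (f' i - f i)} -> graded_eq f f' a I.
Proof. by move=> bf; apply: (level_graded_eq bf) => i; apply: level_basis. Qed.

(* The indices are matched into pairs [ps] spanning planes of unramified discriminant, except for
   singles [ss] (at most two, by [reduced_parity]); everything else vanishes in the graded form. *)
Record reduced f a ps ss : Prop := {
  reduced_uniq : uniq (indices ps ss);
  reduced_diag : {in indices ps ss, forall i, wge '[f i] (2 * (a i)%:Z)};
  reduced_linked : forall i j, linked ps i j -> weq (2 * '[f i, f j]) ((a i)%:Z + (a j)%:Z);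
  reduced_off : {in indices ps ss &, forall i j, i != j -> ~~ linked ps i j ->
    wge (2 * '[f i, f j]) ((a i)%:Z + (a j)%:Z + 1)};
  reduced_single : {in ss, forall i, weq '[f i] (2 * (a i)%:Z)};
  reduced_parity : {in ss &, forall i j, i != j -> odd (a i + a j)} }.

Lemma reduced_bounded f a ps ss : reduced f a ps ss -> bounded f a (indices ps ss).
Proof.
move=> rf; split; first exact: reduced_diag rf.
move=> i j iI jI ij; have [/(reduced_linked rf)/weq_wge//|ij_off] := boolP (linked ps i j).
by apply: wgeW (reduced_off rf iI jI ij ij_off) _; lia.
Qed.

Lemma reduced_graded_eq f f' a ps ss : graded_eq f f' a (indices ps ss) ->
  reduced f a ps ss -> reduced f' a ps ss.
Proof.
move=> [diag off] rf; split; [exact: reduced_uniq rf | | | | | exact: reduced_parity rf].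
- move=> i iI; rewrite -(subrK '[f i] '[f' i]); apply: wgeD (reduced_diag rf iI).
  by apply: wgeW (diag _ iI) _; lia.
- move=> i j ij; apply: weq_near (reduced_linked rf ij) _; apply: off.
  + exact: linked_indices ij.
  + by move: ij; rewrite linkedC => /linked_indices; apply.
  exact: linked_neq (uniq_pair_indices (reduced_uniq rf)) ij.
- move=> i j iI jI ij ij_off; rewrite -(subrK (2 * '[f i, f j]) (2 * '[f' i, f' j])).
  by apply: wgeD; [apply: off | apply: (reduced_off rf)].
move=> i iss; apply: weq_near (reduced_single rf iss) _.
by apply: wgeW (diag i _) _; [apply: mem_indices_single | lia].
Qed.

Lemma eq_reduced f f' a a' ps ss : {in indices ps ss, f =1 f'} -> {in indices ps ss, a =1 a'} ->
  reduced f a ps ss -> reduced f' a' ps ss.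
Proof.
move=> ff' aa' rf; have sI i : i \in ss -> i \in indices ps ss by apply: mem_indices_single.
split; first exact: reduced_uniq rf.
- by move=> i iI; rewrite -ff' // -aa' //; apply: (reduced_diag rf).
- move=> i j ij; have iI := linked_indices ss ij; move: (ij); rewrite linkedC => ji.
  by rewrite -!ff' -?aa' ?(linked_indices ss ji) //; apply: (reduced_linked rf).
- by move=> i j iI jI; rewrite -!ff' -?aa' //; apply: (reduced_off rf).
- by move=> i iss; rewrite -ff' -?aa' ?sI //; apply: (reduced_single rf).
by move=> i j iss jss; rewrite -!aa' ?sI //; apply: (reduced_parity rf).
Qed.

Lemma reduced_perm f a ps ss ss' : perm_eq ss ss' -> reduced f a ps ss -> reduced f a ps ss'.
Proof.
move=> ssE rf; have ssm := perm_mem ssE.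
have pI : perm_eq (indices ps ss) (indices ps ss') by rewrite perm_cat2r.
have Im := perm_mem pI; split; first by rewrite -(perm_uniq pI); apply: reduced_uniq rf.
- by move=> i; rewrite -Im; apply: (reduced_diag rf).
- exact: reduced_linked rf.
- by move=> i j; rewrite -!Im; apply: (reduced_off rf).
- by move=> i; rewrite -ssm; apply: (reduced_single rf).
by move=> i j; rewrite -!ssm; apply: (reduced_parity rf).
Qed.

Lemma reduced_behead f a p ps ss : reduced f a (p :: ps) ss -> reduced f a ps ss.
Proof.
case: p => i0 j0 rf; have sub : {subset indices ps ss <= indices ((i0, j0) :: ps) ss}.
  by move=> i iI; rewrite mem_indices_cons iI !orbT.
have := reduced_uniq rf; rewrite uniq_indices_cons => /and4P[_ ni0 nj0 u].
split=> //.
- by move=> i /sub; apply: (reduced_diag rf).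
- by move=> i j ij; apply: (reduced_linked rf); rewrite linked_cons ij !orbT.
- move=> i j iI jI ij ij_off; apply: (reduced_off rf) => //; try exact: sub.
  rewrite linked_cons !xpair_eqE (negPf ij_off) orbF negb_or !negb_and.
  by rewrite (memPn ni0 _ iI) (memPn nj0 _ iI) orbT.
- exact: reduced_single rf.
exact: reduced_parity rf.
Qed.

Section PlaneProjection.

Variables p q : V.
Hypothesis D0 : '[p] * '[q] - '[p, q] ^+ 2 != 0.

Definition plane_coef p q x : F := ('[x, p] * '[q] - '[x, q] * '[p, q]) / ('[p] * '[q] - '[p, q] ^+ 2).
Definition plane_proj x : V := x - plane_coef p q x *: p - plane_coef q p x *: q.

Lemma plane_projP x : '[plane_proj x, p] = 0 /\ '[plane_proj x, q] = 0.
Proof.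
have D0' : '[q] * '[p] - '[p, q] ^+ 2 != 0 by rewrite mulrC.
rewrite /plane_proj !linearBl /= !symZl /plane_coef [bt q p]symC.
by split; field; exact: D0'.
Qed.

Lemma orth_plane_proj x z : '[p, z] = 0 -> '[q, z] = 0 -> '[plane_proj x, z] = '[x, z].
Proof. by move=> pz qz; rewrite /plane_proj !linearBl /= !symZl pz qz !mulr0 !subr0. Qed.

End PlaneProjection.

Lemma weq_plane_disc p q (A B : int) : wge '[p] (2 * A) -> wge '[q] (2 * B) ->
  weq (2 * '[p, q]) (A + B) -> weq (4 * ('[p] * '[q] - '[p, q] ^+ 2)) (2 * (A + B)).
Proof.
move=> hp hq hpq.
have -> : 4 * ('[p] * '[q] - '[p, q] ^+ 2) = - (2 * '[p, q]) ^+ 2 + 4 * ('[p] * '[q]) by ring.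
apply: weqDl; first by rewrite weqN; apply: weq_eq (weqX 2 hpq) _ _ => //; lia.
by apply: (wge4M (wgeM hp hq)); lia.
Qed.

Lemma wge_plane_coef p q x (A B C : int) : wge '[p] (2 * A) -> wge '[q] (2 * B) ->
  weq (2 * '[p, q]) (A + B) -> wge (2 * '[x, p]) (C + A) -> wge (2 * '[x, q]) (C + B) ->
  wge (plane_coef p q x) (C - A).
Proof.
move=> hp hq hpq hxp hxq; have hD := weq_plane_disc hp hq hpq.
have -> : plane_coef p q x = ((2 * '[x, p]) * (2 * '[q]) - (2 * '[x, q]) * (2 * '[p, q])) /
   (4 * ('[p] * '[q] - '[p, q] ^+ 2)).
  have D0 : '[p] * '[q] - '[p, q] ^+ 2 != 0 by apply: contraNneq (weq_neq0 hD) => ->; rewrite mulr0.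
  by rewrite /plane_coef; field; rewrite D0 (weq_neq0 weq4).
apply: (wge_div (k := C + A + 2 * B) _ hD); last by lia.
apply: wgeB; first by apply: (wgeM_le hxp (wge2M hq (lexx _))); lia.
by apply: (wgeM_le hxq (weq_wge hpq)); lia.
Qed.

Definition cleared g ps ss : Prop :=
  {in indices ps ss &, forall i j, i != j -> ~~ linked ps i j -> ~~ ((i \in ss) && (j \in ss)) ->
     '[g i, g j] = 0}.

Lemma clear_plane f a i j ps ss : reduced f a ((i, j) :: ps) ss -> exists f',
  [/\ forall l, '[f' l, f i] = 0 /\ '[f' l, f j] = 0,
      {in indices ps ss, forall l, level f a [:: i; j] ((a l)%:Z + 1) (f' l - f l)},
      reduced f' a ps ss &
      forall l z, '[f i, z] = 0 -> '[f j, z] = 0 -> '[f' l, z] = '[f l, z]].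
Proof.
move=> rf; pose f' l := plane_proj (f i) (f j) (f l).
have := reduced_uniq rf; rewrite uniq_indices_cons => /and4P[_ ni nj _].
have iI : i \in indices ((i, j) :: ps) ss by rewrite mem_indices_cons eqxx.
have jI : j \in indices ((i, j) :: ps) ss by rewrite mem_indices_cons eqxx orbT.
have sub : {subset indices ps ss <= indices ((i, j) :: ps) ss}.
  by move=> l lI; rewrite mem_indices_cons lI !orbT.
have [bi bj] := (reduced_diag rf iI, reduced_diag rf jI).
have bij : weq (2 * '[f i, f j]) ((a i)%:Z + (a j)%:Z).
  by apply: (reduced_linked rf); rewrite linked_cons eqxx.
have bji : weq (2 * '[f j, f i]) ((a j)%:Z + (a i)%:Z) by rewrite symC addrC.
have D0 : '[f i] * '[f j] - '[f i, f j] ^+ 2 != 0.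
  by apply: contraNneq (weq_neq0 (weq_plane_disc bi bj bij)) => ->; rewrite mulr0.
have off l : l \in indices ps ss ->
    wge (2 * '[f l, f i]) ((a l)%:Z + 1 + (a i)%:Z) /\ wge (2 * '[f l, f j]) ((a l)%:Z + 1 + (a j)%:Z).
  move=> lI; have [li lj] := (memPn ni _ lI, memPn nj _ lI).
  have not_linked m : m \in [:: i; j] -> ~~ linked ((i, j) :: ps) l m.
    move=> mij; rewrite linked_cons !xpair_eqE (negPf li) (negPf lj) /= andbF /=.
    apply: contraL mij; rewrite linkedC => /linked_indices mI; rewrite !inE negb_or.
    by rewrite (memPn ni _ (mI ss)) (memPn nj _ (mI ss)).
  have lI' := sub _ lI.
  by split; rewrite addrAC; apply: (reduced_off rf) => //; apply: not_linked; rewrite !inE eqxx ?orbT.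
have close l I : l \in indices ps ss -> i \in I -> j \in I -> level f a I ((a l)%:Z + 1) (f' l - f l).
  move=> lI i_in j_in; have [li lj] := off l lI.
  have -> : f' l - f l = (- plane_coef (f i) (f j) (f l)) *: f i + (- plane_coef (f j) (f i) (f l)) *: f j.
    by rewrite /f' /plane_proj !scaleNr addrC addrA addKr.
  apply: levelD; apply: lincomb1 => //; rewrite wgeN; first exact: wge_plane_coef bi bj bij li lj.
  exact: wge_plane_coef bj bi bji lj li.
exists f'; split=> [l|l lI||l z iz jz]; last exact: orth_plane_proj.
- exact: plane_projP.
- by apply: close; rewrite // !inE eqxx ?orbT.
apply: reduced_graded_eq (reduced_behead rf); apply: (level_graded_eq (reduced_bounded rf)) => l lI.
  by apply: level_basis; apply: sub.
exact: close.
Qed.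

Lemma cleared_cons g i j ps ss :
  {in indices ps ss, forall l, '[g l, g i] = 0 /\ '[g l, g j] = 0} ->
  cleared g ps ss -> cleared g ((i, j) :: ps) ss.
Proof.
move=> orth clear l m; rewrite !mem_indices_cons => lI mI lm; rewrite linked_cons !xpair_eqE.
rewrite negb_or => /andP[lm_ij]; rewrite negb_or => /andP[ml_ij lm_off] not_single.
case/or3P: lI => [/eqP lE|/eqP lE|lI]; case/or3P: mI => [/eqP mE|/eqP mE|mI]; subst;
  rewrite ?eqxx // in lm lm_ij ml_ij *.
- by rewrite symC (orth m mI).1.
- by rewrite symC (orth m mI).2.
- by rewrite (orth l lI).1.
- by rewrite (orth l lI).2.
exact: clear.
Qed.

Lemma clear_pairs f a ps ss : reduced f a ps ss -> exists g,
  [/\ {in indices ps ss, forall i, level f a (pair_indices ps) ((a i)%:Z + 1) (g i - f i)},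
      cleared g ps ss &
      forall l i, l \in pair_indices ps -> i \in ss -> '[f l, g i] = 0].
Proof.
elim: ps f => [|[i j] ps IHps] f rf.
  exists f; split=> // [l _|l m lI mI _ _]; first by rewrite subrr; apply: lincomb0.
  by move: lI mI; rewrite /indices cats0 => -> ->.
have [f' [f'_orth f'_close rf' f'_form]] := clear_plane rf.
have [g' [g'_close g'_clear g'_pair]] := IHps _ rf'.
have := reduced_uniq rf; rewrite uniq_indices_cons => /and4P[_ ni nj _].
have g'_orth l : l \in indices ps ss -> '[g' l, f i] = 0 /\ '[g' l, f j] = 0.
  move=> lI; have z m : '[g' l, f m] = '[f' l, f m] + '[g' l - f' l, f m] by rewrite -symDl addrC subrK.
  rewrite !z !(f'_orth l).1 !(f'_orth l).2 !add0r.
  by split; apply: lincomb_orth (g'_close _ lI) => m _; case: (f'_orth m).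
pose g l := if l \in indices ps ss then g' l else f l.
have gE l : l \in indices ps ss -> g l = g' l by rewrite /g => ->.
have [gi gj] : g i = f i /\ g j = f j by rewrite /g (negPf ni) (negPf nj).
exists g; split.
- move=> l; rewrite mem_indices_cons orbA => /orP[lij|lI].
    have -> : g l = f l by case/orP: lij => /eqP ->.
    by rewrite subrr; apply: lincomb0.
  rewrite gE // -(subrK (f' l) (g' l)) -addrA; apply: levelD; last first.
    by apply: levelW (f'_close _ lI) => // m; rewrite !inE => /orP[] ->; rewrite ?orbT.
  apply: level_trans (g'_close _ lI) => m mps; rewrite -(subrK (f m) (f' m)); apply: levelD.
    apply: levelW (f'_close _ (mem_indices_pair _ mps)); last by lia.
    by move=> m'; rewrite !inE => /orP[] ->; rewrite ?orbT.
  by apply: level_basis; rewrite !inE mps !orbT.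
- apply: cleared_cons => [l lI|l m lI mI]; first by rewrite gi gj gE //; apply: g'_orth.
  by rewrite !gE //; apply: g'_clear.
move=> l m; rewrite !inE => lps mss; have mI := mem_indices_single ps mss.
rewrite (gE _ mI); case/or3P: lps => [/eqP->|/eqP->|lps].
- by rewrite symC (g'_orth m mI).1.
- by rewrite symC (g'_orth m mI).2.
by rewrite -(f'_form l) ?g'_pair // symC; case: (g'_orth m mI).
Qed.

End ReducedSystems.

Definition represents (al be ga c : F) : Prop :=
  exists x y, al * x ^+ 2 + 2 * be * x * y + ga * y ^+ 2 = c.

Lemma represents_norm al be ga D s c : al != 0 -> s != 0 -> be ^+ 2 - al * ga = D * s ^+ 2 ->
  is_norm D (c / al) -> represents al be ga c.
Proof.
move=> al0 s0 disc [X [Y cE]]; exists (X - be * Y / s), (al * Y / s).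
apply: (mulfI al0); rewrite -[c](divfK al0) cE.
have -> : al * (al * (X - be * Y / s) ^+ 2 + 2 * be * (X - be * Y / s) * (al * Y / s) +
    ga * (al * Y / s) ^+ 2) = (al * X) ^+ 2 - (be ^+ 2 - al * ga) * (al * Y / s) ^+ 2 by field.
by rewrite disc; field.
Qed.

Lemma represents_hyperbolic al be ga r c : r != 0 -> be ^+ 2 - al * ga = r ^+ 2 ->
  represents al be ga c.
Proof.
move=> r0 disc; have [al0|al0] := eqVneq al 0; last first.
  apply: (represents_norm al0 r0 (D := 1 ^+ 2)); first by rewrite disc; ring.
  by apply: is_norm_base_sqr; apply: oner_neq0.
have be0 : be != 0.
  apply: contraNneq r0 => be0; move: disc; rewrite al0 be0 mul0r subr0 expr0n => /esym/eqP.
  by rewrite expf_eq0.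
by exists ((c - ga) / (2 * be)), 1; rewrite al0; field; rewrite be0 two_neq0.
Qed.

Section CongruentPlanes.

Variables (al be ga al1 be1 ga1 : F) (A B : int).
Hypotheses (hal : wge al (2 * A)) (hga : wge ga (2 * B)) (hbe : weq (2 * be) (A + B)).
Hypotheses (dal : wge (al1 - al) (2 * A + 2)) (dga : wge (ga1 - ga) (2 * B + 2)).
Hypothesis dbe : wge (2 * be1 - 2 * be) (A + B + 1).

Let w := al * ga / (2 * be) ^+ 2.
Let w1 := al1 * ga1 / (2 * be1) ^+ 2.

Let hal1 : wge al1 (2 * A).
Proof. by rewrite -(subrK al al1); apply: wgeD hal; apply: wgeW dal _; lia_goal. Qed.

Let hga1 : wge ga1 (2 * B).
Proof. by rewrite -(subrK ga ga1); apply: wgeD hga; apply: wgeW dga _; lia_goal. Qed.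

Let hbe1 : weq (2 * be1) (A + B). Proof. exact: weq_near hbe dbe. Qed.

Let be0 : be != 0. Proof. by apply: contraNneq (weq_neq0 hbe) => ->; rewrite mulr0. Qed.
Let be10 : be1 != 0. Proof. by apply: contraNneq (weq_neq0 hbe1) => ->; rewrite mulr0. Qed.

Let w_int : wge w 0. Proof. by apply: wge_div (wgeM hal hga) (weqX 2 hbe) _; lia_goal. Qed.
Let w1_int : wge w1 0. Proof. by apply: wge_div (wgeM hal1 hga1) (weqX 2 hbe1) _; lia_goal. Qed.

Let disc : be ^+ 2 - al * ga = (1 - 4 * w) * be ^+ 2.
Proof. by rewrite /w; field; rewrite be0 two_neq0. Qed.

Let disc1 : be1 ^+ 2 - al1 * ga1 = (1 - 4 * w1) * be1 ^+ 2.
Proof. by rewrite /w1; field; rewrite be10 two_neq0. Qed.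

Let w_near : wge (w1 - w) 2.
Proof.
have [z zE] := weq_even hbe.
have dbe2 : wge (2 * be1 - 2 * be) (A + B + 2) by apply: (wge_sharpen dbe); clear -zE; lia.
have -> : w1 - w = ((al1 - al) * ga1 + al * (ga1 - ga) -
    w * ((2 * be1 - 2 * be) * (2 * be1 + 2 * be))) / (2 * be1) ^+ 2.
  by rewrite /w /w1; field; rewrite be0 be10 two_neq0.
apply: (wge_div (k := 2 * (A + B) + 2) _ (weqX 2 hbe1)); last by lia_goal.
apply: wgeB; first apply: wgeD.
- by apply: (wgeM_le dal hga1); lia_goal.
- by apply: (wgeM_le hal dga); lia_goal.
apply: (wgeM_le w_int (wgeM dbe2 (wgeD (weq_wge hbe1) (weq_wge hbe)))); lia_goal.
Qed.

Lemma congruent_planes_disc : exists D s s1,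
  [/\ unramified D, s != 0, s1 != 0, be ^+ 2 - al * ga = D * s ^+ 2 &
      be1 ^+ 2 - al1 * ga1 = D * s1 ^+ 2].
Proof.
have [|t t0 tE] := @sqrt_near (1 - 4 * w1) _ (weq_1m4 w_int).
  rewrite (_ : _ - _ = - (4 * (w1 - w))); last by ring.
  by rewrite wgeN; apply: wge4M w_near _.
exists (1 - 4 * w), be, (t * be1); split=> //; first 2 last.
- by rewrite disc1 tE; ring.
- by exists w, 1; rewrite oner_eq0; split=> //; ring.
by rewrite mulf_neq0.
Qed.

(* Both planes are hyperbolic, or [al] and [al1] differ by a unit, which is a norm. *)
Lemma congruent_planes_value : exists c, [/\ c != 0, represents al be ga c & represents al1 be1 ga1 c].
Proof.
have [D [s [s1 [_ s0 s10 e e1]]]] := congruent_planes_disc.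
have D0 := weq_neq0 (weq_1m4 w_int).
case: (pselect (exists r, D = r ^+ 2)) => [[r rE]|not_sqr].
  have r0 : r != 0.
    apply: contraNneq D0 => r0; have := disc; rewrite e rE r0 expr0n mul0r => /esym/eqP.
    by rewrite mulf_eq0 expf_eq0 (negPf be0) orbF.
  exists 1; rewrite oner_neq0; split=> //.
    by apply: (represents_hyperbolic (r := r * s)); rewrite ?mulf_neq0 // e rE exprMn.
  by apply: (represents_hyperbolic (r := r * s1)); rewrite ?mulf_neq0 // e1 rE exprMn.
have w_unit : weq w 0.
  apply: (wge_weq (k := 0)) => //; apply/negP => w2; case: not_sqr.
  have [|t _ tE] := @near_sqr_of_artin_schreier (- w) 0 (wge0 0).
    by rewrite expr0n addr0 add0r opprK.
  exists (t * be / s); rewrite expr_div_n exprMn -tE.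
  by apply: (mulIf (expf_neq0 2 s0)); rewrite divfK ?expf_neq0 // -e disc; ring.
have [hal' _] : weq al (2 * A) /\ weq ga (2 * B).
  apply: weq_mulP => //; rewrite (_ : al * ga = w * (2 * be) ^+ 2).
    by apply: weq_eq (weqM w_unit (weqX 2 hbe)) _ _ => //; lia_goal.
  by rewrite /w divfK // expf_neq0 // (weq_neq0 hbe).
have hal1' : weq al1 (2 * A) by apply: weq_near hal' (wgeW dal _); lia_goal.
exists al; split; first exact: weq_neq0 hal'.
  by exists 1, 0; ring.
apply: (represents_norm (weq_neq0 hal1') be10 disc1); apply: unit_is_norm_unram w1_int _.
by apply: weq_eq (weqM hal' (weqV hal1')) _ _ => //; lia_goal.
Qed.

End CongruentPlanes.

Section Orthogonalization.

Variables (V : lmodType F) (bt : {symmetric V}).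
Local Notation "''[' x , y ]" := (bt x y) : ring_scope.
Local Notation "''[' x ]" := (bt x x) : ring_scope.
Implicit Types (f g h : nat -> V) (a : nat -> nat) (ps : seq (nat * nat)) (ss I : seq nat).

Lemma spanned2 g i j x y : spanned g [:: i; j] (x *: g i + y *: g j).
Proof. by apply: lincombD; apply: lincomb1; rewrite // !inE eqxx ?orbT. Qed.

Definition plane_diagonal g h i j : Prop :=
  [/\ spanned g [:: i; j] (h i), spanned g [:: i; j] (h j), '[h i, h j] = 0 &
      [/\ '[h i] != 0, '[h j] != 0 & unramified (- ('[h i] * '[h j]))]].

Lemma plane_diagonalize g i j c D s : s != 0 ->
  '[g i, g j] ^+ 2 - '[g i] * '[g j] = D * s ^+ 2 -> represents '[g i] '[g i, g j] '[g j] c ->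
  exists hi hj, [/\ spanned g [:: i; j] hi /\ spanned g [:: i; j] hj,
    '[hi] = c, '[hj] = - (c * D) & '[hi, hj] = 0].
Proof.
move=> s0 disc [x [y cE]]; have DE : D = ('[g i, g j] ^+ 2 - '[g i] * '[g j]) / s ^+ 2.
  by rewrite disc mulfK // expf_neq0.
exists (x *: g i + y *: g j), ((- (x * '[g i, g j] + y * '[g j]) / s) *: g i +
  ((x * '[g i] + y * '[g i, g j]) / s) *: g j).
split; first by split; apply: spanned2.
- by rewrite symDD !(symZl, symZr) -cE; ring.
- by rewrite symDD !(symZl, symZr) -cE DE; field.
by rewrite symDl !linearDr /= !(symZl, symZr) [bt (g j) (g i)]symC; field.
Qed.

Lemma diagonalize_congruent_plane g g1 a i j : i != j ->
  wge '[g i] (2 * (a i)%:Z) -> wge '[g j] (2 * (a j)%:Z) ->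
  weq (2 * '[g i, g j]) ((a i)%:Z + (a j)%:Z) -> graded_eq bt g g1 a [:: i; j] ->
  exists h h1,
    [/\ plane_diagonal g h i j, plane_diagonal g1 h1 i j, '[h1 i] = '[h i] & '[h1 j] = '[h j]].
Proof.
move=> ij bi bj bij [diag off].
have [iI jI] : i \in [:: i; j] /\ j \in [:: i; j] by rewrite !inE !eqxx orbT.
have [D [s [s1 [uD s0 s10 e e1]]]] :=
  congruent_planes_disc bi bj bij (diag _ iI) (diag _ jI) (off _ _ iI jI ij).
have [c [c0 rep rep1]] :=
  congruent_planes_value bi bj bij (diag _ iI) (diag _ jI) (off _ _ iI jI ij).
have D0 := unramified_neq0 uD.
have [hi [hj [[si sj] ni nj oij]]] := plane_diagonalize s0 e rep.
have [hi1 [hj1 [[si1 sj1] ni1 nj1 oij1]]] := plane_diagonalize s10 e1 rep1.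
have cD : [/\ c != 0, - (c * D) != 0 & unramified (- (c * - (c * D)))].
  rewrite oppr_eq0 mulf_neq0 // (_ : - (c * - (c * D)) = D * c ^+ 2); last by ring.
  by split=> //; apply: unramified_mul_sqr.
exists (fun l => if l == i then hi else hj), (fun l => if l == i then hi1 else hj1).
by rewrite /plane_diagonal eqxx eq_sym (negPf ij) ni nj ni1 nj1.
Qed.

Lemma diagonalize_congruent_planes g g1 a ps : uniq (pair_indices ps) ->
  {in pair_indices ps, forall i, wge '[g i] (2 * (a i)%:Z)} ->
  (forall i j, linked ps i j -> weq (2 * '[g i, g j]) ((a i)%:Z + (a j)%:Z)) ->
  graded_eq bt g g1 a (pair_indices ps) ->
  exists h h1, (forall l, l \notin pair_indices ps -> h l = g l /\ h1 l = g1 l) /\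
   forall i j, (i, j) \in ps ->
    [/\ plane_diagonal g h i j, plane_diagonal g1 h1 i j, '[h1 i] = '[h i] & '[h1 j] = '[h j]].
Proof.
elim: ps => [|[i j] ps IHps]; first by exists g, g1.
rewrite pair_indices_cons !cons_uniq inE negb_or -!andbA => /and4P[ij ni nj u] diag weq_linked gr.
have sub : {subset pair_indices ps <= [:: i, j & pair_indices ps]} by move=> l lI; rewrite !inE lI !orbT.
have weq_linked' l m : linked ps l m -> weq (2 * '[g l, g m]) ((a l)%:Z + (a m)%:Z).
  by move=> lm; apply: weq_linked; rewrite linked_cons lm !orbT.
have [h [h1 [h_out h_pair]]] :=
  IHps u (fun l lI => diag l (sub l lI)) weq_linked' (graded_eq_sub sub gr).
have [||||k [k1 [dk dk1 ki kj]]] := @diagonalize_congruent_plane g g1 a i j ij.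
- by apply: diag; rewrite inE eqxx.
- by apply: diag; rewrite !inE eqxx orbT.
- by apply: weq_linked; rewrite linked_cons eqxx.
- by apply: graded_eq_sub gr => l; rewrite !inE => /orP[] ->; rewrite ?orbT.
pose ext (k h : nat -> V) l := if (l == i) || (l == j) then k l else h l.
have [ext_i ext_j] : (forall k h, ext k h i = k i) /\ (forall k h, ext k h j = k j).
  by rewrite /ext !eqxx orbT.
have ext_out k' h' l : l \in pair_indices ps -> ext k' h' l = h' l.
  by move=> lI; rewrite /ext (negPf (memPn ni _ lI)) (negPf (memPn nj _ lI)).
exists (ext k h), (ext k1 h1); split.
  move=> l; rewrite !inE !negb_or => /and3P[/negPf li /negPf lj lps].
  by rewrite /ext li lj; apply: h_out.
move=> p q; rewrite inE xpair_eqE => /orP[/andP[/eqP-> /eqP->]|pq].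
  by rewrite /plane_diagonal !ext_i !ext_j.
have [pI qI] : p \in pair_indices ps /\ q \in pair_indices ps.
  by split; apply/mem_pair_indices; [exists q | exists p]; rewrite /linked pq ?orbT.
by rewrite /plane_diagonal !ext_out //; apply: h_pair.
Qed.

Lemma plane_diagonalC g h i j : plane_diagonal g h i j -> plane_diagonal g h j i.
Proof.
move=> [si sj o [ni nj u]]; rewrite /plane_diagonal symC [_ * '[h i]]mulrC.
have sub : {subset [:: i; j] <= [:: j; i]} by move=> l; rewrite !inE orbC.
by split=> //; [apply: (lincomb_spanned sub sj) | apply: (lincomb_spanned sub si)].
Qed.

Definition same_block ps i j : bool := (i == j) || linked ps i j.

Lemma same_block_trans ps i j l : uniq (pair_indices ps) ->
  same_block ps i j -> same_block ps j l -> same_block ps i l.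
Proof.
move=> u /orP[/eqP->//|ij] /orP[/eqP <-|jl]; first by rewrite /same_block ij orbT.
by rewrite linkedC in jl; rewrite (linked_inj u ij jl) /same_block eqxx.
Qed.

Record almost_orthogonal h a ps ss : Prop := {
  almost_orthogonal_uniq : uniq (indices ps ss);
  almost_orthogonal_form : {in indices ps ss &, forall i j, i != j ->
    ~~ ((i \in ss) && (j \in ss)) -> '[h i, h j] = 0};
  almost_orthogonal_plane : forall i j, linked ps i j ->
    '[h i] != 0 /\ unramified (- ('[h i] * '[h j]));
  almost_orthogonal_single : {in ss, forall i, weq '[h i] (2 * (a i)%:Z)};
  almost_orthogonal_cross : {in ss &, forall i j, i != j ->
    wge (2 * '[h i, h j]) ((a i)%:Z + (a j)%:Z + 1)} }.

Section Assembly.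

Variables (g h : nat -> V) (a : nat -> nat) (ps : seq (nat * nat)) (ss : seq nat).
Hypothesis h_out : forall l, l \notin pair_indices ps -> h l = g l.
Hypothesis h_plane : forall i j, linked ps i j -> plane_diagonal g h i j.

Lemma spanned_block i : i \in indices ps ss ->
  spanned g [seq m <- indices ps ss | same_block ps i m] (h i).
Proof.
move=> iI; have [/mem_pair_indices[j ij]|iout] := boolP (i \in pair_indices ps); last first.
  by rewrite h_out //; apply: spanned_mem; rewrite mem_filter /same_block eqxx.
have [si _ _ _] := h_plane ij; apply: lincomb_spanned si => m.
rewrite mem_filter /same_block !inE => /orP[] /eqP->; first by rewrite eqxx.
by rewrite ij orbT; rewrite linkedC in ij; rewrite (linked_indices _ ij).
Qed.

Lemma planes_almost_orthogonal : reduced bt g a ps ss -> cleared bt g ps ss ->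
  almost_orthogonal h a ps ss.
Proof.
move=> rg cg; have u := reduced_uniq rg; have up := uniq_pair_indices u.
have hs i : i \in ss -> h i = g i by move=> iss; apply/h_out/(single_not_paired u iss).
split=> // [i j iI jI ij not_single|i j /h_plane[_ _ _ []]//|i iss|i j iss jss ij]; first 1 last.
- by rewrite hs //; apply: (reduced_single rg).
- rewrite !hs //; apply: (reduced_off rg); rewrite ?mem_indices_single //.
  exact: single_not_linked u iss.
have [/h_plane[]//|ij_off] := boolP (linked ps i j).
have not_same : ~~ same_block ps i j by rewrite negb_or ij.
apply: lincomb_orth (spanned_block iI) => m; rewrite mem_filter => /andP[im mI].
rewrite symC; apply: lincomb_orth (spanned_block jI) => l; rewrite mem_filter => /andP[jl lI].
have ml_off : ~~ same_block ps m l.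
  apply: contra not_same => ml; apply: (same_block_trans up im); apply: (same_block_trans up ml).
  by move: jl; rewrite /same_block eq_sym linkedC.
move: ml_off; rewrite negb_or => /andP[ml ml_off]; rewrite symC; apply: cg => //.
have single k k' : same_block ps k k' -> k' \in ss -> k \in ss.
  by case/orP=> [/eqP->//|]; rewrite linkedC => kk' k'ss; case/negP: (single_not_linked k u k'ss).
by apply: contra not_single => /andP[/(single _ _ im)-> /(single _ _ jl)].
Qed.

Lemma planes_spanned f : {in indices ps ss, forall i, spanned f (indices ps ss) (g i)} ->
  {in indices ps ss, forall i, spanned f (indices ps ss) (h i)}.
Proof.
move=> gf i /spanned_block; apply: spanned_trans => m.
by rewrite mem_filter => /andP[_]; apply: gf.
Qed.

End Assembly.

Lemma common_orthogonalization f f1 a ps ss :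
  reduced bt f a ps ss -> graded_eq bt f f1 a (indices ps ss) -> exists h h1,
   [/\ {in indices ps ss, forall i, spanned f (indices ps ss) (h i)},
       {in indices ps ss, forall i, spanned f1 (indices ps ss) (h1 i)},
       almost_orthogonal h a ps ss, almost_orthogonal h1 a ps ss &
       {in pair_indices ps, forall i, '[h1 i] = '[h i]}].
Proof.
move=> rf ff1; have rf1 := reduced_graded_eq ff1 rf.
have sub : {subset pair_indices ps <= indices ps ss} by move=> i; apply: mem_indices_pair.
have clear f' : reduced bt f' a ps ss -> exists g, [/\ graded_eq bt f' g a (indices ps ss),
    cleared bt g ps ss & {in indices ps ss, forall i, spanned f' (indices ps ss) (g i)}].
  move=> rf'; have [g [close cg _]] := clear_pairs rf'; exists g; split=> // [|i iI].
    apply: (level_graded_eq_id (reduced_bounded rf')) => i iI.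
    exact: levelW sub (lexx _) (close _ iI).
  rewrite -(subrK (f' i) (g i)); apply: lincombD (spanned_mem _ iI).
  exact: lincomb_spanned sub (close _ iI).
have [g [fg cg sg]] := clear _ rf; have [g1 [f1g1 cg1 sg1]] := clear _ rf1.
have [rg rg1] := (reduced_graded_eq fg rf, reduced_graded_eq f1g1 rf1).
have gg1 := graded_eq_trans (graded_eq_trans (graded_eq_sym fg) ff1) f1g1.
have [h [h1 [h_out h_pair]]] := diagonalize_congruent_planes
  (uniq_pair_indices (reduced_uniq rg)) (fun i iI => reduced_diag rg (sub i iI))
  (reduced_linked rg) (graded_eq_sub sub gg1).
have [hg h1g1] : (forall i j, linked ps i j -> plane_diagonal g h i j) /\
                 (forall i j, linked ps i j -> plane_diagonal g1 h1 i j).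
  by split=> i j /orP[] /h_pair[? ? _ _] //; apply: plane_diagonalC.
have h_out1 l : l \notin pair_indices ps -> h1 l = g1 l by case/h_out.
have h_out0 l : l \notin pair_indices ps -> h l = g l by case/h_out.
exists h, h1; split; first exact: (planes_spanned h_out0 hg).
- exact: (planes_spanned h_out1 h1g1).
- exact: (planes_almost_orthogonal h_out0 hg).
- exact: (planes_almost_orthogonal h_out1 h1g1).
by move=> i /mem_pair_indices[j /orP[]] /h_pair[].
Qed.

End Orthogonalization.

(** * Invariants of reduced systems *)

Section Invariants.

Variables (V : lmodType F) (bt : {symmetric V}).
Local Notation "''[' x , y ]" := (bt x y) : ring_scope.
Local Notation "''[' x ]" := (bt x x) : ring_scope.
Implicit Types (f g h : nat -> V) (a : nat -> nat) (ps : seq (nat * nat)) (ss I : seq nat).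

Definition gram f k : 'M[F]_k := \matrix_(i, j) '[f i, f j].

Definition congruent k (M N : 'M[F]_k) : Prop := exists Y : 'M[F]_k, Y^T *m M *m Y = N.

Lemma congruent_trans k (N M L : 'M[F]_k) : congruent M N -> congruent N L -> congruent M L.
Proof. by move=> [Y <-] [X <-]; exists (Y *m X); rewrite trmx_mul !mulmxA. Qed.

Lemma gram_congruent f h I k : perm_eq I (iota 0 k) -> {in I, forall i, spanned f I (h i)} ->
  congruent (gram f k) (gram h k).
Proof.
move=> pI fh; have uI : uniq I by rewrite (perm_uniq pI) iota_uniq.
have /boolp.choice[c cE] : forall l : 'I_k, exists c : nat -> F, h l = \sum_(m < k) c m *: f m.
  move=> l; have [|c cE] := @spanned_coef _ f I (h l) uI.
    by apply: fh; rewrite (perm_mem pI) mem_iota ltn_ord.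
  exists c; rewrite cE (perm_big _ pI) /= -(big_mkord xpredT (fun m => c m *: f m)).
  by rewrite /index_iota subn0.
exists (\matrix_(m, l) c l m); apply/matrixP => i j.
rewrite [RHS]mxE !cE linear_sumr mxE; apply: eq_bigr => n _.
rewrite [X in _ * X]mxE /= symZr mulrC; congr (_ * _).
by rewrite linear_sumlz mxE; apply: eq_bigr => m _; rewrite /= symZl !mxE.
Qed.

Lemma gram_orthogonal h k : {in iota 0 k &, forall i j, i != j -> '[h i, h j] = 0} ->
  gram h k = diag_mx (\row_l '[h l]).
Proof.
move=> orth; apply/matrixP => i j; rewrite !mxE.
have [->|ij] := eqVneq i j; first by rewrite mulr1n.
by rewrite mulr0n orth ?mem_iota ?ltn_ord.
Qed.

Lemma det_gram_orthogonal h I k : perm_eq I (iota 0 k) ->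
  {in I &, forall i j, i != j -> '[h i, h j] = 0} -> \det (gram h k) = \prod_(l <- I) '[h l].
Proof.
move=> pI orth; rewrite gram_orthogonal ?det_diag => [|i j]; last first.
  by rewrite -!(perm_mem pI); apply: orth.
rewrite (perm_big _ pI) -val_enum_ord big_map [RHS]big_enum /=.
by apply: eq_bigr => i _; rewrite mxE.
Qed.

Lemma det_congruent k (M N : 'M[F]_k) : congruent M N -> \det N != 0 ->
  eq_mod_sqr (\det N) (\det M).
Proof.
move=> [Y <-]; rewrite !det_mulmx det_tr => h; exists (\det Y); last by ring.
by apply: contraNneq h => ->; rewrite mulr0.
Qed.

Lemma det_congruent_neq0 k (M N : 'M[F]_k) : congruent M N -> \det N != 0 -> \det M != 0.
Proof.
move=> MN N0; have [c _ NE] := det_congruent MN N0.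
by apply: contraNneq N0 => M0; rewrite NE M0 mul0r.
Qed.

Lemma xi_congruent k (M N : 'M[F]_k) : congruent M N -> \det N != 0 ->
  xi v M = disc_xi v ((-1) ^+ k./2 * \det N).
Proof.
move=> MN N0; apply/disc_xi_eq_mod_sqr/eq_mod_sqrM/eq_mod_sqr_sym/det_congruent => //.
exists (2 ^+ k./2); first by rewrite expf_neq0 ?two_neq0.
by rewrite -exprM mulnC exprM -exprMn; congr (_ ^+ _); ring.
Qed.

Lemma odd_valM x y : x != 0 -> y != 0 -> odd `|v (x * y)| = odd `|v x| (+) odd `|v y|.
Proof. by move=> x0 y0; rewrite vM //; lia. Qed.

Lemma odd_val_sign x n : odd `|v ((-1) ^+ n * x)| = odd `|v x|.
Proof. by case: (odd n) (signr_odd F n) => <-; rewrite ?expr0 ?expr1 ?mulN1r ?mul1r ?vN. Qed.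

Lemma ord_det_odd_congruent k (M N : 'M[F]_k) : congruent M N -> \det N != 0 ->
  ord_det_odd v M = ord_det_odd v N.
Proof.
move=> MN N0; rewrite /ord_det_odd; have [c c0 NE] := det_congruent MN N0.
have M0 := det_congruent_neq0 MN N0; rewrite NE odd_valM ?expf_neq0 // vX //; lia_goal.
Qed.

Lemma unramified_pair_prod (n : nat -> F) ps :
  (forall i j, linked ps i j -> unramified (- (n i * n j))) ->
  unramified ((-1) ^+ size ps * \prod_(l <- pair_indices ps) n l).
Proof.
elim: ps => [|[i j] ps IHps] un; first by rewrite big_nil mulr1 expr0; apply: unramified1.
rewrite pair_indices_cons !big_cons exprS.
rewrite (_ : _ * _ = - (n i * n j) * ((-1) ^+ size ps * \prod_(l <- pair_indices ps) n l)).
  apply: unramifiedM; first by apply: un; rewrite linked_cons eqxx.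
  by apply: IHps => p q pq; apply: un; rewrite linked_cons pq !orbT.
by ring.
Qed.

Lemma ramified_plane_disc x y z (A B : int) : weq x (2 * A) -> weq y (2 * B) -> odd `|A + B| ->
  wge (2 * z) (A + B + 1) -> ramified (z ^+ 2 - x * y).
Proof.
move=> hx hy oAB hz; have hxy := weqM hx hy.
have [hz3|hz3] := boolP (wge (2 * z) (A + B + 3)).
  left; have : weq (4 * (z ^+ 2 - x * y)) (2 * (A + B + 2)).
    rewrite (_ : 4 * _ = - (4 * (x * y)) + (2 * z) * (2 * z)); last by ring.
    apply: weqDl; last by apply: (wgeM_le hz3 hz3); lia_goal.
    by rewrite weqN; apply: (weq_eq (weqM weq4 hxy)) => //; lia_goal.
  case/weqP; rewrite mulf_eq0 negb_or => /andP[n4 n0]; rewrite vM // => vz; split=> //.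
  by have /weqP[_] := weq4; move: (v 4) (v _) vz oAB; lia_goal.
right; have [m mE] : exists m : int, A + B + 1 = 2 * m.
  by exists ((A + B + 1) %/ 2)%Z; clear -oAB; lia.
have hz1 : weq (2 * z) (A + B + 1).
  rewrite mE; apply: wge_weq; first by rewrite -mE.
  by apply: contra hz3 => hz3; apply: wgeW hz3 _; clear -mE; lia.
have z0 : z != 0 by apply: contraNneq (weq_neq0 hz1) => ->; rewrite mulr0.
exists (- (2 * (x * y) / (2 * z) ^+ 2)), z; split=> //; last by field; rewrite z0 two_neq0.
rewrite weqN; apply: (weq_eq (weqM (weqM weq2 hxy) (weqV (weqX 2 hz1)))) => //; lia_goal.
Qed.

Section AlmostOrthogonal.

Variables (h : nat -> V) (a : nat -> nat) (ps : seq (nat * nat)) (k : nat) (M : 'M[F]_k).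
Hypothesis Mh : congruent M (gram h k).

Let pair_prod : F := \prod_(l <- pair_indices ps) '[h l].

Lemma pair_norm_neq0 ss l : almost_orthogonal bt h a ps ss -> l \in pair_indices ps -> '[h l] != 0.
Proof. by move=> ao /mem_pair_indices[m /(almost_orthogonal_plane ao)[]]. Qed.

Lemma pair_prod_neq0 ss : almost_orthogonal bt h a ps ss -> pair_prod != 0.
Proof. by move=> ao; rewrite prodf_seq_neq0; apply/allP => l /(pair_norm_neq0 ao). Qed.

Lemma pair_disc_unramified ss : almost_orthogonal bt h a ps ss ->
  unramified ((-1) ^+ size ps * pair_prod).
Proof. by move=> ao; apply: unramified_pair_prod => i j /(almost_orthogonal_plane ao)[]. Qed.

Lemma half_indices ss : perm_eq (indices ps ss) (iota 0 k) -> k./2 = ((size ss)./2 + size ps)%N.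
Proof.
move/perm_size; rewrite size_cat size_pair_indices size_iota => <-.
by rewrite halfD odd_double andbF doubleK.
Qed.

Lemma xi_no_single : almost_orthogonal bt h a ps [::] -> perm_eq (indices ps [::]) (iota 0 k) ->
  \det (gram h k) = pair_prod /\ xi v M = disc_xi v ((-1) ^+ size ps * pair_prod).
Proof.
move=> ao pI; have dE : \det (gram h k) = pair_prod.
  by rewrite (det_gram_orthogonal pI) // => i j iI jI ij; apply: (almost_orthogonal_form ao).
by rewrite (xi_congruent Mh) dE ?(half_indices pI) // (pair_prod_neq0 ao).
Qed.

Section OneSingle.

Variable s : nat.
Hypothesis ao : almost_orthogonal bt h a ps [:: s].
Hypothesis pI : perm_eq (indices ps [:: s]) (iota 0 k).

Let orth : {in indices ps [:: s] &, forall i j, i != j -> '[h i, h j] = 0}.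
Proof.
move=> i j iI jI ij; apply: (almost_orthogonal_form ao) => //.
by rewrite !inE; apply: contra ij => /andP[/eqP-> /eqP->].
Qed.

Let s_norm : weq '[h s] (2 * (a s)%:Z).
Proof. by apply: (almost_orthogonal_single ao); rewrite inE. Qed.

Let s0 : '[h s] != 0 := weq_neq0 s_norm.

Lemma det_one_single : \det (gram h k) = '[h s] * pair_prod.
Proof. by rewrite (det_gram_orthogonal pI orth) big_cons. Qed.

Lemma det_one_single_neq0 : \det (gram h k) != 0.
Proof. by rewrite det_one_single mulf_neq0 ?(pair_prod_neq0 ao). Qed.

Lemma ord_det_one_single : ord_det_odd v (gram h k) = odd (a s).
Proof.
rewrite /ord_det_odd det_one_single odd_valM ?(pair_prod_neq0 ao) //.
have := unramified_even (pair_disc_unramified ao); rewrite odd_val_sign => /negPf->.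
by have /weqP[_] := s_norm; move: (v _) (a s); lia_goal.
Qed.

Lemma eta_one_single :
  Defs.eta M = hilb (-1 : F) (-1) ^+ (k.+1 %/ 4) * hilb (-1) pair_prod ^+ size ps *
    hilb '[h s] ((-1) ^+ size ps * pair_prod) * hasse [seq '[h l] | l <- pair_indices ps].
Proof.
have gE : gram h k = diag_mx (\row_l '[h l]).
  by rewrite gram_orthogonal // => i j; rewrite -!(perm_mem pI); apply: orth.
have [Y YE] : exists Y : 'M[F]_k, Y^T *m M *m Y = diag_mx (\row_l '[h l]) by rewrite -gE; apply: Mh.
have pairs0 : all (fun x : F => x != 0) [seq '[h l] | l <- pair_indices ps].
  by apply/allP => _ /mapP[l lI ->]; apply: pair_norm_neq0 ao lI.
rewrite (eta_congr_diag _ YE) => [|| i]; last 2 first.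
- have := det_one_single_neq0; rewrite gE -YE det_mulmx unitmxE unitfE.
  by apply: contraNneq => ->; rewrite mulr0.
- rewrite mxE; have : (i : nat) \in iota 0 k by rewrite mem_iota ltn_ord.
  by rewrite -(perm_mem pI) inE => /orP[/eqP->|/(pair_norm_neq0 ao)].
have m1 : (-1 : F) != 0 by rewrite oppr_eq0 oner_eq0.
rewrite /eta_diag -hasse_enum.
have -> : hilb (-1) (\det M) = hilb (-1) '[h s] * hilb (-1) pair_prod.
  rewrite -hilbMr ?(pair_prod_neq0 ao) // -det_one_single.
  apply: hilb_eq_mod_sqr (eq_mod_sqr_refl _) (eq_mod_sqr_sym _).
  exact: det_congruent Mh det_one_single_neq0.
have -> : hilb '[h s] ((-1) ^+ size ps * pair_prod) =
    hilb (-1) '[h s] ^+ size ps * \prod_(x <- [seq '[h l] | l <- pair_indices ps]) hilb '[h s] x.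
  rewrite hilb_prod // big_map hilbMr ?expf_neq0 ?(pair_prod_neq0 ao) //; congr (_ * _).
  elim: (size ps) => [|n IHn]; first by rewrite !expr0 hilb1.
  by rewrite !exprS hilbMr ?expf_neq0 // IHn hilbC.
have -> : (k.-1 %/ 2)%N = size ps.
  by have := perm_size pI; rewrite size_cat size_pair_indices size_iota => <-; rewrite divn2 doubleK.
have -> : [seq (\row_l '[h l]) 0 i | i <- enum 'I_k] = [seq '[h l] | l <- iota 0 k].
  by rewrite -val_enum_ord -map_comp; apply: eq_map => i; rewrite /= mxE.
by rewrite -(hasse_perm (perm_map (fun l => '[h l]) pI)) /= exprMn; ring.
Qed.

End OneSingle.

Section TwoSingles.

Variables s t : nat.
Hypothesis ao : almost_orthogonal bt h a ps [:: s; t].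
Hypothesis pI : perm_eq (indices ps [:: s; t]) (iota 0 k).
Hypothesis st_odd : odd (a s + a t).

Let st : s != t.
Proof. by apply: contraTneq st_odd => ->; rewrite addnn odd_double. Qed.

Let sI : s \in indices ps [:: s; t]. Proof. by rewrite inE eqxx. Qed.
Let tI : t \in indices ps [:: s; t]. Proof. by rewrite !inE eqxx orbT. Qed.

Let s_norm : weq '[h s] (2 * (a s)%:Z).
Proof. by apply: (almost_orthogonal_single ao); rewrite inE eqxx. Qed.

Let t_norm : weq '[h t] (2 * (a t)%:Z).
Proof. by apply: (almost_orthogonal_single ao); rewrite !inE eqxx orbT. Qed.

Let s0 : '[h s] != 0 := weq_neq0 s_norm.

Let g : nat -> V := [eta h with t |-> h t - ('[h s, h t] / '[h s]) *: h s].

Let gE l : l != t -> g l = h l. Proof. by rewrite /g /= => /negPf->. Qed.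
Let gt : g t = h t - ('[h s, h t] / '[h s]) *: h s. Proof. by rewrite /g /= eqxx. Qed.

Lemma orthogonalized_pair : {in indices ps [:: s; t] &, forall i j, i != j -> '[g i, g j] = 0}.
Proof.
have orth i j : i \in indices ps [:: s; t] -> j \in indices ps [:: s; t] -> i != j ->
    ~~ ((i \in [:: s; t]) && (j \in [:: s; t])) -> '[h i, h j] = 0.
  by move=> *; apply: (almost_orthogonal_form ao).
have gt_orth i : i \in indices ps [:: s; t] -> i != t -> '[g t, h i] = 0.
  move=> iI it; rewrite gt linearBl /= symZl.
  have [->|is_] := eqVneq i s; first by rewrite divfK // symC subrr.
  have i_out : i \notin [:: s; t] by rewrite !inE negb_or is_.
  have [ti si] : '[h t, h i] = 0 /\ '[h s, h i] = 0.
    by split; apply: orth; rewrite // 1?eq_sym ?(negPf i_out) ?andbF.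
  by rewrite ti si mulr0 subr0.
move=> i j iI jI ij; have [iE|it] := eqVneq i t.
  by rewrite iE [g j]gE ?gt_orth // -iE eq_sym.
have [jE|jt] := eqVneq j t; first by rewrite jE [g i]gE // symC gt_orth.
rewrite !gE //; apply: orth => //; apply: contra ij.
by rewrite !inE (negPf it) (negPf jt) !orbF => /andP[/eqP-> /eqP->].
Qed.

Lemma disc_two_singles : ramified ((-1) ^+ k./2 * \det (gram g k)).
Proof.
rewrite (det_gram_orthogonal pI orthogonalized_pair) (half_indices pI) !big_cons /= exprS.
have -> : \prod_(l <- pair_indices ps) '[g l] = pair_prod.
  apply: eq_big_seq => l lI; rewrite gE //; apply: contraTneq lI => ->.
  by apply: (single_not_paired (almost_orthogonal_uniq ao)); rewrite !inE eqxx orbT.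
rewrite (_ : _ * _ = ((-1) ^+ size ps * pair_prod) * ('[h s, h t] ^+ 2 - '[h s] * '[h t])).
  apply: (unramifiedM_ramified (pair_disc_unramified ao)).
  apply: (ramified_plane_disc s_norm t_norm); first by move: st_odd; lia_goal.
  by apply: (almost_orthogonal_cross ao) => //; rewrite !inE eqxx ?orbT.
by rewrite gE // gt -scaleNr symDD !(symZl, symZr) [bt (h t) (h s)]symC; field.
Qed.

Lemma two_singles_congruent : congruent M (gram g k).
Proof.
apply: congruent_trans Mh (gram_congruent pI _) => l lI.
have [->|lt] := eqVneq l t; last by rewrite gE //; apply: spanned_mem.
by rewrite gt -scaleNr; apply: lincombD; [apply: spanned_mem | apply: lincomb1].
Qed.

Lemma det_two_singles_neq0 : \det (gram g k) != 0.
Proof. by have := ramified_neq0 disc_two_singles; rewrite mulf_eq0 negb_or => /andP[]. Qed.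

Lemma xi_two_singles : xi v M = 0.
Proof.
rewrite (xi_congruent two_singles_congruent) ?det_two_singles_neq0 //.
exact: disc_xi_ramified disc_two_singles.
Qed.

End TwoSingles.
End AlmostOrthogonal.

Lemma size_singles f a ps ss : reduced bt f a ps ss -> (size ss <= 2)%N.
Proof.
move=> rf; have := reduced_parity rf; have := reduced_uniq rf; rewrite cat_uniq => /andP[+ _].
case: ss {rf} => [|s [|t [|r ss]]] //= + par; rewrite !inE !negb_or -!andbA => /and5P[st sr _ tr _].
have odd_st : odd (a s + a t) by apply: par; rewrite // !inE eqxx ?orbT.
have odd_sr : odd (a s + a r) by apply: par; rewrite // !inE eqxx ?orbT.
have : odd (a t + a r) by apply: par; rewrite // !inE eqxx ?orbT.
by move: odd_st odd_sr; rewrite !oddD; case: (odd (a s)); case: (odd (a t)); case: (odd (a r)).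
Qed.

Lemma congruent_spanned f h ps ss k (M : 'M[F]_k) : congruent M (gram f k) ->
  perm_eq (indices ps ss) (iota 0 k) ->
  {in indices ps ss, forall i, spanned f (indices ps ss) (h i)} -> congruent M (gram h k).
Proof. by move=> Mf pI hf; apply: congruent_trans Mf (gram_congruent pI hf). Qed.

Lemma two_singles_parity f a ps s t : reduced bt f a ps [:: s; t] -> odd (a s + a t).
Proof.
move=> rf; apply: (reduced_parity rf); rewrite ?inE ?eqxx ?orbT //.
by have := reduced_uniq rf; rewrite /= inE negb_or -andbA => /andP[].
Qed.

Lemma reduced_det_neq0 k (M : 'M[F]_k) f a ps ss : reduced bt f a ps ss ->
  congruent M (gram f k) -> perm_eq (indices ps ss) (iota 0 k) -> \det M != 0.
Proof.
move=> rf Mf pI; have [h [_ [fh _ ao _ _]]] := common_orthogonalization rf (graded_eq_refl _ _ _ _).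
have Mh := congruent_spanned Mf pI fh.
have := size_singles rf; case: ss rf pI {Mf fh} ao => [|s [|t [|//]]] rf pI ao _.
- by apply: (det_congruent_neq0 Mh); rewrite (xi_no_single Mh ao pI).1 (pair_prod_neq0 ao).
- exact: det_congruent_neq0 Mh (det_one_single_neq0 ao pI).
apply: det_congruent_neq0 (two_singles_congruent Mh pI) _.
exact: det_two_singles_neq0 ao pI (two_singles_parity rf).
Qed.

Lemma reduced_invariants k (M : 'M[F]_k) f a ps ss : reduced bt f a ps ss ->
  congruent M (gram f k) -> perm_eq (indices ps ss) (iota 0 k) ->
  match ss with
  | [::] => [/\ ~~ odd k, xi v M != 0 & ~~ ord_det_odd v M]
  | [:: s] => odd k /\ ord_det_odd v M = odd (a s)
  | _ => ~~ odd k /\ xi v M = 0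
  end.
Proof.
move=> rf Mf pI; have [h [_ [fh _ ao _ _]]] := common_orthogonalization rf (graded_eq_refl _ _ _ _).
have Mh := congruent_spanned Mf pI fh.
have -> : odd k = odd (size ss).
  by have := perm_size pI; rewrite size_cat size_pair_indices size_iota => <-; rewrite oddD odd_double addbF.
have := size_singles rf; case: ss rf pI {Mf fh} ao => [|s [|t [|//]]] rf pI ao _.
- have [dE xiE] := xi_no_single Mh ao pI; have u := pair_disc_unramified ao.
  rewrite xiE (ord_det_odd_congruent Mh) ?dE ?(pair_prod_neq0 ao) // /ord_det_odd dE.
  rewrite disc_xi_unramified // -(odd_val_sign _ (size ps)); split=> //.
  exact: unramified_even.
- by rewrite (ord_det_odd_congruent Mh) ?(det_one_single_neq0 ao) ?(ord_det_one_single ao).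
by split=> //; apply: (xi_two_singles Mh ao pI) (two_singles_parity rf).
Qed.

Lemma hilb_unramified_eq_val x y D : x != 0 -> y != 0 -> v x = v y -> unramified D ->
  hilb x D = hilb y D.
Proof.
move=> x0 y0 vxy uD; have D0 := unramified_neq0 uD.
have yx0 : y / x != 0 by rewrite mulf_neq0 ?invr_eq0.
rewrite -[y in RHS](divfK x0) hilbMl // [hilb (y / x) D]hilbC.
case: uD => w [t [hw t0 ->]]; rewrite hilb_unram_unit ?mul1r //.
by apply/weqP; rewrite vM ?invr_eq0 // vV // vxy subrr mulr0.
Qed.

Lemma zeta_graded_eq k (M M' : 'M[F]_k) f f' a ps ss : reduced bt f a ps ss ->
  graded_eq bt f f' a (indices ps ss) -> perm_eq (indices ps ss) (iota 0 k) ->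
  congruent M (gram f k) -> congruent M' (gram f' k) -> zeta v M = zeta v M'.
Proof.
move=> rf ff' pI Mf Mf'; have rf' := reduced_graded_eq ff' rf.
have inv := reduced_invariants rf Mf pI; have inv' := reduced_invariants rf' Mf' pI.
have [h [h' [fh fh' ao ao' hh']]] := common_orthogonalization rf ff'.
have [Mh Mh'] := (congruent_spanned Mf pI fh, congruent_spanned Mf' pI fh').
have pairE : \prod_(l <- pair_indices ps) '[h' l] = \prod_(l <- pair_indices ps) '[h l].
  exact: eq_big_seq.
rewrite /zeta; case: ss pI {rf rf' ff' Mf Mf' fh fh'} ao ao' inv inv' => [|s [|t ss]] pI ao ao'.
- move=> [/negPf-> _ _] _.
  by rewrite (xi_no_single Mh ao pI).2 (xi_no_single Mh' ao' pI).2 pairE.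
- move=> [-> _] _; rewrite (eta_one_single Mh ao pI) (eta_one_single Mh' ao' pI) pairE.
  have -> : [seq '[h' l] | l <- pair_indices ps] = [seq '[h l] | l <- pair_indices ps].
    exact/eq_in_map.
  congr (_ * _ * _); have ss_s : s \in [:: s] by rewrite inE.
  have /weqP[n0 vn] := almost_orthogonal_single ao ss_s.
  have /weqP[n0' vn'] := almost_orthogonal_single ao' ss_s.
  apply: hilb_unramified_eq_val (pair_disc_unramified ao) => //.
  by move: (v _) (v _) vn vn'; lia_goal.
by move=> [/negPf-> ->] [_ ->].
Qed.

End Invariants.

(** * Uniqueness of the Gross-Keating invariant *)

Lemma lexle_anti s t : size s = size t -> lexle s t -> lexle t s -> s = t.
Proof.
elim: s t => [|x s IHs] [|y t] //= [szE]; case: (ltngtP x y) => //= -> st ts.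
by rewrite (IHs t).
Qed.

Lemma lexleNgt s t : size s = size t -> ~~ lexle t s -> exists p, [/\ (p < size s)%N,
  forall i, (i < p)%N -> nth 0%N s i = nth 0%N t i & (nth 0%N s p < nth 0%N t p)%N].
Proof.
elim: s t => [|x s IHs] [|y t] //= [szE]; case: (ltngtP x y) => //= [xy _|-> ts].
  by exists 0%N.
have [p [ps eq_st lt_st]] := IHs _ szE ts.
by exists p.+1; split=> // -[|i] //; rewrite ltnS; apply: eq_st.
Qed.

Lemma wge_det n (U : 'M[F]_n) (r c : 'I_n -> int) : (forall i j, wge (U i j) (r i + c j)) ->
  wge (\det U) (\sum_i r i + \sum_j c j).
Proof.
move=> hU; rewrite /determinant; apply: wge_sum => // s _.
apply: (wgeM_le (k := 0) (l := \sum_i (r i + c (perm.fun_of_perm s i)))).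
- by case: (perm.odd_perm s); rewrite ?expr1 ?expr0 ?wgeN; apply: wge1.
- exact: wge_prod.
by rewrite add0r big_split /= lerD2l [leLHS](reindex_inj (@perm.perm_inj _ s)).
Qed.

Lemma wge_invmx n (U : 'M[F]_n) (c : 'I_n -> int) : weq (\det U) 0 ->
  (forall i j, wge (U i j) (c j - c i)) -> forall i j, wge (invmx U i j) (c j - c i).
Proof.
move=> dU hU i j; have uU : U \in unitmx by rewrite unitmxE unitfE (weq_neq0 dU).
rewrite /invmx uU mxE [\adj U i j]mxE /cofactor.
apply: (wgeM_le (k := 0) (l := c j - c i)); last by lia_goal.
  by have := weqV dU; rewrite oppr0 => /weq_wge.
apply: (wgeM_le (k := 0) (l := c j - c i)); last by lia_goal.
  by rewrite -signr_odd; case: (odd _); rewrite ?expr1 ?expr0 ?wgeN; apply: wge1.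
pose r k := - c (lift j k); pose s k := c (lift i k).
have -> : c j - c i = \sum_k r k + \sum_k s k.
  have total k : \sum_l c l = c k + \sum_l c (lift k l) by rewrite (bigD1_ord k).
  have := total i; rewrite (total j) sumrN /s.
  by move: (\sum_k _) (\sum_k _) (c i) (c j) => x y z w; lia_goal.
by apply: wge_det => k l; rewrite !mxE addrC; apply: hU.
Qed.

Lemma wge_det_zero_block n (U : 'M[F]_n) p : (p < n)%N -> (forall i j, wge (U i j) 0) ->
  (forall i j : 'I_n, (i <= p)%N -> (p <= j)%N -> wge (U i j) 2) -> wge (\det U) 2.
Proof.
move=> pn hU hblock; pose r (i : 'I_n) : int := if (i <= p)%N then 2 else 0.
pose c (j : 'I_n) : int := if (j < p)%N then -2 else 0.
have count (x : int) q : (q <= n)%N -> \sum_(i < n) (if (i < q)%N then x else 0) = x * q%:Z.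
  move=> qn; rewrite -big_mkcond -(big_ord_widen n (fun=> x) qn) sumr_const card_ord.
  by rewrite -[LHS]mulr_natr natz.
have [rE cE] : \sum_i r i = 2 * p.+1%:Z /\ \sum_j c j = -2 * p%:Z.
  by split; [apply: (count 2 p.+1 pn) | apply: (count (-2) p (ltnW pn))].
have -> : (2 : int) = \sum_i r i + \sum_j c j by rewrite rE cE; lia_goal.
apply: wge_det => i j; rewrite /r /c; case: (leqP i p) => ip; case: (ltnP j p) => jp //.
  exact: hblock.
exact: wgeW (hU i j) _.
Qed.

Lemma GLoP n (U : 'M[F]_n) : reflect ((forall i j, wge (U i j) 0) /\ weq (\det U) 0) (GLo v U).
Proof.
rewrite /GLo unit_oE; apply: (iffP andP) => -[hU dU]; split=> //.
  by move=> i j; have /forallP/(_ i)/forallP/(_ j) := hU; rewrite integralE.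
by apply/forallP => i; apply/forallP => j; rewrite integralE.
Qed.

Lemma inSP n (M : 'M[F]_n) (a : nat -> nat) : M^T = M ->
  inS v M (mkseq a n) <->
  [/\ forall i j, (i <= j < n)%N -> (a i <= a j)%N, forall i, wge (M i i) (2 * (a i)%:Z) &
      forall i j, wge (2 * M i j) ((a i)%:Z + (a j)%:Z)].
Proof.
move=> symM; split=> [[_ a_sorted diag off]|[a_mono diag off]].
  split=> [i j /andP[ij jn]|i|i j].
  - have iN := leq_ltn_trans ij jn; rewrite -(nth_mkseq 0 a iN) -(nth_mkseq 0 a jn).
    by apply: (sorted_leq_nth leq_trans leqnn) => //; rewrite inE size_mkseq.
  - by rewrite -vgeE; have := diag i; rewrite nth_mkseq.
  case: (leqP i j) => ij; first by have := off i j ij; rewrite !nth_mkseq.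
  by have := off j i (ltnW ij); rewrite !nth_mkseq // addnC -{1 2}symM !mxE.
split=> [||i|i j _]; rewrite ?size_mkseq ?nth_mkseq ?vgeE //; last exact: off.
apply/(sortedP 0%N) => i; rewrite size_mkseq => iN; rewrite !nth_mkseq ?(ltnW iN) //.
by apply: a_mono; rewrite leqnSn.
Qed.

Section GradedForm.

Variable n : nat.
Implicit Types (a : nat -> nat) (x y : 'cV[F]_n).

Definition coord_level a (m : nat) x : Prop :=
  forall i : 'I_n, wge (x i 0) 0 && wge (x i 0) (m%:Z - (a i)%:Z).

(* The quadratic form induced on each graded piece [coord_level a m / coord_level a m.+1] has
   trivial radical, so that the filtration is determined by the form alone. *)
Definition graded_nonsingular (A : 'M[F]_n) a : Prop :=
  forall (m : nat) x, coord_level a m x -> wge (qform A x x) (2 * m%:Z + 2) ->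
    (forall y, coord_level a m y -> wge (2 * qform A x y) (2 * m%:Z + 2)) -> coord_level a m.+1 x.

Section BaseChange.

Variables (A U : 'M[F]_n) (a a' : nat -> nat).
Hypothesis A_nonsingular : graded_nonsingular A a.
Hypotheses (U_int : forall i j, wge (U i j) 0) (U_unit : weq (\det U) 0).

Local Notation A' := (U^T *m A *m U).
Hypothesis A'_diag : forall i, wge (A' i i) (2 * (a' i)%:Z).
Hypothesis A'_off : forall i j, wge (2 * A' i j) ((a' i)%:Z + (a' j)%:Z).

Let U_unitmx : U \in unitmx.
Proof. by rewrite unitmxE unitfE (weq_neq0 U_unit). Qed.

Lemma qform_col_invmx j y : qform A (col j U) y = \sum_l A' j l * (invmx U *m y) l 0.
Proof.
transitivity ((row j A' *m (invmx U *m y)) 0 0).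
  by rewrite /qform mulmxA -row_mul mulmxK // row_mul -tr_col.
by rewrite mxE; apply: eq_bigr => l _; rewrite mxE.
Qed.

Lemma coord_level_gain m : (forall i : 'I_n, minn (a i) m = minn (a' i) m) ->
  (forall i j, wge (U i j) ((minn (a j) m)%:Z - (a i)%:Z)) ->
  forall i j : 'I_n, (m < a' j)%N -> wge (U i j) (m.+1%:Z - (a i)%:Z).
Proof.
move=> same_min U_level i j mj.
have jm : minn (a j) m = m by rewrite same_min (minn_idPr (ltnW mj)).
have U_graded k l : wge (U k l) ((minn (a l) m)%:Z - (minn (a k) m)%:Z).
  case: (leqP (a k) m) => _; first exact: U_level.
  by apply: wgeW (U_int k l) _; have := geq_minr (a l) m; lia_goal.
have V_graded := wge_invmx U_unit U_graded.
suff /(_ i) : coord_level a m.+1 (col j U) by rewrite mxE => /andP[].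
apply: A_nonsingular.
- by move=> k; rewrite mxE U_int; have := U_level k j; rewrite jm.
- by rewrite qform_col; apply: wgeW (A'_diag j) _; lia.
move=> y y_level; rewrite qform_col_invmx mulr_sumr; apply: wge_sum => // l _; rewrite mulrA.
have Vy : wge ((invmx U *m y) l 0) (m%:Z - (minn (a l) m)%:Z).
  rewrite mxE; apply: wge_sum => // k _; apply: (wgeM_le (V_graded l k) (l := m%:Z - (minn (a k) m)%:Z)).
    by have /andP[] := y_level k; case: (leqP (a k) m) => // _ y0 _; rewrite subrr.
  by lia_goal.
apply: (wge_sharpen (wgeM (A'_off j l) Vy)) => z; have := same_min l.
by move: (a l) (a' l) (a' j) mj; lia_goal.
Qed.

Lemma base_change_level M : (forall i : 'I_n, minn (a i) M = minn (a' i) M) ->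
  forall i j, wge (U i j) ((minn (a j) M)%:Z - (a i)%:Z).
Proof.
elim: M => [|m IHm] same_min i j; first by apply: wgeW (U_int i j) _; rewrite minn0; lia_goal.
have same_min' (k : 'I_n) : minn (a k) m = minn (a' k) m by have := same_min k; lia_goal.
have U_level := IHm same_min'; have := same_min j.
case: (leqP (a' j) m) => [jm jE|mj _].
  by apply: wgeW (U_level i j) _; move: (a i) (a j) (a' j) jm jE; lia_goal.
by apply: wgeW (coord_level_gain same_min' U_level i mj) _; move: (a j) (a i); lia_goal.
Qed.

Lemma base_change_inv_level : (forall i : 'I_n, a i = a' i) ->
  forall i j, wge (invmx U i j) ((a j)%:Z - (a i)%:Z).
Proof.
move=> aa'; pose M := \max_(i < n) a i.
have aM (i : 'I_n) : minn (a i) M = a i by apply/minn_idPl; apply: (leq_bigmax i).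
apply: wge_invmx U_unit _ => i j; rewrite -{1}(aM j); apply: base_change_level => k.
by rewrite aa'.
Qed.

Lemma exponents_not_exceeded p : (forall i j, (i <= j < n)%N -> (a i <= a j)%N) ->
  (forall i j, (i <= j < n)%N -> (a' i <= a' j)%N) -> (p < n)%N ->
  (forall i, (i < p)%N -> a i = a' i) -> (a' p <= a p)%N.
Proof.
move=> a_mono a'_mono pn eq_before; rewrite leqNgt; apply/negP => lt_p.
have same_min (i : 'I_n) : minn (a i) (a p) = minn (a' i) (a p).
  have [ip|pi] := ltnP i p; first by rewrite eq_before.
  have [ai a'i] : (a p <= a i /\ a' p <= a' i)%N by split; [apply: a_mono | apply: a'_mono]; rewrite pi /=.
  by move: (a p) (a i) (a' p) (a' i) lt_p ai a'i; lia_goal.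
have gain := coord_level_gain same_min (base_change_level same_min).
suff : wge (\det U) 2 by have /weqP[d0 vd] := U_unit; move=> /wgeP/(_ d0); rewrite vd.
apply: (wge_det_zero_block pn U_int) => i j ip pj.
have lt_j : (a p < a' j)%N by apply: leq_trans lt_p (a'_mono _ _ _); rewrite pj /=.
have ai : (a i <= a p)%N by apply: a_mono; rewrite ip.
by apply: (wge_sharpen (gain i j lt_j)); move: (a p) (a i) ai; lia_goal.
Qed.

End BaseChange.

Lemma GK_graded_nonsingular (A : 'M[F]_n) a : A^T = A -> inS v A (mkseq a n) ->
  graded_nonsingular A a -> GK v A = mkseq a n.
Proof.
move=> symA inS_a nsA; have inSU_a : inSU v A (mkseq a n).
  exists 1%:M; split; last by rewrite trmx1 mul1mx mulmx1.
  apply/GLoP; rewrite det1 weq1; split=> // i j; rewrite mxE.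
  by case: eqP => _; rewrite ?mulr1n ?mulr0n ?wge0 ?wge1.
have max_a s : inSU v A s -> lexle s (mkseq a n).
  move=> [U [/GLoP[U_int U_unit] inS_s]]; have [sz _ _ _] := inS_s.
  have sE : s = mkseq (nth 0%N s) n by rewrite -sz mkseq_nth.
  rewrite sE in inS_s *; apply: contraT; case/lexleNgt=> [|p]; first by rewrite !size_mkseq.
  have [a_mono _ _] := (inSP a symA).1 inS_a.
  have symUAU : (U^T *m A *m U)^T = U^T *m A *m U by rewrite !trmx_mul trmxK symA mulmxA.
  have [s_mono s_diag s_off] := (inSP _ symUAU).1 inS_s.
  rewrite size_mkseq => -[pn eq_before]; rewrite !nth_mkseq // ltnNge.
  rewrite (exponents_not_exceeded nsA U_int U_unit s_diag s_off) // => i ip.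
  by have := eq_before i ip; rewrite !nth_mkseq // (ltn_trans ip).
rewrite /GK; set P := (fun _ => _).
have [GK_in GK_max] := @classical_sets.xgetPex _ [::] P (ex_intro _ _ (conj inSU_a max_a)).
apply: lexle_anti; [| exact: max_a | exact: GK_max].
by case: GK_in => U [_ [-> _ _ _]]; rewrite size_mkseq.
Qed.

End GradedForm.

Section NonsingularReduction.

Variables (V : lmodType F) (bt : {symmetric V}).
Local Notation "''[' x , y ]" := (bt x y) : ring_scope.
Local Notation "''[' x ]" := (bt x x) : ring_scope.
Variables (n : nat) (f : nat -> V) (a : nat -> nat).
Implicit Types x y : 'cV[F]_n.

Definition basis_comb x : V := \sum_(i < n) x i 0 *: f i.

Lemma qform_gram x y : qform (gram bt f n) x y = '[basis_comb x, basis_comb y].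
Proof.
rewrite /qform linear_sumr mxE; apply: eq_bigr => j _.
rewrite /= symZr mulrC linear_sumlz mxE; congr (_ * _); apply: eq_bigr => i _.
by rewrite /= symZl !mxE.
Qed.

Lemma basis_comb_delta (j : 'I_n) c : basis_comb (c *: delta_mx j 0) = c *: f j.
Proof.
rewrite /basis_comb (bigD1 j) //= !mxE !eqxx mulr1 big1 ?addr0 // => l lj.
by rewrite !mxE (negPf lj) mulr0 scale0r.
Qed.

Lemma wge_sum_isolate (I : finType) (G : I -> F) i k :
  wge (\sum_j G j) k -> (forall j, j != i -> wge (G j) k) -> wge (G i) k.
Proof.
rewrite (bigD1 i) //= => hsum others; rewrite -(addrK (\sum_(j | j != i) G j) (G i)).
exact: wgeB hsum (wge_sum _ others).
Qed.

Section Degree.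

Variables (m k : nat) (ps : seq (nat * nat)) (ss : seq nat) (x : 'cV[F]_n).
Hypotheses (f_bounded : bounded bt f a (iota 0 n)) (kn : (k <= n)%N).
Hypothesis k_cut : forall i, (i < n)%N -> (i < k)%N = (a i <= m)%N.
Hypotheses (indices_k : perm_eq (indices ps ss) (iota 0 k)) (rf : reduced bt f a ps ss).
Hypothesis x_level : coord_level a m x.
Hypothesis x_norm : wge (qform (gram bt f n) x x) (2 * m%:Z + 2).
Hypothesis x_radical : forall y, coord_level a m y ->
  wge (2 * qform (gram bt f n) x y) (2 * m%:Z + 2).

Local Notation gains i := (wge (x i 0) (m.+1%:Z - (a i)%:Z)).

Let x_int i : wge (x i 0) 0. Proof. by have /andP[] := x_level i. Qed.
Let x_wge i : wge (x i 0) (m%:Z - (a i)%:Z). Proof. by have /andP[] := x_level i. Qed.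

Let mem_k i : (i \in indices ps ss) = (i < k)%N.
Proof. by rewrite (perm_mem indices_k) mem_iota. Qed.

Let iota_ord (i : 'I_n) : (i : nat) \in iota 0 n. Proof. by rewrite mem_iota ltn_ord. Qed.

Lemma wge_unlinked_term (l : 'I_n) j h : (j < k)%N -> m = (a j + h.*2)%N -> ~~ linked ps l j ->
  wge (x l 0 * (2 ^+ h * (2 * '[f l, f j]))) (2 * m%:Z + 2).
Proof.
move=> jk mE lj_off; have h2 := weq_wge (weq2X h).
have [lj|lj] := eqVneq (l : nat) j.
  have jI : j \in indices ps ss by rewrite mem_k.
  have diag : wge (2 * '[f l, f j]) (2 * (a j)%:Z + 2) by rewrite lj; apply: wge2M (reduced_diag rf jI) _.
  by apply: (wgeM_le (x_wge l) (wgeM h2 diag)); rewrite lj mE; move: (a j) => q; lia_goal.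
have [lk|kl] := ltnP l k.
  have off : wge (2 * '[f l, f j]) ((a l)%:Z + (a j)%:Z + 1) by apply: (reduced_off rf); rewrite ?mem_k.
  apply: (wge_sharpen (wgeM (x_wge l) (wgeM h2 off))) => z.
  by rewrite mE; move: (a j) (a l) => q r; lia_goal.
have al : (m < a l)%N by rewrite ltnNge -k_cut // -leqNgt.
have off : wge (2 * '[f l, f j]) ((a l)%:Z + (a j)%:Z).
  by apply: f_bounded.2; rewrite // mem_iota (leq_trans jk).
apply: (wge_sharpen (wgeM (x_int l) (wgeM h2 off))) => z.
by move: al; rewrite mE; move: (a j) (a l) => q r; lia_goal.
Qed.

Lemma linked_coord_gain (i : 'I_n) j : linked ps i j -> ~~ odd (a i + m) -> gains i.
Proof.
move=> ij parity; have jk : (j < k)%N.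
  by rewrite -mem_k; apply: (linked_indices ss); rewrite linkedC; apply: ij.
have jm : (a j <= m)%N by rewrite -k_cut // (leq_trans jk).
have f_ij := reduced_linked rf ij; have [z zE] := weq_even f_ij.
have [h mE] : exists h : nat, m = (a j + h.*2)%N.
  by exists ((m - a j)./2); move: (a i) (a j) parity zE jm => p q; lia_goal.
pose jn := Ordinal (leq_trans jk kn); have h2 := weq2X h.
have y_level : coord_level a m (2 ^+ h *: delta_mx jn 0).
  move=> l; rewrite !mxE andbT; case: (l =P jn) => [->|_]; last by rewrite mulr0 !wge0.
  by rewrite mulr1 !(wgeW (weq_wge h2)) //= mE; move: (a j); lia_goal.
have := x_radical y_level; rewrite qform_gram basis_comb_delta symZr linear_sumlz /=.
rewrite !mulr_sumr (eq_bigr (fun l : 'I_n => x l 0 * (2 ^+ h * (2 * '[f l, f j])))) => [x_j|l _]; last first.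
  by rewrite symZl; ring.
have hij := weqM h2 f_ij; rewrite -(mulfK (weq_neq0 hij) (x i 0)) (wge_divl _ _ hij).
apply: (wgeW (k := 2 * m%:Z + 2)); last by rewrite mE; move: (a j) (a i); lia_goal.
apply: wge_sum_isolate x_j _ => l li.
apply: wge_unlinked_term => //; apply: contra li => lj; apply/eqP/val_inj => /=.
exact: linked_inj (uniq_pair_indices (reduced_uniq rf)) lj ij.
Qed.

Lemma unpaired_coord_gain (i : 'I_n) : ((i : nat) \notin ss) || odd (a i + m) -> gains i.
Proof.
have [i_odd _|i_even] := boolP (odd (a i + m)).
  by apply: (wge_sharpen (x_wge i)); move: (a i) i_odd; lia_goal.
rewrite orbF => iss; have [ik|ki] := ltnP i k; last first.
  have ai : (m < a i)%N by rewrite ltnNge -k_cut // -leqNgt.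
  by apply: wgeW (x_int i) _; move: (a i) ai; lia_goal.
move: ik; rewrite -mem_k mem_cat (negPf iss) => /mem_pair_indices[j ij].
exact: linked_coord_gain ij i_even.
Qed.

Lemma coord_level_succ : coord_level a m.+1 x.
Proof.
move=> i; rewrite x_int /=; have [iss|iss] := boolP ((i : nat) \in ss); last first.
  by apply: unpaired_coord_gain; rewrite iss.
have [i_odd|i_even] := boolP (odd (a i + m)); first by apply: unpaired_coord_gain; rewrite i_odd orbT.
have others (l : 'I_n) : l != i -> gains l.
  move=> li; apply: unpaired_coord_gain; have [lss|//] := boolP ((l : nat) \in ss).
  by have := reduced_parity rf lss iss li; move: (a i) (a l) i_even; lia_goal.
pose R := \sum_(l < n | l != i) x l 0 *: f l.
have R_level : level f a (iota 0 n) m.+1%:Z R.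
  apply: (big_ind (level f a (iota 0 n) m.+1%:Z)) => [||l li]; [exact: lincomb0 | exact: levelD |].
  by apply: lincomb1 (others l li); apply: iota_ord.
have xi_level : level f a (iota 0 n) m%:Z (x i 0 *: f i) by apply: lincomb1.
have xE : basis_comb x = x i 0 *: f i + R by rewrite /basis_comb (bigD1 i).
have: wge (x i 0 * x i 0 * '[f i]) (2 * m%:Z + 2).
  have := x_norm; rewrite qform_gram xE symDD symZl symZr mulrA => hsum.
  rewrite -(addrK (2 * '[x i 0 *: f i, R] + '[R]) (x i 0 * x i 0 * '[f i])) addrA.
  apply: wgeB hsum (wgeD _ _).
    by apply: (wge_sharpen (level_form f_bounded xi_level R_level)); lia_goal.
  by apply: wgeW (level_norm f_bounded R_level) _; lia_goal.
have := reduced_single rf iss => f_i; have [->|x0] := eqVneq (x i 0) 0; first by rewrite wge0.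
have /weqP[f0 vf] := f_i; move=> /wgeP; rewrite !mulf_neq0 // !vM ?mulf_neq0 // => /(_ isT) vx.
by apply/wgeP => _; move: (v _) (v _) (a i) vf vx; lia_goal.
Qed.

End Degree.

Lemma gram_graded_nonsingular : bounded bt f a (iota 0 n) ->
  (forall m, exists k ps ss,
    [/\ (k <= n)%N, forall i, (i < n)%N -> (i < k)%N = (a i <= m)%N,
        perm_eq (indices ps ss) (iota 0 k) & reduced bt f a ps ss]) ->
  graded_nonsingular (gram bt f n) a.
Proof.
move=> f_bounded reductions m x x_level x_norm x_radical.
have [k [ps [ss [kn k_cut pI rf]]]] := reductions m.
exact: (coord_level_succ f_bounded kn k_cut pI rf x_level x_norm x_radical).
Qed.

End NonsingularReduction.

(** * Extending a reduced system by a vector *)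

Definition update (T : Type) (f : nat -> T) k x : nat -> T := fun l => if l == k then x else f l.

Lemma update_at T (f : nat -> T) k x : update f k x k = x.
Proof. by rewrite /update eqxx. Qed.

Lemma update_ne T (f : nat -> T) k x l : l != k -> update f k x l = f l.
Proof. by rewrite /update => /negPf->. Qed.

Section Extension.

Variables (V : lmodType F) (bt : {symmetric V}).
Local Notation "''[' x , y ]" := (bt x y) : ring_scope.
Local Notation "''[' x ]" := (bt x x) : ring_scope.
Implicit Types (f : nat -> V) (a : nat -> nat) (ps : seq (nat * nat)) (ss : seq nat).

Lemma reduced_update f a ps ss k x c : k \notin indices ps ss -> reduced bt f a ps ss ->
  reduced bt (update f k x) (update a k c) ps ss.
Proof.
by move=> kI; apply: eq_reduced => i iI; rewrite update_ne //; apply: contraNneq kI => <-.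
Qed.

Lemma reduced_drop_single f a ps ss i : reduced bt f a ps (i :: ss) -> reduced bt f a ps ss.
Proof.
move=> rf; have sub : {subset ss <= i :: ss} by move=> j jss; rewrite inE jss orbT.
have subI : {subset indices ps ss <= indices ps (i :: ss)} by move=> j jI; rewrite inE jI orbT.
split.
- by have /andP[] := reduced_uniq rf.
- by move=> j /subI; apply: (reduced_diag rf).
- exact: reduced_linked rf.
- by move=> j l /subI jI /subI lI; apply: (reduced_off rf).
- by move=> j /sub; apply: (reduced_single rf).
by move=> j l /sub jss /sub lss; apply: (reduced_parity rf).
Qed.

Lemma reduced_add_single f a ps ss k : reduced bt f a ps ss -> k \notin indices ps ss ->
  weq '[f k] (2 * (a k)%:Z) ->
  {in indices ps ss, forall l, wge (2 * '[f l, f k]) ((a l)%:Z + (a k)%:Z + 1)} ->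
  {in ss, forall l, odd (a l + a k)} -> reduced bt f a ps (k :: ss).
Proof.
move=> rf kI norm off parity; split.
- by rewrite /= kI; apply: reduced_uniq rf.
- move=> i; rewrite inE => /orP[/eqP->|]; [exact: weq_wge | exact: (reduced_diag rf)].
- exact: reduced_linked rf.
- move=> i j; rewrite !inE => /orP[/eqP->|iI] /orP[/eqP->|jI]; rewrite ?eqxx // => ij ij_off.
  + by rewrite symC [(a k)%:Z + _]addrC; apply: off.
  + exact: off.
  exact: (reduced_off rf).
- by move=> i; rewrite inE => /orP[/eqP->|] //; apply: (reduced_single rf).
move=> i j; rewrite !inE => /orP[/eqP->|iI] /orP[/eqP->|jI]; rewrite ?eqxx // => ij.
- by rewrite addnC; apply: parity.
- exact: parity.
exact: (reduced_parity rf).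
Qed.

Lemma reduced_add_plane f a ps ss i j : reduced bt f a ps ss ->
  i != j -> i \notin indices ps ss -> j \notin indices ps ss ->
  wge '[f i] (2 * (a i)%:Z) -> wge '[f j] (2 * (a j)%:Z) ->
  weq (2 * '[f i, f j]) ((a i)%:Z + (a j)%:Z) ->
  {in indices ps ss, forall l, wge (2 * '[f l, f i]) ((a l)%:Z + (a i)%:Z + 1)} ->
  {in indices ps ss, forall l, wge (2 * '[f l, f j]) ((a l)%:Z + (a j)%:Z + 1)} ->
  reduced bt f a ((i, j) :: ps) ss.
Proof.
move=> rf ij iI jI norm_i norm_j link off_i off_j; split.
- by rewrite uniq_indices_cons ij iI jI; apply: reduced_uniq rf.
- move=> l; rewrite mem_indices_cons => /or3P[/eqP->|/eqP->|] //; exact: (reduced_diag rf).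
- move=> l m; rewrite linked_cons !xpair_eqE => /or3P[/andP[/eqP-> /eqP->]|/andP[/eqP-> /eqP->]|] //.
    by rewrite symC addrC.
  exact: (reduced_linked rf).
- move=> l m; rewrite !mem_indices_cons => lI mI lm; rewrite linked_cons !xpair_eqE.
  case/or3P: lI lm => [/eqP->|/eqP->|lI]; case/or3P: mI => [/eqP->|/eqP->|mI];
    rewrite ?eqxx ?orbT // => lm lm_off.
  + by rewrite symC [(a i)%:Z + _]addrC; apply: off_i.
  + by rewrite symC [(a j)%:Z + _]addrC; apply: off_j.
  + exact: off_i.
  + exact: off_j.
  by apply: (reduced_off rf) => //; apply: contra lm_off => ->; rewrite !orbT.
- exact: (reduced_single rf).
exact: (reduced_parity rf).
Qed.

Lemma reduced_pair_single f a ps ss ss' i k : reduced bt f a ps ss -> perm_eq ss (i :: ss') ->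
  k \notin indices ps ss -> wge '[f k] (2 * (a k)%:Z) ->
  weq (2 * '[f i, f k]) ((a i)%:Z + (a k)%:Z) ->
  {in indices ps ss, forall l, l != i -> wge (2 * '[f l, f k]) ((a l)%:Z + (a k)%:Z + 1)} ->
  reduced bt f a ((i, k) :: ps) ss'.
Proof.
move=> rf ssE kI norm link off; have rf' := reduced_perm ssE rf.
have Im l : (l \in indices ps ss) = (l == i) || (l \in indices ps ss').
  by rewrite (perm_mem (perm_cat ssE (perm_refl (pair_indices ps)))) inE.
have iI' : i \notin indices ps ss' by have /andP[] := reduced_uniq rf'.
have [ki kI'] : k != i /\ k \notin indices ps ss' by apply/andP; rewrite -negb_or -Im.
have single l : l \in indices ps ss' -> l \in indices ps ss by rewrite Im => ->; rewrite orbT.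
have ne l : l \in indices ps ss' -> l != i by apply: contraTneq => ->.
apply: reduced_add_plane => //; first exact: reduced_drop_single rf'.
- by rewrite eq_sym.
- by apply: (reduced_diag rf); rewrite Im eqxx.
- move=> l lI; apply: (reduced_off rf); rewrite ?(single l lI) ?(ne l lI) ?Im ?eqxx //.
  by rewrite linkedC; apply: (single_not_linked _ (reduced_uniq rf')); rewrite inE eqxx.
by move=> l lI; apply: off; rewrite ?(single l lI) ?(ne l lI).
Qed.

Record single_projections f a ps ss (r : nat -> V) : Prop := {
  projection_level : {in ss, forall i, level f a (indices ps ss) (a i)%:Z (r i)};
  projection_pair : forall l i, l \in pair_indices ps -> i \in ss -> '[f l, r i] = 0;
  projection_single : {in ss &, forall j i, '[f j, r i] = '[r j, r i]};
  projection_norm : {in ss, forall i, weq '[r i] (2 * (a i)%:Z)};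
  projection_cross : {in ss &, forall i j, i != j ->
    wge (2 * '[r i, r j]) ((a i)%:Z + (a j)%:Z + 1)} }.

Lemma ex_single_projections f a ps ss : reduced bt f a ps ss ->
  exists r, single_projections f a ps ss r.
Proof.
move=> rf; have [r [close _ pair_orth]] := clear_pairs rf; exists r.
have sub : {subset pair_indices ps <= indices ps ss} by move=> i; apply: mem_indices_pair.
have ssI i : i \in ss -> i \in indices ps ss := @mem_indices_single ps ss i.
have rr : reduced bt r a ps ss.
  apply: (reduced_graded_eq (f := f)) => //; apply: (level_graded_eq_id (reduced_bounded rf)) => i iI.
  exact: levelW sub (lexx _) (close i iI).
split=> //.
- move=> i iss; rewrite -(subrK (f i) (r i)); apply: levelD (level_basis _ _ (ssI i iss)).
  by apply: levelW sub _ (close i (ssI i iss)); lia_goal.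
- move=> j i jss iss; apply/eqP; rewrite -subr_eq0 -opprB oppr_eq0 -linearBl; apply/eqP.
  by apply: lincomb_orth (close j (ssI j jss)) => l lps; apply: pair_orth.
- exact: reduced_single rr.
move=> i j iss jss ij; apply: (reduced_off rr); rewrite ?ssI //.
exact: single_not_linked (reduced_uniq rf) iss.
Qed.

(* The residue field is perfect, so the leading term of [x] is minus a square times that of [y]. *)
Lemma cancel_leading_term x y (A B : int) : wge x (2 * A) -> weq y (2 * B) -> ~~ odd `|A - B| ->
  exists s, [/\ wge s (A - B), wge (x + s ^+ 2 * y) (2 * A + 2) & weq x (2 * A) -> weq s (A - B)].
Proof.
move=> hx hy AB; have [h hE] : exists h : int, A - B = 2 * h.
  by exists ((A - B) %/ 2)%Z; clear -AB; lia.
have [t t0 vt] := ex_val h; have ht : weq t (A - B) by apply/weqP; rewrite t0 vt hE.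
have hyt := weqM hy (weqX 2 ht); pose q := x / (y * t ^+ 2).
have [|s s_int sq] := @residue_sqrt (- q); first by rewrite wgeN; apply: wge_div hx hyt _; lia_goal.
exists (s * t); split; first by apply: (wgeM_le s_int (weq_wge ht)); lia_goal.
  rewrite (_ : x + _ = (s ^+ 2 - - q) * (y * t ^+ 2)).
    by apply: (wgeM_le sq (weq_wge hyt)); lia_goal.
  by rewrite /q; field; rewrite t0 (weq_neq0 hy).
move=> hx'; have hq : weq q 0 by apply: (weq_eq (weqM hx' (weqV hyt))) => //; lia_goal.
have hs : weq s 0.
  apply: weq_sqr; rewrite mulr0 -(subrK (- q) (s ^+ 2)) addrC; apply: weqDl; first by rewrite weqN.
  exact: wgeW sq _.
by apply: (weq_eq (weqM hs ht)) => //; lia_goal.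
Qed.

Section NewVector.

Variables (f : nat -> V) (a : nat -> nat) (ps : seq (nat * nat)) (ss : seq nat) (k K : nat).
Hypothesis rf : reduced bt f a ps ss.
Hypotheses (kI : k \notin indices ps ss) (k1I : k.+1 \notin indices ps ss).

Definition orthogonal_vector e : Prop :=
  {in indices ps ss, forall l, '[f l, e] = 0} /\ weq '[e] (2 * K%:Z).

Variable e : V.
Hypothesis e_new : orthogonal_vector e.

Definition new_vector c ps' ss' : Prop :=
  exists2 y, level f a (indices ps ss) K%:Z y &
    reduced bt (update f k (e + y)) (update a k c) ps' ss'.

Definition new_plane e' : Prop :=
  exists y y', [/\ level f a (indices ps ss) K%:Z y, level f a (indices ps ss) K%:Z y' &
    reduced bt (update (update f k (e + y)) k.+1 (e' + y'))
      (update (update a k K.+1) k.+1 K.+1) ((k, k.+1) :: ps) ss].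

Lemma update_add_single x c : weq '[x] (2 * c%:Z) ->
  {in indices ps ss, forall l, wge (2 * '[f l, x]) ((a l)%:Z + c%:Z + 1)} ->
  {in ss, forall l, odd (a l + c)} -> reduced bt (update f k x) (update a k c) ps (k :: ss).
Proof.
move=> norm off parity; have ne l : l \in indices ps ss -> l != k by apply: contraTneq => ->.
apply: reduced_add_single => //; first exact: reduced_update.
- by rewrite !update_at.
- by move=> l lI; rewrite !update_at !update_ne ?ne //; apply: off.
by move=> l lss; rewrite update_at update_ne ?parity // ne // mem_indices_single.
Qed.

Lemma update_pair_single i ss' x c : perm_eq ss (i :: ss') -> wge '[x] (2 * c%:Z) ->
  weq (2 * '[f i, x]) ((a i)%:Z + c%:Z) ->
  {in indices ps ss, forall l, l != i -> wge (2 * '[f l, x]) ((a l)%:Z + c%:Z + 1)} ->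
  reduced bt (update f k x) (update a k c) ((i, k) :: ps) ss'.
Proof.
move=> ssE norm link off; have ne l : l \in indices ps ss -> l != k by apply: contraTneq => ->.
have iI : i \in indices ps ss by apply: mem_indices_single; rewrite (perm_mem ssE) inE eqxx.
apply: (reduced_pair_single (reduced_update _ _ kI rf) ssE kI).
- by rewrite !update_at.
- by rewrite !update_at !update_ne ?ne.
by move=> l lI li; rewrite !update_at !update_ne ?ne //; apply: off.
Qed.

Lemma update_add_plane x x' c : wge '[x] (2 * c%:Z) -> wge '[x'] (2 * c%:Z) ->
  weq (2 * '[x, x']) (c%:Z + c%:Z) ->
  {in indices ps ss, forall l, wge (2 * '[f l, x]) ((a l)%:Z + c%:Z + 1)} ->
  {in indices ps ss, forall l, wge (2 * '[f l, x']) ((a l)%:Z + c%:Z + 1)} ->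
  reduced bt (update (update f k x) k.+1 x') (update (update a k c) k.+1 c) ((k, k.+1) :: ps) ss.
Proof.
move=> norm norm' link off off'; have kk : k != k.+1 by rewrite neq_ltn ltnSn.
have ne l : l \in indices ps ss -> l != k by apply: contraTneq => ->.
have ne' l : l \in indices ps ss -> l != k.+1 by apply: contraTneq => ->.
apply: reduced_add_plane => //; first by do 2!apply: reduced_update => //.
- by rewrite !(update_at, update_ne _ _ kk).
- by rewrite !(update_at, update_ne _ _ kk).
- by rewrite !(update_at, update_ne _ _ kk).
- by move=> l lI; rewrite !(update_at, update_ne _ _ kk) !update_ne ?ne ?ne' //; apply: off.
by move=> l lI; rewrite !update_at !update_ne ?ne ?ne' //; apply: off'.
Qed.

Lemma new_vector_single : {in ss, forall l, odd (a l + K)} -> new_vector K ps (k :: ss).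
Proof.
move=> parity; have [orth norm] := e_new; exists 0; first exact: lincomb0.
by rewrite addr0; apply: update_add_single => // l lI; rewrite orth // mulr0 wge0.
Qed.

Section Projections.

Variable r : nat -> V.
Hypothesis fr : single_projections f a ps ss r.

Lemma form_projection l i : l \in indices ps ss -> i \in ss ->
  '[f l, r i] = if l \in ss then '[r l, r i] else 0.
Proof.
move=> + iss; rewrite mem_cat; case: ifP => [lss _|_ /= lps].
  exact: (projection_single fr).
exact: (projection_pair fr).
Qed.

Lemma orth_projection z i : orthogonal_vector z -> i \in ss -> '[z, r i] = 0.
Proof.
by move=> [orth _] iss; rewrite symC; apply: lincomb_orth (projection_level fr iss).
Qed.

Lemma form_corrected z i s l : orthogonal_vector z -> i \in ss -> l \in indices ps ss ->
  2 * '[f l, z + s *: r i] = if l \in ss then s * (2 * '[r l, r i]) else 0.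
Proof.
move=> [orth _] iss lI; rewrite linearDr /= symZr orth // add0r form_projection //.
by case: ifP => _; ring.
Qed.

Lemma level_correction i s : i \in ss -> wge s (K%:Z - (a i)%:Z) ->
  level f a (indices ps ss) K%:Z (s *: r i).
Proof. by move=> iss hs; apply: levelZ hs _ (projection_level fr iss); lia_goal. Qed.

Lemma norm_corrected z i s : orthogonal_vector z -> i \in ss ->
  '[z + s *: r i] = '[z] + s ^+ 2 * '[r i].
Proof. by move=> hz iss; rewrite symDD !(symZl, symZr) orth_projection //; ring. Qed.

Lemma ex_correction z i : orthogonal_vector z -> i \in ss -> ~~ odd (a i + K) ->
  exists2 s, weq s (K%:Z - (a i)%:Z) & wge '[z + s *: r i] (2 * K.+1%:Z).
Proof.
move=> hz iss parity; have [_ norm] := hz.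
have [|s [_ hnorm hs]] := cancel_leading_term (weq_wge norm) (projection_norm fr iss).
  by move: (a i) parity; lia_goal.
exists s; first exact: hs.
by rewrite norm_corrected //; apply: wgeW hnorm _; lia_goal.
Qed.

Lemma form_corrected_self z i s : orthogonal_vector z -> i \in ss -> weq s (K%:Z - (a i)%:Z) ->
  weq (2 * '[f i, z + s *: r i]) ((a i)%:Z + K.+2%:Z).
Proof.
move=> hz iss hs; rewrite form_corrected ?mem_indices_single // iss.
by apply: (weq_eq (weqM hs (weqM weq2 (projection_norm fr iss)))) => //; lia_goal.
Qed.

Lemma new_vector_odd i : ss = [:: i] -> ~~ odd (a i + K) ->
  new_vector K.+2 ((i, k) :: ps) [::] \/ new_vector K.+1 ps [:: k; i].
Proof.
move=> ssE parity; have iss : i \in ss by rewrite ssE inE.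
have [s hs hnorm] := ex_correction e_new iss parity.
have y_level := level_correction iss (weq_wge hs).
have link := form_corrected_self e_new iss hs.
have off l : l \in indices ps ss -> l != i -> '[f l, e + s *: r i] = 0.
  move=> lI li; apply: (mulfI two_neq0).
  by rewrite form_corrected // ssE inE (negPf li) mulr0.
have [big|small] := boolP (wge '[e + s *: r i] (2 * K.+2%:Z)).
  left; exists (s *: r i) => //; apply: update_pair_single => //; first by rewrite ssE.
  by move=> l lI li; rewrite off // mulr0 wge0.
right; exists (s *: r i) => //; rewrite -ssE; apply: update_add_single.
- by apply: wge_weq hnorm _; apply: contra small => small; apply: wgeW small _; lia_goal.
- move=> l lI; have [->|li] := eqVneq l i; last by rewrite off // mulr0 wge0.
  by apply: wgeW (weq_wge link) _; lia_goal.
by move=> l; rewrite ssE inE => /eqP->; move: (a i) parity; lia_goal.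
Qed.

Lemma new_plane_single e' i : orthogonal_vector e' -> '[e, e'] = 0 -> i \in ss ->
  ~~ odd (a i + K) ->
  {in ss, forall j, j != i -> wge (2 * '[r j, r i]) ((a i)%:Z + (a j)%:Z + 3)} -> new_plane e'.
Proof.
move=> e'_new ee' iss parity cross.
have [s hs hnorm] := ex_correction e_new iss parity.
have [s' hs' hnorm'] := ex_correction e'_new iss parity.
exists (s *: r i), (s' *: r i); split; try exact: level_correction (weq_wge _).
have off z c : orthogonal_vector z -> weq c (K%:Z - (a i)%:Z) ->
    {in indices ps ss, forall l, wge (2 * '[f l, z + c *: r i]) ((a l)%:Z + K.+1%:Z + 1)}.
  move=> hz hc l lI; have [->|li] := eqVneq l i.
    by apply: wgeW (weq_wge (form_corrected_self hz iss hc)) _; lia_goal.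
  rewrite form_corrected //; case: ifP => [lss|_]; last exact: wge0.
  by apply: (wgeM_le (weq_wge hc) (cross l lss li)); lia_goal.
apply: update_add_plane => //; [| exact: off | exact: off].
rewrite symDl !linearDr /= !(symZl, symZr) ee' [bt (r i) e']symC.
rewrite (orth_projection e_new iss) (orth_projection e'_new iss).
rewrite (_ : 2 * _ = 2 * (s * s' * '[r i])); last by ring.
by apply: (weq_eq (weqM weq2 (weqM (weqM hs hs') (projection_norm fr iss)))) => //; lia_goal.
Qed.

Section TwoSingles.

Variables i j : nat.
Hypotheses (ssE : perm_eq ss [:: i; j]) (i_even : ~~ odd (a i + K)).

Let ss_mem l : (l \in ss) = (l == i) || (l == j).
Proof. by rewrite (perm_mem ssE) !inE. Qed.

Let iss : i \in ss. Proof. by rewrite ss_mem eqxx. Qed.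
Let jss : j \in ss. Proof. by rewrite ss_mem eqxx orbT. Qed.

Let ij : i != j.
Proof.
have := reduced_uniq rf; rewrite cat_uniq (perm_uniq ssE) /= inE andbT.
by case/andP.
Qed.

Let ij_odd : odd (a i + a j). Proof. exact: (reduced_parity rf). Qed.

Lemma new_vector_coupled : ~~ wge (2 * '[r i, r j]) ((a i)%:Z + (a j)%:Z + 3) ->
  new_vector K.+1 ((j, k) :: ps) [:: i].
Proof.
move=> small; have [s hs hnorm] := ex_correction e_new iss i_even.
have cross : weq (2 * '[r i, r j]) ((a i)%:Z + (a j)%:Z + 1).
  have [z zE] : exists z : int, (a i)%:Z + (a j)%:Z + 1 = 2 * z.
    exists (((a i)%:Z + (a j)%:Z + 1) %/ 2)%Z.
    by move: (a i) (a j) ij_odd; lia_goal.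
  rewrite zE; apply: wge_weq; first by rewrite -zE; apply: (projection_cross fr).
  by apply: contra small => small; apply: wgeW small _; move: zE; lia_goal.
exists (s *: r i); first exact: level_correction (weq_wge hs).
apply: update_pair_single hnorm _ _.
- by apply: perm_trans ssE _; apply/permPl; apply: (perm_catC [:: i]).
- rewrite form_corrected ?mem_indices_single // jss symC.
  by apply: (weq_eq (weqM hs cross)) => //; lia_goal.
move=> l lI lj; have [->|li] := eqVneq l i.
  by apply: wgeW (weq_wge (form_corrected_self e_new iss hs)) _; lia_goal.
by rewrite form_corrected // ss_mem (negPf li) (negPf lj) wge0.
Qed.

Lemma new_vector_uncoupled : wge (2 * '[r i, r j]) ((a i)%:Z + (a j)%:Z + 3) ->
  new_vector K.+2 ((i, k) :: ps) [:: j].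
Proof.
move=> cross; have [s hs hnorm] := ex_correction e_new iss i_even.
have [|s' [hs' hnorm' _]] := cancel_leading_term hnorm (projection_norm fr jss).
  by move: (a i) (a j) i_even ij_odd; lia_goal.
exists (s *: r i + s' *: r j).
  apply: levelD; first exact: level_correction (weq_wge hs).
  by apply: level_correction => //; apply: wgeW hs' _; lia_goal.
have formE l : l \in indices ps ss -> 2 * '[f l, e + (s *: r i + s' *: r j)] =
    2 * '[f l, e + s *: r i] + if l \in ss then s' * (2 * '[r l, r j]) else 0.
  move=> lI; rewrite addrA linearDr /= mulrDr symZr form_projection //.
  by case: ifP => _; ring.
apply: update_pair_single => //.
- rewrite addrA symDD symZr (_ : _ + _ = '[e + s *: r i] + s' ^+ 2 * '[r j] + s' * s * (2 * '[r i, r j])).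
    apply: wgeD; first by apply: wgeW hnorm' _; lia_goal.
    by apply: (wgeM_le (wgeM hs' (weq_wge hs)) cross); lia_goal.
  have -> : '[e + s *: r i, r j] = s * '[r i, r j].
    by rewrite symDl symZl (orth_projection e_new jss) add0r.
  by rewrite symZl symZr; ring.
- rewrite formE ?mem_indices_single // iss; apply: weqDl (form_corrected_self e_new iss hs) _.
  by apply: (wgeM_le hs' cross); lia_goal.
move=> l lI li; rewrite formE // form_corrected // ss_mem (negPf li) /=.
have [->|_] := eqVneq l j; last by rewrite addr0 wge0.
apply: wgeD; first by rewrite symC; apply: (wgeM_le (weq_wge hs) cross); lia_goal.
by apply: (wgeM_le hs' (weq_wge (weqM weq2 (projection_norm fr jss)))); lia_goal.
Qed.

Lemma new_plane_uncoupled e' : orthogonal_vector e' -> '[e, e'] = 0 ->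
  wge (2 * '[r i, r j]) ((a i)%:Z + (a j)%:Z + 3) -> new_plane e'.
Proof.
move=> e'_new ee' cross; apply: (new_plane_single e'_new ee' iss i_even) => l.
by rewrite ss_mem => /orP[/eqP->|/eqP-> _]; rewrite ?eqxx // symC.
Qed.

End TwoSingles.
End Projections.
End NewVector.
End Extension.

(** * Pre-optimal forms *)

Section Blocks.

Implicit Types (b : blk F) (s : seq (nat * blk F)).

Lemma degs_cat s1 s2 : degs (s1 ++ s2) = (degs s1 + degs s2)%N.
Proof. by rewrite /degs map_cat sumn_cat. Qed.

Lemma blk_entryC b i j : blk_entry b i j = blk_entry b j i.
Proof.
case: b => [s|x y z] /=; first by rewrite eq_sym; case: eqP => // ->.
by case: i j => [|[|i]] [|[|j]].
Qed.

Lemma entC s i j : ent s i j = ent s j i.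
Proof.
elim: s i j => [|[k b] s IHs] i j //=.
by rewrite [(j < _)%N && _]andbC [(_ <= j)%N && _]andbC blk_entryC IHs.
Qed.

Lemma ent_catl s1 s2 i j : (i < degs s1)%N -> (j < degs s1)%N -> ent (s1 ++ s2) i j = ent s1 i j.
Proof.
elim: s1 i j => [|[k b] s1 IHs1] i j //=; rewrite /degs /= -/(degs s1) => hi hj.
by case: ifP => // _; case: ifP => // /andP[bi bj]; apply: IHs1; rewrite ltn_subLR.
Qed.

Lemma ent_catr s1 s2 i j : ent (s1 ++ s2) (degs s1 + i) (degs s1 + j) = ent s2 i j.
Proof.
elim: s1 i j => [|[k b] s1 IHs1] i j //=; rewrite /degs /= -/(degs s1).
by rewrite -!addnA !ltnNge !leq_addr /= !addKn.
Qed.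

Lemma ent_cat_offdiag s1 s2 i j : (i < degs s1)%N -> (degs s1 <= j)%N -> ent (s1 ++ s2) i j = 0.
Proof.
elim: s1 i j => [|[k b] s1 IHs1] i j //=; rewrite /degs /= -/(degs s1) => hi hj.
have bj : (deg b <= j)%N := leq_trans (leq_addr _ _) hj.
rewrite [(j < _)%N]ltnNge bj andbF /=; case: ifP => // /andP[bi _].
by apply: IHs1; [rewrite ltn_subLR | rewrite leq_subRL].
Qed.

Lemma assemble_sym s : (assemble s)^T = assemble s.
Proof. by apply/matrixP => i j; rewrite !mxE entC. Qed.

End Blocks.

Section AssembledForm.

Variable bl : seq (nat * blk F).
Let default_block : nat * blk F := (0%N, BD [::]).
Local Notation offset t := (degs (take t bl)).
Local Notation n := (degs bl).
Local Notation bt := (symmx_form (assemble_sym bl)).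
Local Notation "''[' x , y ]" := (bt x y) : ring_scope.
Local Notation "''[' x ]" := (bt x x) : ring_scope.

Lemma offset_succ t : (t < size bl)%N -> offset t.+1 = (offset t + deg (Cb bl t.+1))%N.
Proof. by move=> ht; rewrite (take_nth default_block ht) -cats1 degs_cat /= /degs /= addn0. Qed.

Lemma offset_le t : (offset t <= n)%N.
Proof. by rewrite -{2}(cat_take_drop t bl) degs_cat leq_addr. Qed.

Lemma ent_take t i j : (i < offset t)%N -> (j < offset t)%N -> ent (take t bl) i j = ent bl i j.
Proof. by move=> hi hj; rewrite -{2}(cat_take_drop t bl) ent_catl. Qed.

Lemma ent_block t x y : (t < size bl)%N -> (x < deg (Cb bl t.+1))%N -> (y < deg (Cb bl t.+1))%N ->
  ent bl (offset t + x) (offset t + y) = 2 ^+ kb bl t.+1 * blk_entry (Cb bl t.+1) x y.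
Proof.
move=> ht; rewrite /Cb /kb /= -/default_block => hx hy.
rewrite -{1}(cat_take_drop t bl) ent_catr (drop_nth default_block ht).
by case: (nth default_block bl t) hx hy => k b /= -> ->.
Qed.

Definition unit_vec (j : nat) : 'cV[F]_n := \col_i (i == j :> nat)%:R.

Lemma form_unit_vec i j : (i < n)%N -> (j < n)%N -> '[unit_vec i, unit_vec j] = ent bl i j.
Proof.
move=> iN jN; have colE (l : 'I_n) : unit_vec l = col l 1%:M by apply/colP => x; rewrite !mxE.
rewrite (colE (Ordinal iN)) (colE (Ordinal jN)) symmx_formE qform_col.
by rewrite trmx1 mul1mx mulmx1 mxE.
Qed.

Lemma unit_vec_orth t i j : (i < offset t)%N -> (offset t <= j)%N -> '[unit_vec i, unit_vec j] = 0.
Proof.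
move=> hi hj; have [jN|nj] := ltnP j n.
  rewrite form_unit_vec ?(leq_trans hi) ?offset_le //.
  by rewrite -(cat_take_drop t bl) ent_cat_offdiag.
have -> : unit_vec j = 0 by apply/colP => x; rewrite !mxE (ltn_eqF (leq_trans (ltn_ord x) nj)).
exact: linear0r.
Qed.

Lemma Bpre_gram t : Bpre bl t = gram bt unit_vec (offset t).
Proof.
apply/matrixP => i j; rewrite !mxE ent_take // -form_unit_vec //.
  exact: leq_trans (ltn_ord i) (offset_le t).
exact: leq_trans (ltn_ord j) (offset_le t).
Qed.

Section BlockNorms.

Hypothesis blocks_ok : all (fun p => blk_ok v p.2) bl.

Lemma block_ok t : (t < size bl)%N -> blk_ok v (Cb bl t.+1).
Proof. by move=> ht; have /(all_nthP default_block)/(_ t ht) := blocks_ok. Qed.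

Lemma deg_gt0 t : (t < size bl)%N -> (0 < deg (Cb bl t.+1))%N.
Proof. by move=> /block_ok; case: (Cb bl t.+1) => //= s /andP[]. Qed.

Lemma diag_block_norm t x : (t < size bl)%N -> isD (Cb bl t.+1) -> (x < deg (Cb bl t.+1))%N ->
  weq '[unit_vec (offset t + x)] (2 * (kb bl t.+1)%:Z).
Proof.
move=> ht diag hx; have xN : (offset t + x < n)%N.
  by apply: leq_trans (offset_le t.+1); rewrite offset_succ // ltn_add2l.
rewrite form_unit_vec // ent_block //; have := block_ok ht.
case: (Cb bl t.+1) diag hx => //= s _ hx /andP[_ /allP units]; rewrite eqxx.
have := units _ (mem_nth 0 hx); rewrite unit_oE => hs.
by apply: (weq_eq (weqM (weq2X _) hs)) => //; lia_goal.
Qed.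

Lemma diag_block_orth t : (t < size bl)%N -> isD (Cb bl t.+1) -> deg (Cb bl t.+1) = 2%N ->
  '[unit_vec (offset t), unit_vec (offset t).+1] = 0.
Proof.
move=> ht diag d2; have kn : ((offset t).+1 < n)%N.
  by apply: leq_trans (offset_le t.+1); rewrite offset_succ // d2 addn2.
rewrite form_unit_vec ?(ltnW kn) // -{1}[offset t]addn0 -addn1 ent_block ?d2 //.
by case: (Cb bl t.+1) diag => //= s _; rewrite mulr0.
Qed.

Lemma even_block_plane t : (t < size bl)%N -> ~~ isD (Cb bl t.+1) ->
  [/\ offset t.+1 = (offset t).+2, wge '[unit_vec (offset t)] (2 * (kb bl t.+1)%:Z),
      wge '[unit_vec (offset t).+1] (2 * (kb bl t.+1)%:Z) &
      weq (2 * '[unit_vec (offset t), unit_vec (offset t).+1]) ((kb bl t.+1)%:Z + (kb bl t.+1)%:Z)].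
Proof.
move=> ht even; have d2 : deg (Cb bl t.+1) = 2%N by case: (Cb bl t.+1) even.
have offE : offset t.+1 = (offset t).+2 by rewrite offset_succ // d2 addn2.
have kn : ((offset t).+1 < n)%N by rewrite -offE offset_le.
have entE x y : (x < 2)%N -> (y < 2)%N -> ent bl (offset t + x) (offset t + y) =
    2 ^+ kb bl t.+1 * blk_entry (Cb bl t.+1) x y by move=> hx hy; apply: ent_block; rewrite ?d2.
have := entE 0%N 0%N isT isT; have := entE 1%N 1%N isT isT; have := entE 0%N 1%N isT isT.
rewrite addn0 addn1 !form_unit_vec ?(ltnW kn) // => -> -> ->.
have := block_ok ht; case: (Cb bl t.+1) even => //= x y z _.
rewrite integralE unit_oE !vgeE !mulr1 -[wge (2 * x) 2]/(wge (2 * x) (0 + 2)).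
rewrite -[wge (2 * z) 2]/(wge (2 * z) (0 + 2)) !wge_mul2 => /and4P[hx hz hy hd].
have hk := weq2X (kb bl t.+1); have hk' := weq_wge hk.
split=> //; [by apply: (wgeM_le hk' hx); lia_goal | by apply: (wgeM_le hk' hz); lia_goal |].
have hy' : weq (2 * y) 0.
  apply: weq_sqr; rewrite mulr0 (_ : _ ^+ 2 = - (2 * x * (2 * z) - (2 * y) ^+ 2) + 4 * (x * z)); last by ring.
  by apply: weqDl; [rewrite weqN | apply: (wge4M (wgeM hx hz)); lia_goal].
rewrite mulrCA; apply: (weq_eq (weqM hk hy')) => //; lia_goal.
Qed.

End BlockNorms.
End AssembledForm.

Lemma det_gram_last (V : lmodType F) (bt : {symmetric V}) (f : nat -> V) k :
  (forall l, (l < k)%N -> bt (f l) (f k) = 0) ->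
  \det (gram bt f k.+1) = bt (f k) (f k) * \det (gram bt f k).
Proof.
move=> orth; rewrite (expand_det_row _ ord_max) (bigD1 ord_max) //= big1 ?addr0 => [|j jm].
  rewrite mxE /cofactor /= addnn -signr_odd odd_double expr0 mul1r; congr (_ * \det _).
  by apply/matrixP => i j; rewrite !mxE !lift_max.
rewrite mxE symC orth ?mul0r //=; have := ltn_ord j; rewrite ltnS leq_eqVlt => /orP[/eqP jk|//].
by move/eqP: jm; case; apply: val_inj.
Qed.

Section Stages.

Variable bl : seq (nat * blk F).
Local Notation offset t := (degs (take t bl)).
Local Notation n := (degs bl).
Local Notation e := (unit_vec bl).
Local Notation bt := (symmx_form (assemble_sym bl)).
Local Notation "''[' x , y ]" := (bt x y) : ring_scope.
Local Notation "''[' x ]" := (bt x x) : ring_scope.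
Implicit Types (f : nat -> 'cV[F]_n) (a : nat -> nat) (ps : seq (nat * nat)) (ss : seq nat).

Definition integral_comb k : 'cV[F]_n -> Prop := lincomb e (iota 0 k) (fun _ c => wge c 0).

Lemma integral_combW i j x : (i <= j)%N -> integral_comb i x -> integral_comb j x.
Proof. by move=> ij; apply: lincomb_sub => // m; rewrite !mem_iota /= => /leq_trans->. Qed.

Lemma integral_comb_unit l k : (l < k)%N -> integral_comb k (e l).
Proof. by move=> lk; rewrite -[e l]scale1r; apply: lincomb1; rewrite ?mem_iota //; apply: wge1. Qed.

Definition unitriangular k f : Prop := forall l, (l < k)%N -> integral_comb l (f l - e l).

Lemma unitriangular_integral k f l : unitriangular k f -> (l < k)%N -> integral_comb k (f l).
Proof.
move=> tri lk; rewrite -(subrK (e l) (f l)); apply: lincombD; last exact: integral_comb_unit.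
by apply: integral_combW (tri l lk); apply: ltnW.
Qed.

Lemma unitriangular_update k f y : unitriangular k f -> integral_comb k y ->
  unitriangular k.+1 (update f k (e k + y)).
Proof.
move=> tri hy l; rewrite ltnS leq_eqVlt => /orP[/eqP->|lk].
  by rewrite update_at addrAC subrr add0r.
by rewrite update_ne ?ltn_eqF //; apply: tri.
Qed.

Lemma unitriangular_orth t f l q : unitriangular (offset t) f ->
  (l < offset t)%N -> (offset t <= q)%N -> '[f l, e q] = 0.
Proof.
move=> tri hl hq; apply: lincomb_orth (unitriangular_integral tri hl) => m.
by rewrite mem_iota => hm; apply: unit_vec_orth hm hq.
Qed.

Lemma Bpre_congruent t f : unitriangular (offset t) f ->
  congruent (Bpre bl t) (gram bt f (offset t)).
Proof.
move=> tri; rewrite Bpre_gram; apply: gram_congruent (perm_refl _) _ => l.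
by rewrite mem_iota => lt; apply: (lincomb_spanned _ (unitriangular_integral tri lt)).
Qed.

Definition exponents_le k a (M : nat) : Prop := forall l, (l < k)%N -> (a l <= M)%N.

Lemma exponents_leW k a M M' : (M <= M')%N -> exponents_le k a M -> exponents_le k a M'.
Proof. by move=> MM' aM l lk; apply: leq_trans (aM l lk) MM'. Qed.

Lemma exponents_le_update k a c M : exponents_le k a M -> (c <= M)%N ->
  exponents_le k.+1 (update a k c) M.
Proof.
move=> aM cM l; rewrite ltnS leq_eqVlt => /orP[/eqP->|lk]; first by rewrite update_at.
by rewrite update_ne ?ltn_eqF ?aM.
Qed.

Lemma level_integral k f a K ps ss y : unitriangular k f -> perm_eq (indices ps ss) (iota 0 k) ->
  exponents_le k a K.+1 -> level f a (indices ps ss) K%:Z y -> integral_comb k y.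
Proof.
move=> tri pI aK; elim: y / => [|y m c _ IHy mI hc]; first exact: lincomb0.
have mk : (m < k)%N by move: mI; rewrite (perm_mem pI) mem_iota.
have c_int : wge c 0 by apply: (wge_sharpen hc); have := aK m mk; move: (a m); lia_goal.
apply: lincombD => //; apply: lincombZ (unitriangular_integral tri mk) => l d hd.
by apply: (wgeM_le c_int hd).
Qed.

Definition boundary_reduced f a c : Prop := exists t ps ss,
  [/\ (t <= size bl)%N, offset t = c, perm_eq (indices ps ss) (iota 0 c) & reduced bt f a ps ss].

Record triangular k f a : Prop := {
  triangular_unit : unitriangular k f;
  triangular_mono : forall i j, (i <= j < k)%N -> (a i <= a j)%N;
  triangular_jump : forall c, (0 < c < k)%N -> (a c.-1 < a c)%N -> boundary_reduced f a c }.

Lemma boundary_reduced_update k f a x d c : (c <= k)%N -> boundary_reduced f a c ->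
  boundary_reduced (update f k x) (update a k d) c.
Proof.
move=> ck [t [ps [ss [ht tc pI rf]]]]; exists t, ps, ss; split=> //.
by apply: reduced_update rf; rewrite (perm_mem pI) mem_iota -leqNgt.
Qed.

Lemma triangular_update k f a y c : triangular k f a -> integral_comb k y -> exponents_le k a c ->
  ((0 < k)%N -> (a k.-1 < c)%N -> boundary_reduced f a k) ->
  triangular k.+1 (update f k (e k + y)) (update a k c).
Proof.
move=> [tri mono jump] hy ac top; split; first exact: unitriangular_update.
  move=> i j /andP[ij]; rewrite ltnS leq_eqVlt => /orP[/eqP jk|jk]; last first.
    by rewrite !update_ne ?ltn_eqF ?(leq_ltn_trans ij) //; apply: mono; rewrite ij.
  rewrite jk update_at; move: ij; rewrite jk leq_eqVlt => /orP[/eqP->|ik].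
    by rewrite update_at.
  by rewrite update_ne ?ltn_eqF ?ac.
move=> l /andP[l0 lk]; have l1k : (l.-1 < k)%N by rewrite -ltnS prednK.
rewrite [update a k c l.-1]update_ne ?ltn_eqF //.
move: lk; rewrite ltnS leq_eqVlt => /orP[/eqP lk|lk].
  by rewrite lk update_at => lt; apply: boundary_reduced_update => //; apply: top => //; rewrite -lk.
rewrite update_ne ?ltn_eqF // => lt; apply: boundary_reduced_update (ltnW lk) (jump l _ lt).
by rewrite l0.
Qed.

Record stage t f a ps ss : Prop := {
  stage_triangular : triangular (offset t) f a;
  stage_indices : perm_eq (indices ps ss) (iota 0 (offset t));
  stage_reduced : reduced bt f a ps ss }.

Lemma stage_boundary t f a ps ss : (t <= size bl)%N -> stage t f a ps ss ->
  boundary_reduced f a (offset t).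
Proof. by move=> ht [_ pI rf]; exists t, ps, ss. Qed.

Lemma stage_invariants t f a ps ss : stage t f a ps ss ->
  match ss with
  | [::] => [/\ ~~ odd (offset t), xi v (Bpre bl t) != 0 & ~~ ord_det_odd v (Bpre bl t)]
  | [:: s] => odd (offset t) /\ ord_det_odd v (Bpre bl t) = odd (a s)
  | _ => ~~ odd (offset t) /\ xi v (Bpre bl t) = 0
  end.
Proof.
by move=> [[tri _ _] pI rf]; apply: (reduced_invariants rf (Bpre_congruent tri) pI).
Qed.

Lemma ord_det_odd_succ t f a ps ss K : stage t f a ps ss -> offset t.+1 = (offset t).+1 ->
  weq '[e (offset t)] (2 * K%:Z) ->
  ord_det_odd v (Bpre bl t.+1) = ord_det_odd v (Bpre bl t) (+) odd K.
Proof.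
move=> [[tri _ _] pI rf] offE /weqP[e0 ve].
have B0 := reduced_det_neq0 rf (Bpre_congruent tri) pI.
rewrite /ord_det_odd [Bpre bl t.+1]Bpre_gram offE det_gram_last => [|l lt]; last first.
  exact: (unit_vec_orth (t := t)).
rewrite -Bpre_gram odd_valM // addbC; congr (_ (+) _).
by move: (v _) ve => x; lia_goal.
Qed.

End Stages.

Lemma same_parity_singles (V : lmodType F) (bt : {symmetric V}) f a ps ss K :
  reduced bt f a ps ss -> {in ss, forall s, odd (a s + K)} -> (size ss <= 1)%N.
Proof.
move=> rf ss_odd; have := reduced_uniq rf; rewrite cat_uniq => /andP[+ _].
case: ss rf ss_odd => [|s [|s' ss]] //= rf ss_odd /andP[]; rewrite inE negb_or => /andP[ss' _] _.
have : odd (a s + a s') by apply: (reduced_parity rf); rewrite ?inE ?eqxx ?orbT.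
have [] : odd (a s + K) /\ odd (a s' + K) by split; apply: ss_odd; rewrite !inE eqxx ?orbT.
by rewrite !oddD; case: (odd (a s)); case: (odd (a s')); case: (odd K).
Qed.

Section PreOptimal.

Variable bl : seq (nat * blk F).
Hypothesis blocks_ok : all (fun p => blk_ok v p.2) bl.
Hypothesis bl_preopt : pre_optimal v bl.
Local Notation offset t := (degs (take t bl)).
Local Notation n := (degs bl).
Local Notation e := (unit_vec bl).
Local Notation bt := (symmx_form (assemble_sym bl)).
Local Notation "''[' x , y ]" := (bt x y) : ring_scope.
Local Notation "''[' x ]" := (bt x x) : ring_scope.

Definition next_same_scale t : Prop :=
  [/\ (t < size bl)%N, isD (Cb bl t.+1) & kb bl t.+1 = kb bl t].

Lemma diag_degs_le2 js K : uniq js ->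
  {in js, forall j, [/\ (1 <= j <= size bl)%N, kb bl j = K & isD (Cb bl j)]} ->
  (\sum_(j <- js) deg (Cb bl j) <= 2)%N.
Proof.
move=> js_uniq js_diag; have [PO1 _] := bl_preopt; apply: leq_trans (PO1 K).
rewrite -[leqRHS]big_filter; set s := filter _ _.
have s_uniq : uniq s by rewrite filter_uniq // iota_uniq.
have sub : {subset js <= s}.
  by move=> j /js_diag[j_range jK jD]; rewrite mem_filter jK eqxx jD mem_index_iota ltnS.
have sE : perm_eq s (js ++ filter [predC js] s).
  apply: uniq_perm => //; first rewrite cat_uniq js_uniq filter_uniq // andbT.
    by apply/hasPn => j; rewrite mem_filter => /andP[].
  by move=> j; rewrite mem_cat mem_filter /=; case: (boolP (j \in js)) => [/sub|].
by rewrite (perm_big _ sE) big_cat leq_addr.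
Qed.

Lemma diag_deg_le2 t : (t < size bl)%N -> isD (Cb bl t.+1) -> (deg (Cb bl t.+1) <= 2)%N.
Proof.
move=> ht diag; have := @diag_degs_le2 [:: t.+1] (kb bl t.+1); rewrite big_seq1; apply=> // j.
by rewrite inE => /eqP->; rewrite diag.
Qed.

Lemma next_same_scale_deg t : (t < size bl)%N -> isD (Cb bl t.+1) -> next_same_scale t.+1 ->
  deg (Cb bl t.+1) = 1%N /\ deg (Cb bl t.+2) = 1%N.
Proof.
move=> ht diag [ht1 diag1 kE]; have := @diag_degs_le2 [:: t.+1; t.+2] (kb bl t.+1).
rewrite !big_cons big_nil addn0 => /(_ _ _)/wrap[|j|].
- by rewrite /= inE neq_ltn ltnSn.
- by rewrite !inE => /orP[] /eqP->; rewrite ?diag ?diag1 ?kE ?ht ?ht1.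
have := deg_gt0 blocks_ok ht; have := deg_gt0 blocks_ok ht1.
by move: (deg _) (deg _) => x y; lia_goal.
Qed.

Lemma no_third_same_scale t : (t < size bl)%N -> isD (Cb bl t.+1) -> next_same_scale t.+1 ->
  ~ next_same_scale t.+2.
Proof.
move=> ht diag next next1; have [d1 d2] := next_same_scale_deg ht diag next.
have [ht1 diag1 kE] := next; have [ht2 diag2 kE'] := next1.
have := @diag_degs_le2 [:: t.+1; t.+2; t.+3] (kb bl t.+1).
rewrite !big_cons big_nil d1 d2 addn0 => /(_ _ _)/wrap[|j|].
- by rewrite /= !inE; lia_goal.
- by rewrite !inE => /or3P[] /eqP->; rewrite ?diag ?diag1 ?diag2 ?kE' ?kE ?ht ?ht1 ?ht2.
by have := deg_gt0 blocks_ok ht2; move: (deg _); lia_goal.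
Qed.

(* How far the exponents may exceed the scale of the last block; (PO1)-(PO6) exclude the blocks that
   would then break the monotonicity of the exponents. *)
Definition exponents_controlled t (a : nat -> nat) (ss : seq nat) : Prop :=
  (0 < t)%N ->
  if isD (Cb bl t) then
    [\/ exponents_le (offset t) a (kb bl t),
        exponents_le (offset t) a (kb bl t).+1 /\
        (next_same_scale t -> exists2 s, ss = [:: s] & ~~ odd (a s + kb bl t)) |
        [/\ exponents_le (offset t) a (kb bl t).+2, ~ next_same_scale t &
         ss = [::] \/ exists s, [/\ ss = [:: s], odd (a s + kb bl t),
           xi v (Bpre bl t.-1) = 0 & (2 <= t)%N]]]
  else exponents_le (offset t) a (kb bl t).

Section NextBlock.

Variables (t : nat) (f : nat -> 'cV[F]_n) (a : nat -> nat) (ps : seq (nat * nat)) (ss : seq nat).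
Hypothesis st : stage t f a ps ss.
Hypothesis control : exponents_controlled t a ss.
Hypothesis ht : (t < size bl)%N.
Local Notation k := (offset t).
Local Notation K := (kb bl t.+1).

Lemma positive_stage l : (l < k)%N -> (0 < t)%N.
Proof. by case: t => //; rewrite take0. Qed.

Lemma same_scale_next : isD (Cb bl t.+1) -> kb bl t = K -> next_same_scale t.
Proof. by move=> diag kE; split. Qed.

Lemma diag_exponents_le : isD (Cb bl t.+1) -> exponents_le k a K.+1.
Proof.
move=> diag l lk; have t0 := positive_stage lk; have [_ [_ [PO2 _]]] := bl_preopt.
have [dd _ _ ed] := PO2 t t.+1 t0 (ltnSn t) ht.
have := control t0; case: ifP => [prev_diag|/negbT prev_even] bound; last first.
  by apply: leq_trans (bound l lk) _; rewrite -addn1; apply: ed.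
have kK := dd prev_diag diag; case: bound => [bound|[bound _]|[bound no_next _]].
- by apply: leq_trans (bound l lk) (leqW kK).
- exact: leq_trans (bound l lk) _.
apply: leq_trans (bound l lk) _; rewrite ltnS ltn_neqAle kK andbT.
by apply/eqP => kE; apply/no_next/same_scale_next.
Qed.

Lemma even_exponents_le : ~~ isD (Cb bl t.+1) -> exponents_le k a K.
Proof.
move=> even l lk; have t0 := positive_stage lk; have [_ [_ [PO2 [_ [_ [PO5 _]]]]]] := bl_preopt.
have [_ ee de _] := PO2 t t.+1 t0 (ltnSn t) ht.
have := control t0; case: ifP => [prev_diag|/negbT prev_even] bound; last first.
  by apply: leq_trans (bound l lk) (ee prev_even even).
have kK := de prev_diag even; rewrite addn1 in kK.
case: bound => [bound|[bound _]|[bound _ singles]].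
- by apply: leq_trans (bound l lk) (ltnW kK).
- exact: leq_trans (bound l lk) kK.
apply: leq_trans (bound l lk) _; rewrite ltn_neqAle kK andbT; apply/eqP => kE.
have [|_] := PO5 t t0 ht prev_diag even; first by rewrite addn1.
have := stage_invariants st; case: singles => [->|[s [-> _ xi0 t2]]].
  by move=> [/negPf-> _ /negPf->] [[]|[]].
by move=> [-> _] [[]|[_ /(_ t2)]] //; rewrite xi0 eqxx.
Qed.

Section LoneVector.

Hypothesis diag : isD (Cb bl t.+1).
Hypothesis deg1 : deg (Cb bl t.+1) = 1%N.
Hypothesis ss_odd : {in ss, forall s, odd (a s + K)}.

Lemma exponents_le_after_diag : (0 < t)%N -> isD (Cb bl t) -> exponents_le k a K.
Proof.
move=> t0 prev_diag l lk; have [_ [_ [PO2 [_ [_ [_ PO6]]]]]] := bl_preopt.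
have [/(_ prev_diag diag) kK _ _ _] := PO2 t t.+1 t0 (ltnSn t) ht.
have := control t0; rewrite prev_diag => -[bound|[bound next]|[bound no_next singles]].
- exact: leq_trans (bound l lk) kK.
- apply: leq_trans (bound l lk) _; rewrite ltn_neqAle kK andbT; apply/eqP => kE.
  have [s ssE s_even] := next (same_scale_next diag kE).
  by case/negP: s_even; rewrite kE; apply: ss_odd; rewrite ssE inE.
have kK' : (kb bl t < K)%N by rewrite ltn_neqAle kK andbT; apply/eqP => /(same_scale_next diag).
apply: leq_trans (bound l lk) _; rewrite ltn_neqAle kK' andbT; apply/eqP => kE.
case: singles => [ssE|[s [ssE s_odd _ _]]].
  have := stage_invariants st; rewrite ssE => -[k_even xi_neq0 _]; case/eqP: xi_neq0.
  by apply: (PO6 t); rewrite // -kE addn1.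
have /ss_odd : s \in ss by rewrite ssE inE.
by rewrite -kE addnS /= s_odd.
Qed.

Lemma exponents_le_after_even : (0 < t)%N -> ~~ isD (Cb bl t) -> exponents_le k a K.
Proof.
move=> t0 prev_even l lk; have [_ [_ [PO2 [_ [PO4 _]]]]] := bl_preopt.
have [_ _ _ /(_ prev_even diag) kK] := PO2 t t.+1 t0 (ltnSn t) ht; rewrite addn1 in kK.
have := control t0; rewrite (negPf prev_even) => bound.
have [le_kK|gt_kK] := leqP (kb bl t) K; first exact: leq_trans (bound l lk) le_kK.
have kE : (K + 1 = kb bl t)%N by apply/eqP; rewrite eqn_leq addn1 gt_kK.
have offE : offset t.+1 = k.+1 by rewrite offset_succ // deg1 addn1.
have norm : weq '[e k] (2 * K%:Z).
  by have := diag_block_norm (x := 0%N) blocks_ok ht diag; rewrite deg1 addn0; apply.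
have := ord_det_odd_succ st offE norm; have := stage_invariants st.
have [||] := PO4 t.+1 _ kE diag prev_even; [by rewrite !ltnS t0 | by rewrite deg1 |].
have -> : odd (offset t.+1) = ~~ odd k by rewrite offE.
move=> -[_ det_xi]; have := same_parity_singles (stage_reduced st) ss_odd.
move: ss_odd; case: ss => [|s [|//]] s_odd _.
  by move=> [/negPf k_even /eqP xi_neq0 _] _; case: det_xi; rewrite k_even => -[].
move=> [k_odd detE] detE'; case: det_xi; rewrite k_odd /= => -[] //.
by rewrite detE' detE -oddD s_odd ?inE.
Qed.

Lemma exponents_le_scale : exponents_le k a K.
Proof.
move=> l lk; have t0 := positive_stage lk; have [prev|prev] := boolP (isD (Cb bl t)).
  exact: exponents_le_after_diag.
exact: exponents_le_after_even.
Qed.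

End LoneVector.

Definition progress : Prop := exists t' (f : nat -> 'cV[F]_n) a ps ss,
  [/\ (t < t')%N, (t' <= size bl)%N, stage t' f a ps ss & exponents_controlled t' a ss].

Let tri : triangular k f a := stage_triangular st.
Let indices_k : perm_eq (indices ps ss) (iota 0 k) := stage_indices st.
Let rf : reduced bt f a ps ss := stage_reduced st.

Let mem_k l : (l \in indices ps ss) = (l < k)%N.
Proof. by rewrite (perm_mem indices_k) mem_iota. Qed.

Let k_new : k \notin indices ps ss. Proof. by rewrite mem_k ltnn. Qed.
Let k1_new : k.+1 \notin indices ps ss. Proof. by rewrite mem_k ltnNge leqnSn. Qed.

Lemma unit_vec_new q : (k <= q)%N -> {in indices ps ss, forall l, '[f l, e q] = 0}.
Proof. by move=> kq l; rewrite mem_k => lk; apply: unitriangular_orth (triangular_unit tri) lk kq. Qed.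

Lemma iota_perm_succ m I J : perm_eq J (m :: I) -> perm_eq I (iota 0 m) -> perm_eq J (iota 0 m.+1).
Proof.
move=> JI Im; apply: perm_trans JI _; rewrite -addn1 iotaD cats1 perm_sym perm_rcons perm_cons.
by rewrite perm_sym.
Qed.

Lemma triangular_add y c : integral_comb k y -> exponents_le k a c ->
  triangular k.+1 (update f k (e k + y)) (update a k c).
Proof. by move=> hy ac; apply: triangular_update => // _ _; apply: stage_boundary (ltnW ht) st. Qed.

Lemma vector_progress y c ps' ss' : offset t.+1 = k.+1 -> integral_comb k y ->
  exponents_le k a c -> perm_eq (indices ps' ss') (k :: indices ps ss) ->
  reduced bt (update f k (e k + y)) (update a k c) ps' ss' ->
  exponents_controlled t.+1 (update a k c) ss' -> progress.
Proof.
move=> offE hy ac pI rf' control'; exists t.+1, (update f k (e k + y)), (update a k c), ps', ss'.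
split=> //; split=> //; first by rewrite offE; apply: triangular_add.
by rewrite offE; apply: iota_perm_succ pI indices_k.
Qed.

Lemma two_vectors_progress t' y y' c ps' ss' : (t < t' <= size bl)%N -> offset t' = k.+2 ->
  integral_comb k y -> integral_comb k.+1 y' -> exponents_le k a c ->
  perm_eq (indices ps' ss') (k.+1 :: k :: indices ps ss) ->
  reduced bt (update (update f k (e k + y)) k.+1 (e k.+1 + y')) (update (update a k c) k.+1 c) ps' ss' ->
  exponents_controlled t' (update (update a k c) k.+1 c) ss' -> progress.
Proof.
move=> /andP[tt' ht'] offE hy hy' ac pI rf' control'.
exists t', (update (update f k (e k + y)) k.+1 (e k.+1 + y')), (update (update a k c) k.+1 c), ps', ss'.
split=> //; split=> //; rewrite offE.
  apply: triangular_update (triangular_add hy ac) hy' (exponents_le_update ac (leqnn c)) _.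
  by rewrite /= update_at ltnn.
by apply: iota_perm_succ pI (iota_perm_succ (perm_refl _) indices_k).
Qed.

Lemma indices_plane_perm : perm_eq (indices ((k, k.+1) :: ps) ss) (k.+1 :: k :: indices ps ss).
Proof.
apply: perm_trans (indices_cons_perm _ _ _ _) _.
by apply/permPl; apply: (perm_catCA [:: k] [:: k.+1]).
Qed.

Lemma even_block_progress : ~~ isD (Cb bl t.+1) -> progress.
Proof.
move=> even; have [offE norm norm' link] := even_block_plane blocks_ok ht even.
have aK := even_exponents_le even.
apply: (@two_vectors_progress t.+1 0 0 K _ _ _ offE _ _ aK indices_plane_perm).
- by rewrite ltnSn.
- exact: lincomb0.
- exact: lincomb0.
- rewrite !addr0; apply: update_add_plane => // l lI.
    by rewrite unit_vec_new // mulr0 wge0.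
  by rewrite unit_vec_new // mulr0 wge0.
by move=> _; rewrite (negPf even) offE; do 2!apply: exponents_le_update => //.
Qed.

Section DiagonalBlock.

Hypothesis diag : isD (Cb bl t.+1).

Let aK1 : exponents_le k a K.+1 := diag_exponents_le diag.

Let level_int y : level f a (indices ps ss) K%:Z y -> integral_comb k y.
Proof. exact: level_integral (triangular_unit tri) indices_k aK1. Qed.

Let e_new : orthogonal_vector bt f ps ss K (e k).
Proof.
split; first exact: unit_vec_new.
by have := diag_block_norm blocks_ok ht diag (deg_gt0 blocks_ok ht); rewrite addn0.
Qed.

Lemma new_plane_progress t' : (t < t' <= size bl)%N -> offset t' = k.+2 -> isD (Cb bl t') ->
  kb bl t' = K -> ~ next_same_scale t' -> new_plane bt f a ps ss k K (e k) (e k.+1) -> progress.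
Proof.
move=> tt' offE diag' kE no_next [y [y' [hy hy' rf']]].
apply: (two_vectors_progress tt' offE (level_int hy) _ aK1 indices_plane_perm rf').
  exact: integral_combW (leqnSn k) (level_int hy').
by move=> _; rewrite diag' offE kE; apply: Or32; split=> //; do 2!apply: exponents_le_update => //.
Qed.

Lemma even_single_split i j : ss = [:: i; j] ->
  exists i' j', perm_eq ss [:: i'; j'] /\ ~~ odd (a i' + K).
Proof.
move=> ssE; have := rf; rewrite ssE => /two_singles_parity; rewrite oddD => parity.
have [i_odd|i_even] := boolP (odd (a i + K)); last by exists i, j.
exists j, i; split; first by apply/permPl; apply: (perm_catC [:: i] [:: j]).
by move: parity i_odd; rewrite !oddD; case: (odd (a i)); case: (odd (a j)); case: (odd K).
Qed.

Section DegreeOne.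

Hypothesis deg1 : deg (Cb bl t.+1) = 1%N.

Let offE : offset t.+1 = k.+1. Proof. by rewrite offset_succ // deg1 addn1. Qed.

Lemma odd_singles_progress : {in ss, forall s, odd (a s + K)} -> progress.
Proof.
move=> ss_odd; have aK := exponents_le_scale diag deg1 ss_odd.
have [y hy rf'] := new_vector_single rf k_new e_new ss_odd.
apply: (vector_progress offE (level_int hy) aK _ rf'); first exact: perm_refl.
by move=> _; rewrite diag offE; apply: Or31; apply: exponents_le_update.
Qed.

Lemma next_same_scale_progress : next_same_scale t.+1 ->
  new_plane bt f a ps ss k K (e k) (e k.+1) -> progress.
Proof.
move=> next; have [_ d2] := next_same_scale_deg ht diag next; have [ht1 diag1 kE] := next.
apply: (new_plane_progress (t' := t.+2)) => //; first by rewrite ltnS leqnSn.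
  by rewrite offset_succ // d2 offE addn1.
exact: no_third_same_scale ht diag next.
Qed.

Lemma next_same_scale_vector : next_same_scale t.+1 ->
  orthogonal_vector bt f ps ss K (e k.+1) /\ '[e k, e k.+1] = 0.
Proof.
move=> [ht1 diag1 kE]; split; last by apply: (unit_vec_orth (t := t.+1)); rewrite offE.
split; first exact: unit_vec_new (leqnSn k).
by have := diag_block_norm blocks_ok ht1 diag1 (deg_gt0 blocks_ok ht1); rewrite addn0 offE kE.
Qed.

Lemma even_single_progress s : ss = [:: s] -> ~~ odd (a s + K) -> progress.
Proof.
move=> ssE s_even; have [r fr] := ex_single_projections rf.
have [next|no_next] := pselect (next_same_scale t.+1).
  have [e1_new ee1] := next_same_scale_vector next; apply: (next_same_scale_progress next).
  have sss : s \in ss by rewrite ssE inE.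
  apply: (new_plane_single rf k_new k1_new e_new fr e1_new ee1 sss s_even) => l.
  by rewrite ssE inE => ->.
have [[y hy rf']|[y hy rf']] := new_vector_odd rf k_new e_new fr ssE s_even.
  apply: (vector_progress offE (level_int hy) _ _ rf'); first exact: exponents_leW aK1.
    by apply: indices_cons_perm1; rewrite ssE.
  move=> _; rewrite diag offE; apply: Or33; split=> //; last by left.
  by apply: exponents_le_update => //; apply: exponents_leW aK1.
apply: (vector_progress offE (level_int hy) aK1 _ rf'); first by rewrite ssE.
by move=> _; rewrite diag offE; apply: Or32; split=> //; apply: exponents_le_update.
Qed.

Lemma two_singles_progress i j : perm_eq ss [:: i; j] -> ~~ odd (a i + K) -> progress.
Proof.
move=> ssE i_even; have [r fr] := ex_single_projections rf.
have ne l : l \in [:: i; j] -> l != k.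
  by rewrite -(perm_mem ssE) => lss; apply: contraNneq k_new => <-; apply: mem_indices_single.
have [coupled|small] := boolP (wge (2 * '[r i, r j]) ((a i)%:Z + (a j)%:Z + 3)); last first.
  have [y hy rf'] := new_vector_coupled rf k_new e_new fr ssE i_even small.
  apply: (vector_progress offE (level_int hy) aK1 _ rf').
    by apply: indices_cons_perm1; apply: perm_trans ssE _; apply/permPl; apply: (perm_catC [:: i]).
  move=> _; rewrite diag offE; apply: Or32; split; first exact: exponents_le_update.
  by exists i => //; rewrite update_ne ?ne // inE eqxx.
have [next|no_next] := pselect (next_same_scale t.+1).
  have [e1_new ee1] := next_same_scale_vector next; apply: (next_same_scale_progress next).
  exact: (new_plane_uncoupled rf k_new k1_new e_new fr ssE i_even e1_new ee1 coupled).
have [y hy rf'] := new_vector_uncoupled rf k_new e_new fr ssE i_even coupled.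
have aK2 : exponents_le k a K.+2 := exponents_leW (leqnSn _) aK1.
apply: (vector_progress offE (level_int hy) aK2 (indices_cons_perm1 _ _ ssE) rf').
move=> _; rewrite diag offE; apply: Or33; split=> //; first exact: exponents_le_update.
right; exists j; split=> //.
- rewrite update_ne ?ne ?inE ?eqxx ?orbT //; have := two_singles_parity (reduced_perm ssE rf).
  by move: i_even; rewrite !oddD; case: (odd (a i)); case: (odd (a j)); case: (odd K).
- by have := stage_invariants st; move: (perm_size ssE); case: ss => [|? [|? ?]] // _ [].
rewrite ltnS; apply: (positive_stage (l := i)); rewrite -mem_k mem_indices_single //.
by rewrite (perm_mem ssE) inE eqxx.
Qed.

End DegreeOne.

Section DegreeTwo.

Hypothesis deg2 : deg (Cb bl t.+1) = 2%N.

Let offE : offset t.+1 = k.+2. Proof. by rewrite offset_succ // deg2 addn2. Qed.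

Let e1_new : orthogonal_vector bt f ps ss K (e k.+1).
Proof.
split; first exact: unit_vec_new (leqnSn k).
by have := diag_block_norm (x := 1%N) blocks_ok ht diag; rewrite deg2 addn1; apply.
Qed.

Let ee1 : '[e k, e k.+1] = 0 := diag_block_orth ht diag deg2.

Let no_next : ~ next_same_scale t.+1.
Proof. by move=> next; have [] := next_same_scale_deg ht diag next; rewrite deg2. Qed.

Lemma block_plane_progress : new_plane bt f a ps ss k K (e k) (e k.+1) -> progress.
Proof. by apply: (new_plane_progress (t' := t.+1)) => //; rewrite ltnSn. Qed.

Lemma diag2_single_progress s : ss = [:: s] -> ~~ odd (a s + K) -> progress.
Proof.
move=> ssE s_even; have [r fr] := ex_single_projections rf; apply: block_plane_progress.
have sss : s \in ss by rewrite ssE inE.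
apply: (new_plane_single rf k_new k1_new e_new fr e1_new ee1 sss s_even) => l.
by rewrite ssE inE => ->.
Qed.

(* The second vector of the block is paired with [i] only if no single remains, which (PO3)
   excludes. *)
Lemma diag2_coupled_progress i j : perm_eq ss [:: i; j] -> ~~ odd (a i + K) ->
  xi v (Bpre bl t.+1) = 0 -> new_vector bt f a ps ss k K (e k) K.+1 ((j, k) :: ps) [:: i] -> progress.
Proof.
move=> ssE i_even xi0 [y hy rf1]; set f1 := update f k _ in rf1; set a1 := update a k _ in rf1.
have ik : i != k by apply: contraNneq k_new => <-; rewrite mem_indices_single // (perm_mem ssE) inE eqxx.
have pI1 : perm_eq (indices ((j, k) :: ps) [:: i]) (k :: indices ps ss).
  by apply: indices_cons_perm1; apply: perm_trans ssE _; apply/permPl; apply: (perm_catC [:: i]).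
have indices_k1 := iota_perm_succ pI1 indices_k.
have k1_new1 : k.+1 \notin indices ((j, k) :: ps) [:: i] by rewrite (perm_mem indices_k1) mem_iota ltnn.
have tri1 : unitriangular k.+1 f1 := unitriangular_update (triangular_unit tri) (level_int hy).
have e1_new1 : orthogonal_vector bt f1 ((j, k) :: ps) [:: i] K (e k.+1).
  split; last by case: e1_new.
  move=> l; rewrite (perm_mem pI1) inE => /orP[/eqP->|lI].
    rewrite /f1 update_at symDl ee1 add0r; apply: lincomb_orth (level_int hy) => m.
    by rewrite mem_iota => mk; apply: unit_vec_orth mk (leqnSn k).
  by rewrite /f1 update_ne ?(unit_vec_new (leqnSn k)) //; apply: contraTneq lI => ->.
have a1K : exponents_le k.+1 a1 K.+1 by apply: exponents_le_update.
have i_even1 : ~~ odd (a1 i + K) by rewrite /a1 update_ne.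
have [r fr] := ex_single_projections rf1.
have [[y' hy' rf2]|[y' hy' rf2]] := new_vector_odd rf1 k1_new1 e1_new1 fr erefl i_even1.
  have tri2 := unitriangular_update tri1 (level_integral tri1 indices_k1 a1K hy').
  have Bf : congruent (Bpre bl t.+1) (gram bt (update f1 k.+1 (e k.+1 + y')) (offset t.+1)).
    by apply: Bpre_congruent; rewrite offE.
  have pI2 : perm_eq (indices [:: (i, k.+1), (j, k) & ps] [::]) (iota 0 (offset t.+1)).
    by rewrite offE; apply: iota_perm_succ indices_k1; apply: indices_cons_perm1.
  by have [_ /eqP] := reduced_invariants rf2 Bf pI2.
apply: (two_vectors_progress (t' := t.+1) _ offE (level_int hy) _ aK1 _ rf2) => //.
- by rewrite ltnSn.
- exact: level_integral tri1 indices_k1 a1K hy'.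
- by rewrite perm_cons.
by move=> _; rewrite diag offE; apply: Or32; split=> //; apply: exponents_le_update.
Qed.

Lemma diag2_progress : progress.
Proof.
have [_ [_ [_ [PO3 _]]]] := bl_preopt; have [|_] := PO3 t.+1 _ diag deg2; first by rewrite ltnS ht.
have -> : odd (offset t.+1) = odd k by rewrite offE /= negbK.
rewrite /= => scales; have := stage_invariants st; have := size_singles rf.
case ssE : ss => [|s [|s' [|//]]] _.
- move=> [/negPf k_even /eqP xi_neq0 _]; by case: scales => -[]; rewrite k_even //= => _ [].
- move=> [k_odd detE]; apply: (diag2_single_progress ssE); case: scales => -[].
    by rewrite k_odd.
  by rewrite !oddD -detE.
move=> [/negPf k_even _]; have xi0 : xi v (Bpre bl t.+1) = 0.
  by case: scales => -[]; rewrite k_even //= => _ [].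
have [i [j [ssE' i_even]]] := even_single_split ssE; have [r fr] := ex_single_projections rf.
have [coupled|small] := boolP (wge (2 * '[r i, r j]) ((a i)%:Z + (a j)%:Z + 3)).
  apply: block_plane_progress.
  exact: (new_plane_uncoupled rf k_new k1_new e_new fr ssE' i_even e1_new ee1 coupled).
apply: (diag2_coupled_progress ssE' i_even xi0).
exact: (new_vector_coupled rf k_new e_new fr ssE' i_even small).
Qed.

End DegreeTwo.

Lemma diag_block_progress : progress.
Proof.
have := diag_deg_le2 ht diag; have := deg_gt0 blocks_ok ht; rewrite leq_eqVlt => /orP[/eqP/esym d1 _|d2 d2'].
  have := size_singles rf; case ssE : ss => [|s [|s' [|//]]] _.
  - by apply: (odd_singles_progress d1) => s; rewrite ssE.
  - have [s_odd|s_even] := boolP (odd (a s + K)); last exact: (even_single_progress d1 ssE).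
    by apply: (odd_singles_progress d1) => l; rewrite ssE inE => /eqP->.
  have [i [j [ssE' i_even]]] := even_single_split ssE; exact: (two_singles_progress d1 ssE').
by apply: diag2_progress; apply/eqP; rewrite eqn_leq d2'.
Qed.

End DiagonalBlock.
End NextBlock.

Lemma ex_final_stage : exists (f : nat -> 'cV[F]_n) a ps ss, stage (size bl) f a ps ss.
Proof.
suff step d t (f : nat -> 'cV[F]_n) a ps ss : (size bl - t <= d)%N -> (t <= size bl)%N -> stage t f a ps ss ->
    exponents_controlled t a ss -> exists (f : nat -> 'cV[F]_n) a ps ss, stage (size bl) f a ps ss.
  apply: (step (size bl) 0%N (fun=> 0) (fun=> 0%N) [::] [::]) => //; first by rewrite subn0.
  by split; [split; rewrite take0 // => c; case: c | rewrite take0 |].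
elim: d t f a ps ss => [|d IHd] t f a ps ss hd; rewrite leq_eqVlt => /orP[/eqP->|ht] st control;
  try by exists f, a, ps, ss.
  by move: hd ht; rewrite leqn0 subn_eq0 ltnNge => ->.
have [t' [f' [a' [ps' [ss' [tt' ht' st' control']]]]]] : progress t.
  have [diag|even] := boolP (isD (Cb bl t.+1)); first exact: (diag_block_progress st control ht diag).
  exact: (even_block_progress st control ht even).
by apply: (IHd t') st' control' => //; move: hd tt' ht; lia_goal.
Qed.

End PreOptimal.

(** * Gross-Keating data of a pre-optimal form *)

Definition repeated (ns ms : seq nat) : seq nat := flatten [seq nseq p.1 p.2 | p <- zip ns ms].

Lemma runs_nseq_cat m k s : (if runs s is p :: _ then p.2 != k else true) ->
  runs (nseq m.+1 k ++ s) = (m.+1, k) :: runs s.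
Proof.
move=> ks; elim: m => [|m IHm] /=; last by move: IHm => /= ->; rewrite eqxx.
by case: (runs s) ks => [|[c y] l] //= yk; rewrite eq_sym (negPf yk).
Qed.

Lemma runs_repeated ns ms : size ns = size ms -> all (fun x => 0 < x)%N ns -> sorted ltn ms ->
  runs (repeated ns ms) = zip ns ms.
Proof.
elim: ns ms => [|[|c] ns IHns] [|m ms] // [sz] pos ms_sorted.
have runsE : runs (repeated ns ms) = zip ns ms by apply: IHns => //; apply: path_sorted ms_sorted.
rewrite [zip _ _]/= [repeated _ _]/(nseq c.+1 m ++ repeated ns ms) runs_nseq_cat runsE //.
by case: ns ms ms_sorted {IHns runsE pos sz} => [|c' ns] [|m' ms] //= /andP[mm _]; rewrite gtn_eqF.
Qed.

Lemma mem_repeated ns ms x : x \in repeated ns ms -> x \in ms.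
Proof.
case/flattenP => _ /mapP[[c m] cm ->]; rewrite mem_nseq => /andP[_ /eqP->] /=.
by elim: ns ms cm => [|c' ns IHns] [|m' ms] //=; rewrite !inE => /orP[/eqP[_ ->]|/IHns->];
  rewrite ?eqxx ?orbT.
Qed.

Lemma size_repeated ns ms : size ns = size ms -> size (repeated ns ms) = sumn ns.
Proof.
rewrite /repeated; elim: ns ms => [|c ns IHns] [|m ms] //= [sz].
by rewrite size_cat size_nseq IHns.
Qed.

Lemma nth_repeated_lt ns ms j i l : size ns = size ms -> sorted ltn ms ->
  (i < sumn (take j ns))%N -> (sumn (take j ns) <= l < sumn ns)%N ->
  (nth 0 (repeated ns ms) i < nth 0 (repeated ns ms) l)%N.
Proof.
move=> sz ms_sorted ij /andP[jl ln].
have szt : size (take j ns) = size (take j ms) by rewrite !size_take sz.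
have -> : repeated ns ms = repeated (take j ns) (take j ms) ++ repeated (drop j ns) (drop j ms).
  by rewrite /repeated -flatten_cat -map_cat -zip_cat ?cat_take_drop.
rewrite !nth_cat size_repeated // ij [(l < _)%N]ltnNge jl /=.
have low : nth 0%N (repeated (take j ns) (take j ms)) i \in take j ms.
  by apply: (@mem_repeated (take j ns)); rewrite mem_nth // size_repeated.
have high : nth 0%N (repeated (drop j ns) (drop j ms)) (l - sumn (take j ns)) \in drop j ms.
  apply: (@mem_repeated (drop j ns)); rewrite mem_nth // size_repeated ?size_drop ?sz //.
  by rewrite ltn_subLR // -sumn_cat cat_take_drop.
move: ms_sorted; rewrite -{1}(cat_take_drop j ms) (sorted_pairwise ltn_trans) pairwise_cat.
by case/andP => /allrelP lt _; apply: lt.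
Qed.

Lemma sumn_take_gt0 ns j : all (fun x => 0 < x)%N ns -> (1 <= j <= size ns)%N ->
  (0 < sumn (take j ns))%N.
Proof. by case: ns j => [|x ns] [|j] //= /andP[x0 _] _; apply: ltn_addr. Qed.

Lemma sumn_take_le ns j : (sumn (take j ns) <= sumn ns)%N.
Proof. by rewrite -[in leqRHS](cat_take_drop j ns) sumn_cat leq_addr. Qed.

Section Similarity.

Variable n : nat.
Implicit Types M U W : 'M[F]_n.

Lemma GLo_unitmx U : GLo v U -> U \in unitmx.
Proof. by move=> /GLoP[_ dU]; rewrite unitmxE unitfE (weq_neq0 dU). Qed.

Lemma GLo_mul U W : GLo v U -> GLo v W -> GLo v (U *m W).
Proof.
move=> /GLoP[U_int dU] /GLoP[W_int dW]; apply/GLoP; split.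
  by move=> i j; rewrite mxE; apply: wge_sum => k _; apply: (wgeM (U_int _ _) (W_int _ _)).
by rewrite det_mulmx; apply: (weqM dU dW).
Qed.

Lemma GLo_inv U : GLo v U -> GLo v (invmx U).
Proof.
move=> /GLoP[U_int dU]; apply/GLoP; split; last by rewrite det_inv; have := weqV dU; rewrite oppr0.
move=> i j; have := @wge_invmx _ U (fun=> 0) dU _ i j; rewrite /= subrr; exact.
Qed.

Lemma congr_invmx M U W : U \in unitmx ->
  (invmx U *m W)^T *m (U^T *m M *m U) *m (invmx U *m W) = W^T *m M *m W.
Proof.
move=> uU; rewrite trmx_mul trmx_inv !mulmxA -[_ *m U *m invmx U]mulmxA mulmxV // mulmx1.
by rewrite -[W^T *m invmx _ *m _]mulmxA mulVmx ?unitmx_tr // mulmx1.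
Qed.

Lemma invmx_quotient U W : U \in unitmx -> W \in unitmx ->
  invmx (invmx W *m U) = invmx U *m W.
Proof.
move=> uU uW; have uWU : invmx W *m U \in unitmx by rewrite unitmx_mul unitmx_inv uW.
by rewrite -[RHS](mulKmx uWU) -!mulmxA [U *m _]mulKVmx // mulVmx ?mulmx1.
Qed.

Lemma inSU_sim M M' a : sim v M M' -> inSU v M a <-> inSU v M' a.
Proof.
move=> [U [hU ->]]; split=> -[W [hW inS_a]].
  exists (invmx U *m W); rewrite congr_invmx ?GLo_unitmx //.
  by split; first exact: GLo_mul (GLo_inv hU) hW.
exists (U *m W); split; first exact: GLo_mul.
by rewrite trmx_mul !mulmxA in inS_a *.
Qed.

Lemma GK_sim M M' : sim v M M' -> GK v M = GK v M'.
Proof.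
move=> MM'; rewrite /GK (_ : inSU v M = inSU v M') //.
by apply/funext => a; apply/propext/inSU_sim.
Qed.

End Similarity.

Lemma mxe_ord m (M : 'M[F]_m) (i j : 'I_m) : mxe M i j = M i j.
Proof. by rewrite /mxe !valK. Qed.

Lemma mxe_out m (M : 'M[F]_m) i j : ~~ ((i < m)%N && (j < m)%N) -> mxe M i j = 0.
Proof.
rewrite /mxe negb_and => /orP[/negPf im|/negPf jm]; first by rewrite insubF.
by rewrite [insub j]insubF //; case: (insub i).
Qed.

Lemma mxe_ulsub_assemble (bl : seq (nat * blk F)) t x y :
  mxe (ulsub (degs (take t bl)) (assemble bl)) x y = mxe (Bpre bl t) x y.
Proof.
have [/andP[hx hy]|out] := boolP ((x < degs (take t bl))%N && (y < degs (take t bl))%N); last first.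
  by rewrite !mxe_out.
have [hx' hy'] := (leq_trans hx (offset_le bl t), leq_trans hy (offset_le bl t)).
rewrite (mxe_ord _ (Ordinal hx) (Ordinal hy)) (mxe_ord (Bpre bl t) (Ordinal hx) (Ordinal hy)) !mxE /=.
by rewrite (mxe_ord _ (Ordinal hx') (Ordinal hy')) mxE ent_take.
Qed.

Section OptimalBasis.

Variable bl : seq (nat * blk F).
Local Notation offset t := (degs (take t bl)).
Local Notation n := (degs bl).
Local Notation e := (unit_vec bl).
Local Notation B := (assemble bl).
Local Notation bt := (symmx_form (assemble_sym bl)).
Local Notation "''[' x , y ]" := (bt x y) : ring_scope.
Local Notation "''[' x ]" := (bt x x) : ring_scope.

Variables (f : nat -> 'cV[F]_n) (a : nat -> nat) (ps : seq (nat * nat)) (ss : seq nat).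
Hypothesis st : stage (size bl) f a ps ss.

Let tri : triangular n f a.
Proof. by have := stage_triangular st; rewrite take_size. Qed.

Let indices_n : perm_eq (indices ps ss) (iota 0 n).
Proof. by have := stage_indices st; rewrite take_size. Qed.

Definition basis_mx : 'M[F]_n := \matrix_(i, j) f j i 0.

Lemma integral_comb_entry l x (i : 'I_n) : integral_comb l x ->
  wge (x i 0) 0 /\ ((l <= i)%N -> x i 0 = 0).
Proof.
elim: x / => [|x m c _ [x_int x0] ml hc]; first by rewrite mxE wge0.
rewrite !mxE; split.
  apply: wgeD x_int _; apply: (wgeM_le hc (l := 0)) => //.
  by case: (_ == _); rewrite ?wge1 ?wge0.
move=> li; rewrite x0 // add0r (_ : (i == m :> nat) = false) ?mulr0 //.
by move: ml; rewrite mem_iota /= => ml; rewrite gtn_eqF // (leq_trans ml).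
Qed.

Lemma unitriangular_entry (i j : 'I_n) :
  [/\ wge (basis_mx i j) 0, basis_mx j j = 1 & ((j < i)%N -> basis_mx i j = 0)].
Proof.
have entryE (l : 'I_n) : basis_mx l j = (f j - e j) l 0 + (l == j :> nat)%:R by rewrite !mxE subrK.
have fj := triangular_unit tri (ltn_ord j); rewrite !entryE; split.
- by apply: wgeD (integral_comb_entry i fj).1 _; case: (_ == _); rewrite ?wge1 ?wge0.
- by rewrite (integral_comb_entry j fj).2 // add0r eqxx.
by move=> ji; rewrite (integral_comb_entry i fj).2 ?(ltnW ji) // add0r gtn_eqF.
Qed.

Lemma basis_mx_GLo : GLo v basis_mx.
Proof.
apply/GLoP; split=> [i j|]; first by case: (unitriangular_entry i j).
rewrite -det_tr det_trig; last first.
  by apply/is_trig_mxP => i j ij; rewrite mxE; case: (unitriangular_entry j i) => _ _ ->.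
by rewrite big1 ?weq1 // => i _; rewrite mxE; case: (unitriangular_entry i i).
Qed.

Lemma congr_basis_mx : basis_mx^T *m B *m basis_mx = gram bt f n.
Proof.
have colE (j : 'I_n) : f j = col j basis_mx by apply/colP => i; rewrite !mxE.
by apply/matrixP => i j; rewrite [RHS]mxE !colE symmx_formE qform_col.
Qed.

Lemma sim_gram : sim v B (gram bt f n).
Proof. by exists basis_mx; rewrite congr_basis_mx; split=> //; apply: basis_mx_GLo. Qed.

Lemma gram_sym : (gram bt f n)^T = gram bt f n.
Proof. by apply/matrixP => i j; rewrite !mxE symC. Qed.

Lemma f_bounded : bounded bt f a (iota 0 n).
Proof.
have [diag off] := reduced_bounded (stage_reduced st).
by split=> [i|i j]; rewrite -!(perm_mem indices_n); [apply: diag | apply: off].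
Qed.

Lemma gram_inS : inS v (gram bt f n) (mkseq a n).
Proof.
apply/(inSP _ gram_sym); split; first exact: (triangular_mono tri).
  by move=> i; rewrite mxE; apply: f_bounded.1; rewrite mem_iota /=.
by move=> i j; rewrite mxE; apply: (bounded_form f_bounded); rewrite mem_iota /=.
Qed.

Lemma jump_boundary c : (0 < c <= n)%N -> ((c < n)%N -> (a c.-1 < a c)%N) -> boundary_reduced f a c.
Proof.
move=> /andP[c0]; rewrite leq_eqVlt => /orP[/eqP-> _|cn lt].
  by have := stage_boundary (leqnn _) st; rewrite take_size.
by apply: (triangular_jump tri); [rewrite c0 | apply: lt].
Qed.

Lemma gram_nonsingular : graded_nonsingular (gram bt f n) a.
Proof.
apply: (gram_graded_nonsingular f_bounded) => m.
pose k := find (fun i => (m < a i)%N) (iota 0 n).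
have kn : (k <= n)%N by rewrite -[leqRHS](size_iota 0 n) find_size.
have le_m i : (i < k)%N -> (a i <= m)%N.
  by move=> ik; have := before_find 0%N ik; rewrite nth_iota ?(leq_trans ik) // => /negbT; rewrite -leqNgt.
have gt_m : (k < n)%N -> (m < a k)%N.
  move=> k_lt; have jump : has (fun i => (m < a i)%N) (iota 0 n) by rewrite has_find size_iota.
  by have := nth_find 0%N jump; rewrite nth_iota.
have k_cut i : (i < n)%N -> (i < k)%N = (a i <= m)%N.
  move=> iN; have [ik|ki] := ltnP i k; first by rewrite le_m.
  apply/esym/negbTE; rewrite -ltnNge; apply: leq_trans (gt_m (leq_ltn_trans ki iN)) _.
  by apply: (triangular_mono tri); rewrite ki.
have [k0|k_gt0] := posnP k.
  by exists 0%N, [::], [::]; split=> // i /k_cut; rewrite k0.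
have [||_ [ps' [ss' [_ _ pI rf']]]] := @jump_boundary k; first by rewrite k_gt0.
  by move=> /gt_m; apply: leq_ltn_trans; apply: le_m; rewrite prednK.
by exists k, ps', ss'.
Qed.

Lemma GK_assemble : GK v B = mkseq a n.
Proof.
rewrite (GK_sim sim_gram).
exact: GK_graded_nonsingular gram_sym gram_inS gram_nonsingular.
Qed.

Lemma optimal_gram : optimal v (gram bt f n).
Proof. by rewrite /optimal -(GK_sim sim_gram) GK_assemble; apply: gram_inS. Qed.

Section OptimalRepresentative.

Variables (M U : 'M[F]_n).
Hypotheses (U_GLo : GLo v U) (ME : M = U^T *m B *m U) (M_optimal : optimal v M).

Let Z : 'M[F]_n := invmx U *m basis_mx.
Let u (j : nat) : 'cV[F]_n := \col_i mxe U i j.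

Let u_ord (j : 'I_n) : u j = col j U.
Proof. by apply/colP => i; rewrite !mxE mxe_ord. Qed.

Let form_u (i j : 'I_n) : '[u i, u j] = M i j.
Proof. by rewrite !u_ord symmx_formE qform_col -ME. Qed.

Let M_sym : M^T = M.
Proof. by rewrite ME !trmx_mul trmxK assemble_sym mulmxA. Qed.

Let M_inS : inS v M (mkseq a n).
Proof. by rewrite -GK_assemble (GK_sim (M' := M)) //; exists U. Qed.

Let u_bounded : bounded bt u a (iota 0 n).
Proof.
have [_ diag off] := (inSP a M_sym).1 M_inS; split.
  by move=> i; rewrite mem_iota => iN; have := diag (Ordinal iN); rewrite -form_u.
by move=> i j; rewrite !mem_iota => iN jN _; have := off (Ordinal iN) (Ordinal jN); rewrite -form_u.
Qed.

Let Z_level i j : (i < n)%N -> (j < n)%N ->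
  wge (mxe Z i j) 0 /\ wge (mxe Z i j) ((a j)%:Z - (a i)%:Z).
Proof.
move=> iN jN; rewrite -[i]/(nat_of_ord (Ordinal iN)) -[j]/(nat_of_ord (Ordinal jN)) mxe_ord.
have uT := GLo_unitmx basis_mx_GLo.
have /GLoP[Z_int dZ] : GLo v Z := GLo_mul (GLo_inv U_GLo) basis_mx_GLo.
split; first exact: Z_int.
have /GLoP[W_int dW] := GLo_mul (GLo_inv basis_mx_GLo) U_GLo.
have WE : (invmx basis_mx *m U)^T *m gram bt f n *m (invmx basis_mx *m U) = M.
  by rewrite -congr_basis_mx congr_invmx // -ME.
have [_ diag off] := (inSP a M_sym).1 M_inS; rewrite -WE in diag off.
rewrite /Z -(invmx_quotient (GLo_unitmx U_GLo) uT).
exact: base_change_inv_level gram_nonsingular W_int dW diag off (fun=> erefl) _ _.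
Qed.

Let truncation c j : 'cV[F]_n := \sum_(i <- iota 0 c) mxe Z i j *: u i.

Let truncation_all j : (j < n)%N -> truncation n j = f j.
Proof.
move=> jN; have -> : truncation n j = \sum_(i < n) mxe Z i j *: u i.
  by rewrite -(big_mkord xpredT (fun i => mxe Z i j *: u i)) /index_iota subn0.
have UZ : basis_mx = U *m Z by rewrite mulmxA mulmxV ?mul1mx // GLo_unitmx.
apply/colP => x; have -> : f j x 0 = basis_mx x (Ordinal jN) by rewrite mxE.
rewrite UZ !mxE summxE; apply: eq_bigr => i _.
by rewrite u_ord [LHS]mxE [col _ _ _ _]mxE -(mxe_ord Z) mulrC.
Qed.

Section Boundary.

Variable c : nat.
Hypotheses (cn : (c <= n)%N) (jump : forall i l, (i < c)%N -> (c <= l < n)%N -> (a i < a l)%N).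

Lemma truncation_graded_eq I : {subset I <= iota 0 c} -> graded_eq bt f (truncation c) a I.
Proof.
move=> Ic; have lt j : j \in I -> (j < c)%N by move/Ic; rewrite mem_iota.
apply: (level_graded_eq u_bounded) => j /lt jc; have jN := leq_trans jc cn.
  rewrite -truncation_all //; apply: lincomb_sum => // i; rewrite mem_iota => iN.
  exact: (Z_level iN jN).2.
have -> : truncation c j - f j = \sum_(i <- iota c (n - c)) (- mxe Z i j) *: u i.
  rewrite -truncation_all // /truncation (_ : iota 0 n = iota 0 c ++ iota c (n - c)).
    rewrite big_cat opprD addrA subrr sub0r -sumrN; apply: eq_bigr => i _.
    by rewrite scaleNr.
  by rewrite -iotaD subnKC.
apply: lincomb_sum => [i|i]; rewrite !mem_iota subnKC // => /andP[ci iN]; first exact: iN.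
rewrite wgeN; apply: wgeW (Z_level iN jN).1 _; have := jump jc (_ : (c <= i < n)%N).
by rewrite ci iN => /(_ isT); move: (a i) (a j); lia_goal.
Qed.

Lemma ulsub_congruent : congruent (ulsub c M) (gram bt (truncation c) c).
Proof.
have -> : ulsub c M = gram bt u c.
  apply/matrixP => i j; rewrite !mxE; have [iN jN] := (leq_trans (ltn_ord i) cn, leq_trans (ltn_ord j) cn).
  by rewrite (mxe_ord M (Ordinal iN) (Ordinal jN)) -form_u.
by apply: gram_congruent (perm_refl _) _ => j _; apply: lincomb_sum.
Qed.

End Boundary.

Lemma zeta_ulsub_boundary t : boundary_reduced f a (offset t) ->
  (forall i l, (i < offset t)%N -> (offset t <= l < n)%N -> (a i < a l)%N) ->
  zeta v (ulsub (offset t) M) = zeta v (Bpre bl t).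
Proof.
move=> [_ [ps' [ss' [_ _ pI rf']]]] jump; have tn := offset_le bl t.
have trunc : graded_eq bt f (truncation (offset t)) a (indices ps' ss').
  by apply: (truncation_graded_eq tn jump) => i; rewrite (perm_mem pI).
have Bf : congruent (Bpre bl t) (gram bt f (offset t)).
  by apply: Bpre_congruent => l lt; apply: (triangular_unit tri); apply: leq_trans lt tn.
exact/esym/(zeta_graded_eq rf' trunc pI Bf (ulsub_congruent tn)).
Qed.

End OptimalRepresentative.

Lemma ex_boundary_block c : (0 < c <= n)%N ->
  (forall i l, (i < c)%N -> (c <= l < n)%N -> (a i < a l)%N) ->
  exists t, [/\ (1 <= t <= size bl)%N, c = offset t &
    forall M, sim v B M -> optimal v M -> zeta v (ulsub c M) = zeta v (Bpre bl t)].
Proof.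
move=> /andP[c0 cn] jump; have cut : boundary_reduced f a c.
  apply: jump_boundary; first by rewrite c0.
  by move=> c_lt; apply: jump; rewrite ?prednK ?leqnn.
have [t [_ [_ [ht offE _ _]]]] := cut; exists t; split=> //.
  by rewrite ht andbT lt0n; apply: contraTneq c0 => t0; rewrite -offE t0 take0.
by move=> M [U [U_GLo ME]] M_opt; subst c; apply: (zeta_ulsub_boundary U_GLo ME).
Qed.

Lemma ex_run_block ns ms j : size ns = size ms -> all (fun x => 0 < x)%N ns -> sorted ltn ms ->
  GK v B = repeated ns ms -> (1 <= j <= size ns)%N -> exists t,
    [/\ (1 <= t <= size bl)%N, sumn (take j ns) = offset t &
        forall M, sim v B M -> optimal v M ->
          zeta v (ulsub (sumn (take j ns)) M) = zeta v (Bpre bl t)].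
Proof.
move=> sz pos ms_sorted GKE j_range; have aE : mkseq a n = repeated ns ms by rewrite -GKE GK_assemble.
have nE : sumn ns = n by rewrite -(size_repeated sz) -aE size_mkseq.
apply: ex_boundary_block => [|i l ij /andP[jl ln]].
  by rewrite (sumn_take_gt0 pos j_range) -nE sumn_take_le.
rewrite -(nth_mkseq 0%N a (leq_trans ij (leq_trans jl (ltnW ln)))) -(nth_mkseq 0%N a ln) aE.
by apply: (nth_repeated_lt sz ms_sorted ij); rewrite jl nE.
Qed.

End OptimalBasis.

Lemma EGK_optimal n (B : 'M[F]_n) ns ms : (exists2 M, sim v B M & optimal v M) ->
  runs (GK v B) = zip ns ms -> size ns = size ms -> exists M, [/\ sim v B M, optimal v M &
    EGK v B = (ns, ms, [seq zeta v (ulsub (sumn (take j ns)) M) | j <- iota 1 (size ns)])].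
Proof.
move=> [M0 BM0 M0_opt] runsE sz; pose P M := sim v B M /\ optimal v M.
have [BM M_opt] : P (classical_sets.xget B P).
  by apply: (@classical_sets.xgetPex _ B P); exists M0.
exists (classical_sets.xget B P); split=> //.
by rewrite /EGK -(GK_sim BM) runsE -/(unzip1 _) -/(unzip2 _) unzip1_zip ?unzip2_zip ?sz.
Qed.

End Dyadic.

Theorem theorem4p2 (F : fieldType) (v : F -> int) (HF : unram2 v)
    (bl : seq (nat * blk F)) (ns ms : seq nat) :
  all (fun p => blk_ok v p.2) bl ->
  in_Hn v (assemble bl) ->
  pre_optimal v bl ->
  size ns = size ms -> all (fun x => 0 < x)%N ns -> sorted ltn ms ->
  GK v (assemble bl) = flatten [seq nseq p.1 p.2 | p <- zip ns ms] ->
  exists l : nat -> nat,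
    (forall j : nat, (1 <= j <= size ns)%N ->
       [/\ (1 <= l j <= size bl)%N,
           sumn (take j ns) = degs (take (l j) bl) &
           forall a b : nat,
             mxe (ulsub (sumn (take j ns)) (assemble bl)) a b =
             mxe (Bpre bl (l j)) a b]) /\
    EGK v (assemble bl) =
      (ns, ms, [seq zeta v (Bpre bl (l j)) | j <- iota 1 (size ns)]).
Proof.
move=> blocks_ok _ preopt sz pos ms_sorted GKE.
have [f [a [ps [ss st]]]] := ex_final_stage HF blocks_ok preopt.
have /choice[l lP] : forall j, exists t, (1 <= j <= size ns)%N ->
    [/\ (1 <= t <= size bl)%N, sumn (take j ns) = degs (take t bl) &
      forall M, sim v (assemble bl) M -> optimal v M ->
        zeta v (ulsub (sumn (take j ns)) M) = zeta v (Bpre bl t)].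
  move=> j; have [j_range|_] := boolP (1 <= j <= size ns)%N; last by exists 0%N.
  by have [t tP] := ex_run_block HF st sz pos ms_sorted GKE j_range; exists t.
exists l; split=> [j /lP[l_range lE _]|].
  by split=> // x y; rewrite lE mxe_ulsub_assemble.
have runsE : runs (GK v (assemble bl)) = zip ns ms by rewrite GKE runs_repeated.
have opt := ex_intro2 _ _ _ (sim_gram HF st) (optimal_gram HF st).
have [M [BM M_opt ->]] := EGK_optimal HF opt runsE sz.
congr (_, _); apply/eq_in_map => j; rewrite mem_iota add1n ltnS => /lP[_ _ zetaE].
exact: zetaE.
Qed.
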